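(* Let $\{T(t)\}_{t\in\mathbb{R}}$ be a weakly measurable operator group consisting of unitary operators on $L^2(\mathbb{R})$. Suppose that for each $t\in\mathbb{R}$, $T(t)$ is semistable, translation-invariant, symmetric, and locally uniformly continuous (LUC) under dilation. Then there exist constants $\alpha,\beta\in\mathbb{R}$ such that $$\widehat{T(t)f}(\xi)=e^{i\beta t|\xi|^\alpha}\hat f(\xi)\quad\text{for a.e. }\xi\in\mathbb{R},\qquad\text{for all } f\in L^2(\mathbb{R}),\ t\in\mathbb{R}.$$ Moreover, if $T(t)\not\equiv I$ (i.e. $T(t)\ne I$ for some $t\in\mathbb{R}$, where $I$ is the identity operator), then the constants $\alpha,\beta$ are uniquely determined by $\{T(t)\}_{t\in\mathbb{R}}$.
   Context: $L^2(\mathbb{R})$ is the space of complex-valued Lebesgue square-integrable functions on $\mathbb{R}$ modulo a.e. equality, with inner product $\langle f,g\rangle=\int_{\mathbb{R}} f\overline{g}\,dx$, and $\mathscr{L}(L^2(\mathbb{R}))$ is the space of bounded linear operators on it. The Fourier transform is the unitary one, $\hat f(\xi)=\frac{1}{\sqrt{2\pi}}\int_{\mathbb{R}} f(x)e^{-i\xi x}\,dx$ (extended to $L^2$ as usual). For $\lambda\in\mathbb{R}\setminus\{0\}$ and $a\in\mathbb{R}$, set $\delta_\lambda f(x)=\frac{1}{|\lambda|}f(x/\lambda)$ and $\tau_a f(x)=f(x-a)$. For $T\in\mathscr{L}(L^2(\mathbb{R}))$ and $\lambda\in\mathbb{R}\setminus\{0\}$, set $T_\lambda=\delta_\lambda\,T\,\delta_{\lambda^{-1}}$.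 For $R>1$, $L^2_R(\mathbb{R})=\{f\in L^2(\mathbb{R}): \hat f(\xi)=0 \text{ for a.e. }\xi\text{ with }|\xi|<R^{-1}\text{ or }|\xi|>R\}$. Definitions for $T\in\mathscr{L}(L^2(\mathbb{R}))$: - $T$ is semistable if there exist constants $a,b>0$ such that $T^2=T_a$ and $T^3=T_b$. - $T$ is translation-invariant if $\tau_{-a}T\tau_a=T$ for all $a\in\mathbb{R}$. - $T$ is symmetric if $T_{-1}=T$. - $T$ is locally uniformly continuous (LUC) under dilation if for every $R>1$ the map $\lambda\mapsto T_\lambda|_{L^2_R(\mathbb{R})}$, from $(0,\infty)$ to the bounded operators $L^2_R(\mathbb{R})\to L^2(\mathbb{R})$, is continuous with respect to the operator norm. A family $\{T(t)\in\mathscr{L}(L^2(\mathbb{R}))\}_{t\in\mathbb{R}}$ is an operator group if $T(0)=I$ and $T(t_1+t_2)=T(t_1)T(t_2)$ for all $t_1,t_2\in\mathbb{R}$. It is weakly measurable if for all $f,g\in L^2(\mathbb{R})$ the function $t\mapsto\langle T(t)f,g\rangle$ is Lebesgue measurable on $\mathbb{R}$. *)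

(* Defs.v *)
From mathcomp Require Import all_boot all_order all_algebra.
From mathcomp Require Import all_classical all_reals all_analysis.
From mathcomp Require Import measurable_realfun complex.

Set Implicit Arguments.
Unset Strict Implicit.
Unset Printing Implicit Defensive.

Import Order.TTheory GRing.Theory Num.Theory.
Import numFieldNormedType.Exports.

Local Open Scope classical_set_scope.
Local Open Scope ring_scope.

(* Elements of L^2(R) are represented by Borel functions R -> R[i] of finite
   L^2 norm; every class modulo a.e. equality has such a representative, and
   aeeq is equality in L^2(R).
   An operator on L^2(R) is represented by a map on functions that sends L^2
   to L^2 and is compatible with aeeq on L^2; its values outside L^2 are
   irrelevant, and equality of operators is opeq. *)

Section L2.
Context {R : realType}.
Implicit Types (f g : R -> R[i]) (T S : (R -> R[i]) -> (R -> R[i])).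

Local Notation mu := (@lebesgue_measure R).

Definition aeeq f g : Prop := {ae mu, forall x, f x = g x}.

Definition normL2 f : \bar R :=
  Lnorm mu 2%:E (fun x => (Normc.normc (f x))%:E).

Definition L2 : set (R -> R[i]) :=
  [set f | [/\ measurable_fun [set: measurableTypeR R] (fun x => complex.Re (f x)),
               measurable_fun [set: measurableTypeR R] (fun x => complex.Im (f x)) &
               (normL2 f < +oo)%E]].

Definition cintegral (D : set R) f : R[i] :=
  Complex (\int[mu]_(x in D) complex.Re (f x))
          (\int[mu]_(x in D) complex.Im (f x)).

Definition inner f g : R[i] := cintegral setT (fun x => f x * conjc (g x)).

(* expi t is e^{it} *)
Definition expi (t : R) : R[i] := Complex (cos t) (sin t).

Definition fourier_trunc (n : nat) f (xi : R) : R[i] :=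
  ((Num.sqrt (2 * pi))^-1)%:C%C *
  cintegral `[- n%:R, n%:R] (fun x => f x * expi (- (xi * x))).

(* The unitary Fourier transform on L^2, as the limit in L^2 norm of the
   Fourier integrals of the truncations of f to [-n, n], which lie in
   L^1 and L^2. The limit is chosen up to aeeq; it exists for f in L^2
   by Plancherel's theorem. *)
Definition fourier f : R -> R[i] :=
  xget 0 [set g | L2 g /\
    normL2 (fun xi => fourier_trunc n f xi - g xi) @[n --> \oo] --> 0%E].

Definition L2band (r : R) : set (R -> R[i]) :=
  [set f | L2 f /\
    {ae mu, forall xi, `|xi| < r^-1 \/ r < `|xi| -> fourier f xi = 0}].

Definition dil (l : R) f : R -> R[i] := fun x => (`|l|^-1)%:C%C * f (x / l).

Definition transl (a : R) f : R -> R[i] := fun x => f (x - a).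

Definition opeq T S : Prop := forall f, L2 f -> aeeq (T f) (S f).

Definition bounded_operator T : Prop :=
  [/\ forall f, L2 f -> L2 (T f),
      forall f g, L2 f -> L2 g -> aeeq f g -> aeeq (T f) (T g),
      forall (c : R[i]) f g, L2 f -> L2 g ->
        aeeq (T (fun x => c * f x + g x)) (fun x => c * T f x + T g x) &
      exists C : R, forall f, L2 f -> (normL2 (T f) <= C%:E * normL2 f)%E].

Definition unitary_operator T : Prop :=
  [/\ bounded_operator T,
      forall f g, L2 f -> L2 g -> inner (T f) (T g) = inner f g &
      forall g, L2 g -> exists2 f, L2 f & aeeq (T f) g].

Definition opdil (l : R) T : (R -> R[i]) -> (R -> R[i]) :=
  dil l \o T \o dil l^-1.

Definition semistable T : Prop :=
  exists a b : R, [/\ 0 < a, 0 < b,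
    opeq (T \o T) (opdil a T) & opeq (T \o T \o T) (opdil b T)].

Definition translation_invariant T : Prop :=
  forall a : R, opeq (transl (- a) \o T \o transl a) T.

Definition symmetric_operator T : Prop := opeq (opdil (-1) T) T.

Definition opnorm_on (V : set (R -> R[i])) T : \bar R :=
  ereal_sup [set normL2 (T f) | f in [set f | V f /\ (normL2 f <= 1)%E]].

(* Convergence to 0 of the operator norm of the difference is continuity at l0
   in operator norm; as l0 > 0, only l > 0 matter near l0. *)
Definition LUC T : Prop :=
  forall r : R, 1 < r -> forall l0 : R, 0 < l0 ->
    opnorm_on (L2band r) (fun f x => opdil l T f x - opdil l0 T f x)
      @[l --> l0] --> 0%E.

Definition operator_group (T : R -> (R -> R[i]) -> (R -> R[i])) : Prop :=
  opeq (T 0) id /\ forall t1 t2, opeq (T (t1 + t2)) (T t1 \o T t2).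

(* measurability for the sigma-algebra of Lebesgue measurable sets,
   i.e. the completion of the Borel sigma-algebra *)
Definition lebesgue_measurable_fun (h : R -> R) : Prop :=
  measurable_fun [set: g_sigma_algebraType (completed_algebra_gen mu)]
    (h : g_sigma_algebraType (completed_algebra_gen mu) -> R).

Definition weakly_measurable (T : R -> (R -> R[i]) -> (R -> R[i])) : Prop :=
  forall f g, L2 f -> L2 g ->
    lebesgue_measurable_fun (fun t => complex.Re (inner (T t f) g)) /\
    lebesgue_measurable_fun (fun t => complex.Im (inner (T t f) g)).

Definition has_power_symbol (T : R -> (R -> R[i]) -> (R -> R[i]))
    (alpha beta : R) : Prop :=
  forall (f : R -> R[i]) (t : R), L2 f ->
    {ae mu, forall xi,
      fourier (T t f) xi = expi (beta * t * `|xi| `^ alpha) * fourier f xi}.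

End L2.

(* Main.v *)
Require Import Defs.
From HB Require Import structures.
From mathcomp Require Import all_boot all_order all_algebra.
From mathcomp Require Import all_classical all_reals all_analysis.
From mathcomp Require Import measurable_realfun complex ring lra.

(* A translation-invariant unitary operator is multiplication by a unimodular
   symbol m on the Fourier side. Testing LUC on indicators of intervals shows
   that the averages of m over small intervals centred at x > 0 are
   equicontinuous in ln x, so that m has a version w (ln x) with w continuous.
   Semistability reads w (s + u) = w s ^ 2 and w (s + v) = w s ^ 3; a continuous
   logarithm phi of w can be normalised so that phi (s + u) = 2 phi s and
   phi (s + v) = 3 phi s. Hence phi s e^(-al s), with al = ln 2 / u, has the
   periods u and v, and these are incommensurable because ln 2 / ln 3 is
   irrational; so phi s = be e^(al s), i.e. m xi = exp(i be |xi|^al).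
   In a group all nontrivial elements have the same exponent al, the coefficient
   be is additive in t and, by weak measurability, Lebesgue measurable, hence
   linear.
   Plancherel's theorem is obtained from the Poisson kernel: its convolution
   with h is the transform of e^(-e|x|) times the transform of h. *)

Set Implicit Arguments.
Unset Strict Implicit.
Unset Printing Implicit Defensive.

Import Order.TTheory GRing.Theory Num.Theory.
Import numFieldNormedType.Exports.

Local Open Scope classical_set_scope.
Local Open Scope ring_scope.

(** * Complex numbers and complex-valued integrals *)

(** Only e^(i phi) is visible, so identities between phases hold modulo 2 pi. Continuity removes the
    ambiguity: a continuous function with values in 2 pi Z is constant. The constant of the first
    relation is absorbed into phi; that of the second is then 0, as evaluating phi (s + u + v) in
    two orders shows. The relation for T^2 alone would leave an arbitrary u-periodic factor in front
    of e^(al s). The relation for T^3 supplies the second period, once the factor by which the shift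
    v multiplies the periodic part is known to be 1; this follows from boundedness of that part,
    used for v and for -v. The exponent is kept nonzero throughout: al = 0 would determine be only
    modulo 2 pi. Nonzero al also makes |xi|^al take every positive value x, so that be is recovered
    from the functions sin (be x) as the limit of n sin (be / n). Intervals serve as test functions
    everywhere: their transforms and Poisson convolutions are explicit, and their squared L^2 norm
    is their length, which cancels the normalisation of an average. *)

Notation normc := Normc.normc.
Notation Re := complex.Re.
Notation Im := complex.Im.

Arguments Normc.normc : simpl never.

Section complex_numbers.
Context {R : realType}.
Implicit Types z w : R[i].

Lemma ReD z w : Re (z + w) = Re z + Re w. Proof. by case: z w => ? ? [? ?]. Qed.
Lemma ImD z w : Im (z + w) = Im z + Im w. Proof. by case: z w => ? ? [? ?]. Qed.
Lemma ReN z : Re (- z) = - Re z. Proof. by case: z. Qed.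
Lemma ImN z : Im (- z) = - Im z. Proof. by case: z. Qed.
Lemma ReB z w : Re (z - w) = Re z - Re w. Proof. by rewrite ReD ReN. Qed.
Lemma ImB z w : Im (z - w) = Im z - Im w. Proof. by rewrite ImD ImN. Qed.
Lemma ReM z w : Re (z * w) = Re z * Re w - Im z * Im w.
Proof. by case: z w => ? ? [? ?]. Qed.
Lemma ImM z w : Im (z * w) = Re z * Im w + Im z * Re w.
Proof. by case: z w => ? ? [? ?]. Qed.
Lemma Reconj z : Re (conjc z) = Re z. Proof. by case: z. Qed.
Lemma Imconj z : Im (conjc z) = - Im z. Proof. by case: z. Qed.

Lemma complex_eq z w : Re z = Re w -> Im z = Im w -> z = w.
Proof. by case: z w => ? ? [? ?] /= -> ->. Qed.

Lemma conjM z w : conjc (z * w) = conjc z * conjc w. Proof. exact: rmorphM. Qed.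
Lemma normcE z : normc z = Num.sqrt (Re z ^+ 2 + Im z ^+ 2).
Proof. by case: z. Qed.

Lemma normc_ge0 z : 0 <= normc z. Proof. by rewrite normcE sqrtr_ge0. Qed.
#[local] Hint Extern 0 (is_true (0 <= normc _)) => exact: normc_ge0 : core.

Lemma normc_sqr z : normc z ^+ 2 = Re z ^+ 2 + Im z ^+ 2.
Proof. by rewrite normcE sqr_sqrtr// addr_ge0 ?sqr_ge0. Qed.

Lemma mulcJ z : z * conjc z = ((normc z) ^+ 2)%:C%C.
Proof. by rewrite normc_sqr; apply: complex_eq; rewrite ?ReM ?ImM Reconj Imconj/=; ring. Qed.

Lemma normc_conj z : normc (conjc z) = normc z.
Proof. by rewrite !normcE Reconj Imconj sqrrN. Qed.

Lemma normc_real (x : R) : normc (x%:C%C) = `|x|.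
Proof. by rewrite normcE/= expr0n addr0 sqrtr_sqr. Qed.

Lemma ler_Re z : `|Re z| <= normc z.
Proof. by rewrite normcE -sqrtr_sqr ler_sqrt ?lerDl ?addr_ge0 ?sqr_ge0. Qed.

Lemma ler_Im z : `|Im z| <= normc z.
Proof. by rewrite normcE -sqrtr_sqr ler_sqrt ?lerDr ?addr_ge0 ?sqr_ge0. Qed.

Lemma normc_le z : normc z <= `|Re z| + `|Im z|.
Proof.
rewrite -(ler_pXn2r (n:=2))// ?nnegrE ?addr_ge0// normc_sqr sqrrD !real_normK ?num_real//.
by rewrite -addrA [_ *+ 2 + _]addrC addrA lerDl mulrn_wge0// mulr_ge0.
Qed.

Lemma normcD z w : normc (z + w) <= normc z + normc w.
Proof. exact: le_normcD. Qed.

Lemma normcM z w : normc (z * w) = normc z * normc w.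
Proof. exact: Normc.normcM. Qed.

Lemma normcB z w : normc (z - w) = normc (w - z).
Proof. by rewrite -opprB normcN. Qed.

Lemma normc_eq0 z : normc z = 0 -> z = 0. Proof. exact: Normc.eq0_normc. Qed.

Lemma normc_expi (t : R) : normc (expi t) = 1.
Proof. by rewrite normcE/= cos2Dsin2 sqrtr1. Qed.

Lemma expiD (s t : R) : expi (s + t) = expi s * expi t.
Proof. by rewrite /expi cosD sinD; apply: complex_eq => //=; ring. Qed.

Lemma expi0 : expi (0 : R) = 1. Proof. by rewrite /expi cos0 sin0. Qed.

Lemma conj_expi (t : R) : conjc (expi t) = expi (- t).
Proof. by rewrite /expi cosN sinN. Qed.

Lemma expiN (t : R) : expi t * expi (- t) = 1.
Proof. by rewrite -expiD subrr expi0. Qed.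

Lemma RC_M (x y : R) : (x * y)%:C%C = x%:C%C * y%:C%C. Proof. exact: rmorphM. Qed.
Lemma RC_D (x y : R) : (x + y)%:C%C = x%:C%C + y%:C%C. Proof. exact: rmorphD. Qed.
Lemma conj_RC (x : R) : conjc (x%:C%C) = x%:C%C. Proof. exact: conjc_real. Qed.

End complex_numbers.

#[global] Hint Extern 0 (is_true (0 <= normc _)) => exact: normc_ge0 : core.

Section complex_measurable.
Context {R : realType} d (T : measurableType d).
Implicit Types f g : T -> R[i].

Definition cmeas f :=
  measurable_fun [set: T] (fun x => Re (f x)) /\ measurable_fun [set: T] (fun x => Im (f x)).

Lemma cmeasD f g : cmeas f -> cmeas g -> cmeas (fun x => f x + g x).
Proof.
move=> [f1 f2] [g1 g2]; split.
  by under eq_fun do rewrite ReD; exact: measurable_funD.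
by under eq_fun do rewrite ImD; exact: measurable_funD.
Qed.

Lemma cmeasM f g : cmeas f -> cmeas g -> cmeas (fun x => f x * g x).
Proof.
move=> [f1 f2] [g1 g2]; split.
  by under eq_fun do rewrite ReM;
    apply: measurable_funB; exact: measurable_funM.
by under eq_fun do rewrite ImM;
  apply: measurable_funD; exact: measurable_funM.
Qed.

Lemma cmeas_cst (c : R[i]) : cmeas (fun=> c).
Proof. by split; exact: measurable_cst. Qed.

Lemma cmeasN f : cmeas f -> cmeas (fun x => - f x).
Proof.
move=> mf; under eq_fun do rewrite -mulN1r.
exact: cmeasM (cmeas_cst _) mf.
Qed.

Lemma cmeasB f g : cmeas f -> cmeas g -> cmeas (fun x => f x - g x).
Proof. by move=> mf mg; apply: cmeasD mf (cmeasN mg). Qed.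

Lemma cmeas_conj f : cmeas f -> cmeas (fun x => conjc (f x)).
Proof.
move=> [f1 f2]; split.
  by under eq_fun do rewrite Reconj.
by under eq_fun do rewrite Imconj; exact: measurable_funN.
Qed.

Lemma cmeas_real (h : T -> R) : measurable_fun setT h -> cmeas (fun x => (h x)%:C%C).
Proof. by move=> mh; split => //=; exact: measurable_cst. Qed.

Lemma cmeas_expi (h : T -> R) : measurable_fun setT h -> cmeas (fun x => expi (h x)).
Proof.
by move=> mh; split; apply: measurableT_comp => //; apply: continuous_measurable_fun;
  [exact: continuous_cos|exact: continuous_sin].
Qed.

Lemma measurable_normc f : cmeas f -> measurable_fun setT (fun x => normc (f x)).
Proof.
move=> [f1 f2]; under eq_fun do rewrite normcE.
apply: (measurableT_comp (f := @Num.sqrt R)).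
  by apply: continuous_measurable_fun; exact: sqrt_continuous.
by apply: measurable_funD; exact: measurable_funX.
Qed.

End complex_measurable.

Lemma cmeas_comp {R : realType} d d' (T : measurableType d) (T' : measurableType d')
  (f : T -> R[i]) (h : T' -> T) : cmeas f -> measurable_fun setT h -> cmeas (f \o h).
Proof.
move=> [f1 f2] mh; split; first exact: (measurableT_comp f1 mh).
exact: (measurableT_comp f2 mh).
Qed.
Notation cmR := (@cmeas _ _ (measurableTypeR _)).

Section complex_integral.
Context {R : realType}.
Local Notation mu := (@lebesgue_measure R).
Implicit Types (f g h : R -> R[i]).

Lemma ae_imp (P Q : R -> Prop) : {ae mu, forall x, P x} -> (forall x, P x -> Q x) ->
  {ae mu, forall x, Q x}.
Proof. by move=> aeP PQ; exact: (@filterS _ _ (ae_filter_ringOfSetsType mu) _ _ PQ aeP). Qed.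

Lemma ae_imp2 (P Q S : R -> Prop) : {ae mu, forall x, P x} -> {ae mu, forall x, Q x} ->
  (forall x, P x -> Q x -> S x) -> {ae mu, forall x, S x}.
Proof. by move=> aeP aeQ PQ; exact: (@filterS2 _ _ (ae_filter_ringOfSetsType mu) _ _ _ PQ aeP aeQ). Qed.

Definition L1 f : Prop :=
  cmR f /\ mu.-integrable setT (fun x => (normc (f x))%:E).

Definition cint f : R[i] := cintegral setT f.

Arguments cint : simpl never.

Lemma L1_cmeas f : L1 f -> cmR f. Proof. by case. Qed.
Hint Resolve L1_cmeas : core.

Lemma L1_le f (h : R -> R) : cmR f -> mu.-integrable setT (EFin \o h) ->
  (forall x, normc (f x) <= h x) -> L1 f.
Proof.
move=> mf ih fh; split=> //; apply: le_integrable ih => //.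
  by apply/measurable_EFinP; exact: measurable_normc.
by move=> x _ /=; rewrite lee_fin ger0_norm// (le_trans (fh x))// ler_norm.
Qed.

Lemma L1_Re f : L1 f -> mu.-integrable setT (fun x => (Re (f x))%:E).
Proof.
move=> [[m1 m2] fi]; apply: le_integrable fi => //.
  exact/measurable_EFinP.
by move=> x _ /=; rewrite lee_fin [leRHS]ger0_norm// ler_Re.
Qed.

Lemma L1_Im f : L1 f -> mu.-integrable setT (fun x => (Im (f x))%:E).
Proof.
move=> [[m1 m2] fi]; apply: le_integrable fi => //.
  exact/measurable_EFinP.
by move=> x _ /=; rewrite lee_fin [leRHS]ger0_norm// ler_Im.
Qed.

Lemma L1D f g : L1 f -> L1 g -> L1 (fun x => f x + g x).
Proof.
move=> [mf fi] [mg gi]; apply: (L1_le (h := fun x => normc (f x) + normc (g x))).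
- exact: cmeasD.
- exact: (integrableD _ fi gi).
- by move=> x; exact: normcD.
Qed.

Lemma L1Ml f g (k : R) : L1 f -> cmR g -> (forall x, normc (g x) <= k) ->
  L1 (fun x => g x * f x).
Proof.
move=> [mf fi] mg gk; apply: (L1_le (h := fun x => k * normc (f x))).
- exact: cmeasM.
- exact: (integrableZl _ _ fi).
- by move=> x; rewrite normcM ler_wpM2r.
Qed.

Lemma L1Z f (c : R[i]) : L1 f -> L1 (fun x => c * f x).
Proof. by move=> f1; apply: (@L1Ml f (fun=> c) (normc c)) => //; exact: cmeas_cst. Qed.

Lemma L1N f : L1 f -> L1 (fun x => - f x).
Proof. by move=> /(L1Z (-1)); under eq_fun do rewrite mulN1r. Qed.

Lemma L1B f g : L1 f -> L1 g -> L1 (fun x => f x - g x).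
Proof. by move=> f1 g1; exact: L1D f1 (L1N g1). Qed.

Lemma L1_conj f : L1 f -> L1 (fun x => conjc (f x)).
Proof.
move=> [mf fi]; split; first exact: cmeas_conj.
by under eq_fun do rewrite normc_conj.
Qed.

Lemma L1_real (h : R -> R) : mu.-integrable setT (EFin \o h) ->
  L1 (fun x => (h x)%:C%C).
Proof.
move=> ih; apply: (L1_le (h := fun x => `|h x|)).
- apply: cmeas_real; apply/measurable_EFinP; exact: measurable_int ih.
- exact: (integrable_abse ih).
- by move=> x; rewrite normc_real.
Qed.

Lemma eq_cint f g : (forall x, f x = g x) -> cint f = cint g.
Proof. by move=> fg; congr cint; apply/funext. Qed.

Lemma cintD f g : L1 f -> L1 g -> cint (fun x => f x + g x) = cint f + cint g.
Proof.
move=> f1 g1; apply: complex_eq; rewrite /cint/cintegral ?ReD ?ImD/=.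
  under eq_Rintegral do rewrite ReD.
  by rewrite RintegralD//; exact: L1_Re.
under eq_Rintegral do rewrite ImD.
by rewrite RintegralD//; exact: L1_Im.
Qed.

Lemma cintZ f (c : R[i]) : L1 f -> cint (fun x => c * f x) = c * cint f.
Proof.
move=> f1; have i1 := L1_Re f1; have i2 := L1_Im f1.
have j1 k := integrableZl measurableT k i1.
have j2 k := integrableZl measurableT k i2.
apply: complex_eq; rewrite ?ReM ?ImM /cint /=.
  under eq_Rintegral do rewrite ReM.
  by rewrite RintegralB; [rewrite !RintegralZl|by []|exact: j1|exact: j2].
under eq_Rintegral do rewrite ImM.
by rewrite RintegralD; [rewrite !RintegralZl|by []|exact: j2|exact: j1].
Qed.

Lemma cintN f : L1 f -> cint (fun x => - f x) = - cint f.
Proof.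
move=> f1; rewrite -mulN1r -cintZ//; apply: eq_cint => x; by rewrite mulN1r.
Qed.

Lemma cintB f g : L1 f -> L1 g -> cint (fun x => f x - g x) = cint f - cint g.
Proof. by move=> f1 g1; rewrite cintD ?cintN//; exact: L1N. Qed.

Lemma cint_conj f : L1 f -> cint (fun x => conjc (f x)) = conjc (cint f).
Proof.
move=> f1; apply: complex_eq; rewrite ?Reconj ?Imconj /cint /=.
  by apply: eq_Rintegral => x _; rewrite Reconj.
under eq_Rintegral do rewrite Imconj -mulN1r.
by rewrite RintegralZl// ?mulN1r//; exact: L1_Im.
Qed.

Lemma cint_real (h : R -> R) : cint (fun x => (h x)%:C%C) = (\int[mu]_x h x)%:C%C.
Proof.
apply: complex_eq; rewrite /cint//= /Rintegral/=.
by rewrite integral0.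
Qed.

Lemma normc_cint f : L1 f -> normc (cint f) <= \int[mu]_x normc (f x).
Proof.
move=> f1; set z := cint f.
have [z0|z0] := eqVneq (normc z) 0.
  by rewrite z0 Rintegral_ge0.
(* The unimodular factor that rotates the integral onto the positive real axis, so that its modulus
   becomes the integral of a real part. *)
pose c := (normc z)^-1%:C%C * conjc z.
have c1 : normc c = 1.
  by rewrite normcM normc_conj normc_real ger0_norm ?invr_ge0// mulVf.
have cz : c * z = (normc z)%:C%C.
  by rewrite /c -mulrA (mulrC _ z) mulcJ -RC_M expr2 mulKf.
have := cintZ c f1; rewrite -/z cz => /(congr1 (@complex.Re R)); rewrite /cint /= => <-.
apply: le_Rintegral => //; [exact/L1_Re/L1Z|by case: f1|].
by move=> x _; rewrite (le_trans (ler_norm _))// (le_trans (ler_Re _))// normcM c1 mul1r.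
Qed.

Lemma cint_ae f g : cmR f -> cmR g -> aeeq f g -> cint f = cint g.
Proof.
move=> [f1 f2] [g1 g2] fg; apply: complex_eq; rewrite /cint /= /Rintegral; congr fine;
  apply: ae_eq_integral => //; try exact/measurable_EFinP.
  by apply: (ae_imp fg) => x -> .
by apply: (ae_imp fg) => x -> .
Qed.

Lemma L1_le_ae f (h : R -> R) : cmR f -> mu.-integrable setT (EFin \o h) ->
  {ae mu, forall x, normc (f x) <= h x} -> L1 f.
Proof.
move=> mf ih fh; split=> //.
have mn : measurable_fun setT (fun x => (normc (f x))%:E).
  exact/measurable_EFinP/measurable_normc.
apply/integrableP; split=> //.
case/integrableP : (integrable_abse ih) => mh; apply: le_lt_trans.
apply: ae_ge0_le_integral => //; try exact: measurableT_comp.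
apply: (ae_imp fh) => x xh _ /=.
by rewrite lee_fin ger0_norm// normr_id (le_trans xh)// ler_norm.
Qed.

(** Limits of complex numbers are expressed, here and below, by [normc] of a difference tending to
    0. As a limit, [f] inherits the bound [h] only almost everywhere; the differences are dominated
    by [2 * h]. *)
Lemma dominated_cint (F : nat -> R -> R[i]) f (h : R -> R) :
  (forall n, cmR (F n)) -> cmR f ->
  {ae mu, forall x, normc (F n x - f x) @[n --> \oo] --> 0} ->
  mu.-integrable setT (EFin \o h) ->
  (forall n x, normc (F n x) <= h x) ->
  L1 f /\ normc (cint (F n) - cint f) @[n --> \oo] --> 0.
Proof.
move=> mF mf Ff ih Fh.
have F1 n : L1 (F n) by apply: L1_le ih (Fh n).
have fh : {ae mu, forall x, normc (f x) <= h x}.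
  apply: (ae_imp Ff) => x xF.
  apply/ler_addgt0Pr => e e0.
  move/cvgrPdist_lt : xF => /(_ _ e0) [N _ /(_ N (leqnn N))].
  rewrite sub0r normrN ger0_norm// => /ltW Nx.
  by rewrite -[f x](subrK (F N x)) (le_trans (normcD _ _))// addrC lerD// normcB.
have f1 : L1 f by exact: L1_le_ae ih fh.
split=> //.
have ih2 : mu.-integrable setT (fun x => ((2 * h x)%:E)).
  exact: (integrableZl _ _ ih).
have [] := @dominated_convergence _ _ _ mu setT measurableT
  (fun n x => (normc (F n x - f x))%:E) (fun x => 0%E) (fun x => ((2 * h x)%:E)).
- move=> n; apply/measurable_EFinP; apply: measurable_normc; exact: cmeasB.
- exact: measurable_cst.
- by apply: (ae_imp Ff) => x xF _; apply/cvg_EFin => //=; exact: nearW.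
- exact: ih2.
- apply: (ae_imp fh) => x xh n _.
  rewrite /= lee_fin ger0_norm// (le_trans (normcD _ _))// normcN mulr_natl mulr2n lerD//.
move=> _ _; rewrite integral0 => /fine_cvgP [_ /=] cv.
apply: (squeeze_cvgr _ (cvg_cst _) cv).
apply: nearW => n /=; rewrite normc_ge0 -cintB//=.
exact: (le_trans (normc_cint (L1B (F1 n) f1))).
Qed.

End complex_integral.
#[global] Hint Resolve L1_cmeas : core.

Arguments cint : simpl never.

(** * Affine change of variable in Lebesgue integrals *)

Section affine_change.
Context {R : realType}.
Local Notation mu := (@lebesgue_measure R).
Variables (a b : R).
Hypothesis a0 : a != 0.

Let aff : measurableTypeR R -> measurableTypeR R := fun x => a * x + b.

Lemma measurable_affine : measurable_fun setT aff.
Proof. by apply: measurable_funD => //; exact: measurable_funM. Qed.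

Let na : {nonneg R} := NngNum (normr_ge0 a).

Let pf : {measure set (measurableTypeR R) -> \bar R} :=
  measure_function_pushforward__canonical__measure_function_Measure mu (measurable_affine).

(** [|a|] times the image of [mu] under [aff]: the candidate that uniqueness of Lebesgue measure
    identifies with [mu]. *)
Let nu : {measure set (measurableTypeR R) -> \bar R} := mscale na pf.

Lemma lebesgue_measure_affine (A : set R) : measurable A ->
  mu A = (`|a|%:E * mu (aff @^-1` A))%E.
Proof.
apply: (@lebesgue_measure_unique R nu) => _ [[x y] /= _ <-].
rewrite /nu /mscale/= /pushforward/=.
have [xy|xy] := ltP x y; last first.
  rewrite set_itv_ge ?bnd_simp -?leNgt//.
  by rewrite preimage_set0 !measure0 mule0.
rewrite lebesgue_measure_itv/= lte_fin xy.
move: a0; rewrite neq_lt => /orP[aN|aP].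
(* A negative [a] reverses the interval, so the preimage is half-open on the other side; its measure
   does not see this. *)
- have -> : aff @^-1` `]x, y] = `[(y - b) / a, (x - b) / a[%classic.
    apply/seteqP; split=> z /=; rewrite !in_itv/= ler_ndivrMr// ltr_ndivlMr// /aff => /andP[? ?]; apply/andP; split; lra.
  rewrite lebesgue_measure_itv/= lte_fin ltr_nM2r ?invr_lt0// ltrD2r xy.
  rewrite -!EFinB -EFinM ltr0_norm//; congr EFin; field; exact: ltr0_neq0.
- have -> : aff @^-1` `]x, y] = `](x - b) / a, (y - b) / a]%classic.
    apply/seteqP; split=> z /=; rewrite !in_itv/= ltr_pdivrMr// ler_pdivlMr// /aff => /andP[? ?]; apply/andP; split; lra.
  rewrite lebesgue_measure_itv/= lte_fin ltr_pM2r ?invr_gt0// ltrD2r xy.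
  rewrite -!EFinB -EFinM gtr0_norm//; congr EFin; field; exact: lt0r_neq0.
Qed.

Lemma ge0_integral_affine (f : R -> \bar R) : measurable_fun [set: measurableTypeR R] f ->
  (forall x, 0 <= f x)%E ->
  (\int[mu]_x f x = `|a|%:E * \int[mu]_x f (a * x + b)%R)%E.
Proof.
move=> mf f0.
rewrite (@eq_measure_integral _ _ _ _ nu); last first.
  move=> A mA _; exact: lebesgue_measure_affine.
rewrite /nu ge0_integral_mscale//=.
by rewrite ge0_integral_pushforward//; exact: measurable_affine.
Qed.

Lemma integrable_affine (f : R -> R) :
  mu.-integrable setT (EFin \o f) -> mu.-integrable setT (fun x => (f (a * x + b))%:E).
Proof.
move=> /integrableP[mf fi]; apply/integrableP; split.
  exact: (measurableT_comp mf measurable_affine).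
move: fi; rewrite (ge0_integral_affine (f := fun x => `|(f x)%:E|%E))//; last first.
  exact: measurableT_comp.
rewrite !ltey; apply: contra_neq => ->.
by rewrite gt0_muley// lte_fin normr_gt0.
Qed.

Lemma Rintegral_affine (f : R -> R) : mu.-integrable setT (EFin \o f) ->
  \int[mu]_x f (a * x + b) = `|a|^-1 * \int[mu]_x f x.
Proof.
move=> fi; have mF := measurable_int _ fi.
have na0 : `|a| != 0 by rewrite normr_eq0.
have gi := integrable_affine fi.
apply: (mulfI na0); rewrite mulVKf// /Rintegral.
have -> : (\int[mu]_x (f x)%:E = `|a|%:E * \int[mu]_x (f (a * x + b)%R)%:E)%E.
  rewrite [in RHS]integralE [in LHS]integralE.
  rewrite (ge0_integral_affine (measurable_funepos mF))//.
  rewrite (ge0_integral_affine (measurable_funeneg mF))//.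
  have -> : (\int[mu]_x (EFin \o f)^\+ (a * x + b)%R =
             \int[mu]_x (fun x => (f (a * x + b)%R)%:E)^\+ x)%E.
    by apply: eq_integral => x _; rewrite !funeposE.
  have -> : (\int[mu]_x (EFin \o f)^\- (a * x + b)%R =
             \int[mu]_x (fun x => (f (a * x + b)%R)%:E)^\- x)%E.
    by apply: eq_integral => x _; rewrite !funenegE.
  rewrite -muleBr//; apply: fin_num_adde_defl; rewrite fin_numN.
  exact: (integrable_neg_fin_num measurableT gi).
rewrite fineM//; exact: integrable_fin_num.
Qed.

Lemma L1_affine (f : R -> R[i]) : L1 f -> L1 (fun x => f (a * x + b)).
Proof.
move=> [mf fi]; split; first exact: (cmeas_comp mf measurable_affine).
exact: (integrable_affine (f := fun x => normc (f x))).
Qed.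

Lemma cint_affine (f : R -> R[i]) : L1 f ->
  cint (fun x => f (a * x + b)) = (`|a|^-1)%:C%C * cint f.
Proof.
move=> f1; apply: complex_eq; rewrite ?ReM ?ImM /cint /= mul0r ?subr0 ?addr0.
  exact: (Rintegral_affine (f := fun x => Re (f x)) (L1_Re f1)).
exact: (Rintegral_affine (f := fun x => Im (f x)) (L1_Im f1)).
Qed.

Lemma ae_affine (P : R -> Prop) : {ae mu, forall x, P x} ->
  {ae mu, forall x, P (a * x + b)}.
Proof.
move=> [N [mN N0 PN]]; exists (aff @^-1` N); split.
- by rewrite -[X in measurable X]setTI; exact: measurable_affine.
- move: N0; rewrite lebesgue_measure_affine// => /eqP.
  by rewrite mule_eq0 eqe normr_eq0 (negbTE a0)/= => /eqP.
- by move=> x /= Px; apply: PN.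
Qed.

End affine_change.

(** * Fubini's theorem for real and complex kernels *)

Section fubini.
Context {R : realType}.
Local Notation mu := (@lebesgue_measure R).
Local Notation mR := (measurableTypeR R).

Lemma measurable_Rintegral2 (k : mR * mR -> R) : measurable_fun setT k ->
  measurable_fun [set: mR] (fun x => \int[mu]_y k (x, y)).
Proof.
move=> mk; rewrite /Rintegral.
apply: measurableT_comp; first exact: fine_measurable.
have mk' : measurable_fun setT (EFin \o k) by exact/measurable_EFinP.
under eq_fun do rewrite integralE.
apply: emeasurable_funB.
  rewrite (_ : (fun x => _) = fun x => (\int[mu]_y (EFin \o k)^\+ (x, y))%E); last first.
    by apply/funext => x; apply: eq_integral => y _; rewrite !funeposE.
  apply: measurable_fun_fubini_tonelli_F => //; exact: measurable_funepos.
rewrite (_ : (fun x => _) = fun x => (\int[mu]_y (EFin \o k)^\- (x, y))%E); last first.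
    by apply/funext => x; apply: eq_integral => y _; rewrite !funenegE.
apply: measurable_fun_fubini_tonelli_F => //; exact: measurable_funeneg.
Qed.

Lemma cmeas_cint (k : mR * mR -> R[i]) : cmeas k ->
  cmR (fun x => cint (fun y => k (x, y))).
Proof.
move=> [k1 k2]; split; first exact: (measurable_Rintegral2 k1).
exact: (measurable_Rintegral2 k2).
Qed.

(** Domination by a product [u x * v y] makes [k] integrable for the product measure, by Tonelli;
    this covers two L^1 functions coupled by a bounded kernel. *)
Lemma Rfubini (k : mR * mR -> R) (u v : R -> R) :
  measurable_fun setT k ->
  mu.-integrable setT (EFin \o u) -> mu.-integrable setT (EFin \o v) ->
  (forall x y, `|k (x, y)| <= u x * v y) ->
  mu.-integrable setT (fun x => (\int[mu]_y k (x, y))%:E) /\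
  \int[mu]_x \int[mu]_y k (x, y) = \int[mu]_y \int[mu]_x k (x, y).
Proof.
move=> mk iu iv kuv.
have mk' : measurable_fun setT (EFin \o k) by exact/measurable_EFinP.
have m1 x : measurable_fun [set: mR] (fun y => k (x, y)).
  exact: measurableT_comp.
have m2 y : measurable_fun [set: mR] (fun x => k (x, y)).
  exact: measurableT_comp.
have i1 x : mu.-integrable setT (fun y => (k (x, y))%:E).
  apply: (le_integrable measurableT _ _ (integrableZl measurableT (u x) iv)).
    exact/measurable_EFinP.
  by move=> y _; rewrite /= lee_fin (le_trans (kuv x y))// ler_norm.
have i2 y : mu.-integrable setT (fun x => (k (x, y))%:E).
  apply: (le_integrable measurableT _ _ (integrableZl measurableT (v y) iu)).
    exact/measurable_EFinP.
  by move=> x _; rewrite /= lee_fin (le_trans (kuv x y))// mulrC ler_norm.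
have ik : (mu \x mu)%E.-integrable setT (EFin \o k).
  apply/integrable12ltyP => //.
  apply: (@le_lt_trans _ _ (\int[mu]_x (`|u x|%:E * \int[mu]_y `|v y|%:E))%E).
    apply: ge0_le_integral => //.
    - by move=> x _; exact: integral_ge0.
    - apply: (measurable_fun_fubini_tonelli_F (abse \o (EFin \o k))).
        exact: (measurableT_comp (@abse_measurable R setT) mk').
      by move=> x; exact: abse_ge0.
    - apply: emeasurable_funM; last exact: measurable_cst.
      apply/measurable_EFinP; apply: measurableT_comp => //.
      by apply/measurable_EFinP; exact: measurable_int iu.
    move=> x _; rewrite -ge0_integralZl//; last first.
      apply/measurable_EFinP; apply: measurableT_comp => //.
      by apply/measurable_EFinP; exact: measurable_int iv.
    apply: ge0_le_integral => //.
    - by apply/measurable_EFinP; apply: measurableT_comp => //; exact: m1.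
    - apply: emeasurable_funM => //.
      apply/measurable_EFinP; apply: measurableT_comp => //.
      by apply/measurable_EFinP; exact: measurable_int iv.
    by move=> y _; rewrite /= -EFinM lee_fin -normrM (le_trans (kuv x y))// ler_norm.
  have /integrableP[_ uoo] := iu; have /integrableP[_ voo] := iv.
  rewrite ge0_integralZr//.
  - rewrite lte_mul_pinfty//; first exact: integral_ge0.
    by rewrite ge0_fin_numE//; exact: integral_ge0.
  - apply/measurable_EFinP; apply: measurableT_comp => //.
    by apply/measurable_EFinP; exact: measurable_int iu.
  - exact: integral_ge0.
have e1 x : (\int[mu]_y k (x, y))%:E = (\int[mu]_y (k (x, y))%:E)%E.
  by rewrite /Rintegral fineK//; exact: integrable_fin_num (i1 x).
have e2 y : (\int[mu]_x k (x, y))%:E = (\int[mu]_x (k (x, y))%:E)%E.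
  by rewrite /Rintegral fineK//; exact: integrable_fin_num (i2 y).
split.
- under eq_fun do rewrite e1; exact: (integrable_fubini_F ik).
rewrite [LHS]/Rintegral [RHS]/Rintegral; congr fine.
under eq_integral do rewrite e1.
under [RHS]eq_integral do rewrite e2.
exact: (Fubini ik).
Qed.

(** In the applications [e] is one of the characters e^(ixy) and e^(-ixy). *)
Lemma cfubini (f g : R -> R[i]) (e : mR * mR -> R[i]) :
  L1 f -> L1 g -> cmeas e -> (forall x y, normc (e (x, y)) <= 1) ->
  [/\ L1 (fun x => f x * cint (fun y => g y * e (x, y))),
      L1 (fun y => g y * cint (fun x => f x * e (x, y))) &
   cint (fun x => f x * cint (fun y => g y * e (x, y))) =
   cint (fun y => g y * cint (fun x => f x * e (x, y)))].
Proof.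
move=> f1 g1 me e1.
have mex x : cmR (fun y => e (x, y)).
  by apply: (cmeas_comp me).
have mey y : cmR (fun x => e (x, y)).
  by apply: (cmeas_comp me).
pose k := fun p : mR * mR => f p.1 * (g p.2 * e p).
have mk : cmeas k.
  apply: cmeasM; first exact: (cmeas_comp (L1_cmeas f1)).
  by apply: cmeasM => //; exact: (cmeas_comp (L1_cmeas g1)).
have kfg x y : normc (k (x, y)) <= normc (f x) * normc (g y).
  by rewrite /k !normcM ler_wpM2l// ler_piMr.
have gx x : L1 (fun y => g y * e (x, y)).
  by under eq_fun do rewrite mulrC; apply: (L1Ml g1 (mex x)).
have fy y : L1 (fun x => f x * e (x, y)).
  by under eq_fun do rewrite mulrC; apply: (L1Ml f1 (mey y)).
have E1 : (fun x => f x * cint (fun y => g y * e (x, y))) =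
          (fun x => cint (fun y => k (x, y))).
  by apply/funext => x; rewrite -cintZ.
have E2 : (fun y => g y * cint (fun x => f x * e (x, y))) =
          (fun y => cint (fun x => k (x, y))).
  apply/funext => y; rewrite -cintZ//; apply: eq_cint => x.
  by rewrite /k/= mulrCA.
have [m1 m2] := mk.
have [i1 i3] := @Rfubini (fun p => Re (k p)) _ _ m1 f1.2 g1.2
  (fun x y => le_trans (ler_Re _) (kfg x y)).
have [j1 j3] := @Rfubini (fun p => Im (k p)) _ _ m2 f1.2 g1.2
  (fun x y => le_trans (ler_Im _) (kfg x y)).
have kgf y x : normc (k (x, y)) <= normc (g y) * normc (f x).
  by rewrite mulrC.
have [mk1 mk2] : cmeas (fun p : mR * mR => k (p.2, p.1)).
  by apply: (cmeas_comp mk); exact: measurable_fun_pair.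
have [i2 _] := @Rfubini (fun p => Re (k (p.2, p.1))) _ _ mk1 g1.2 f1.2
  (fun y x => le_trans (ler_Re _) (kgf y x)).
have [j2 _] := @Rfubini (fun p => Im (k (p.2, p.1))) _ _ mk2 g1.2 f1.2
  (fun y x => le_trans (ler_Im _) (kgf y x)).
move: i2 j2 => /= i2 j2; rewrite E1 E2; split.
- apply: (L1_le (h := fun x => `|\int[mu]_y Re (k (x, y))| + `|\int[mu]_y Im (k (x, y))|)).
  + exact: cmeas_cint.
  + exact: (integrableD _ (integrable_abse i1) (integrable_abse j1)).
  + by move=> x; exact: normc_le.
- apply: (L1_le (h := fun y => `|\int[mu]_x Re (k (x, y))| + `|\int[mu]_x Im (k (x, y))|)).
  + apply: (cmeas_cint (k := fun p => k (p.2, p.1))); split; [exact: mk1|exact: mk2].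
  + exact: (integrableD _ (integrable_abse i2) (integrable_abse j2)).
  + by move=> x; exact: normc_le.
- by apply: complex_eq.
Qed.

End fubini.

(** * The space L^2 *)

Section L2_theory.
Context {R : realType}.
Local Notation mu := (@lebesgue_measure R).
Local Notation mR := (measurableTypeR R).
Implicit Types f g h : R -> R[i].

Definition sqi f := mu.-integrable setT (fun x => (normc (f x) ^+ 2)%:E).

Lemma measurable_normc2 f : cmR f ->
  measurable_fun [set: mR] (fun x => (normc (f x) ^+ 2)%:E).
Proof.
move=> mf; apply/measurable_EFinP.
exact: (measurable_funX 2 (@measurable_normc _ _ mR _ mf)).
Qed.

Lemma normL2E f : normL2 f = ((\int[mu]_x (normc (f x) ^+ 2)%:E) `^ (2^-1))%E.
Proof.
rewrite /normL2 unlock; congr poweR; apply: eq_integral => x _.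
by rewrite abse_EFin poweR_EFin powR_mulrn// ger0_norm.
Qed.

Lemma L2P f : L2 f <-> cmR f /\ sqi f.
Proof.
have I0 : (0 <= \int[mu]_x (normc (f x) ^+ 2)%:E)%E.
  by apply: integral_ge0 => x _; rewrite lee_fin sqr_ge0.
split.
- move=> [f1 f2 fn]; split=> //; apply/integrableP; split.
    by exact: measurable_normc2.
  under eq_integral do rewrite abse_EFin ger0_norm ?sqr_ge0//.
  by move: fn; rewrite normL2E; apply: lty_poweRy; rewrite invr_eq0 pnatr_eq0.
- move=> [mf /integrableP[_ fi]]; split; [exact: mf.1|exact: mf.2|].
  rewrite normL2E; apply: poweR_lty; apply: le_lt_trans fi.
  apply: ge0_le_integral => //=.
  + by move=> x _; rewrite lee_fin sqr_ge0.
  + exact: measurable_normc2.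
  + exact: (measurableT_comp (@abse_measurable R setT) (measurable_normc2 mf)).
  + by move=> x _; rewrite lee_fin ler_norm.
Qed.

(** Real-valued counterpart of [normL2], meaningful only on [L2]: an infinite integral yields 0. *)
Definition nrm f : R := Num.sqrt (\int[mu]_x (normc (f x) ^+ 2)).

Lemma nrm_ge0 f : 0 <= nrm f. Proof. exact: sqrtr_ge0. Qed.
Hint Resolve nrm_ge0 : core.

Lemma nrm_sqr f : nrm f ^+ 2 = \int[mu]_x (normc (f x) ^+ 2).
Proof. by rewrite sqr_sqrtr// Rintegral_ge0// => x _; exact: sqr_ge0. Qed.

Lemma normL2_nrm f : L2 f -> normL2 f = (nrm f)%:E.
Proof.
move=> /L2P[_ fi]; rewrite normL2E /nrm /Rintegral.
have I0 : (0 <= \int[mu]_x (normc (f x) ^+ 2)%:E)%E.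
  by apply: integral_ge0 => x _; rewrite lee_fin sqr_ge0.
by rewrite -powR12_sqrt ?fine_ge0// -poweR_EFin fineK//; exact: integrable_fin_num fi.
Qed.

Lemma L2_cmeas f : L2 f -> cmR f. Proof. by move=> /L2P[]. Qed.
Hint Resolve L2_cmeas : core.

Lemma L2_le f (h : R -> R) : cmR f -> mu.-integrable setT (EFin \o h) ->
  (forall x, normc (f x) ^+ 2 <= h x) -> L2 f.
Proof.
move=> mf ih fh; apply/L2P; split=> //.
apply: le_integrable ih => //.
  by exact: measurable_normc2.
by move=> x _; rewrite lee_fin/= ger0_norm ?sqr_ge0// (le_trans (fh x))// ler_norm.
Qed.

Lemma L2_ae f g : cmR g -> aeeq f g -> L2 f -> L2 g.
Proof.
move=> mg fg /L2P[mf fi]; apply/L2P; split => //.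
have mg2 : measurable_fun [set: mR] (fun x => (normc (g x) ^+ 2)%:E).
  by exact: measurable_normc2.
apply/integrableP; split=> //.
case/integrableP : fi => mf2; apply: le_lt_trans.
apply: ae_ge0_le_integral => //; try exact: measurableT_comp.
by apply: (ae_imp fg) => x /= ->.
Qed.

Lemma sqrD_le (a b : R) : (a + b) ^+ 2 <= 2 * a ^+ 2 + 2 * b ^+ 2.
Proof. by have := sqr_ge0 (a - b); rewrite !expr2; lra. Qed.

Lemma L2D f g : L2 f -> L2 g -> L2 (fun x => f x + g x).
Proof.
move=> /L2P[mf fi] /L2P[mg gi].
apply: (L2_le (h := fun x => 2 * normc (f x) ^+ 2 + 2 * normc (g x) ^+ 2)).
- exact: cmeasD.
- exact: (integrableD _ (integrableZl _ 2 fi) (integrableZl _ 2 gi)).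
- move=> x; apply: le_trans (sqrD_le _ _).
  by rewrite ler_sqr ?nnegrE ?addr_ge0//; exact: normcD.
Qed.

Lemma L2M f g (k : R) : L2 f -> cmR g -> (forall x, normc (g x) <= k) ->
  L2 (fun x => g x * f x).
Proof.
move=> /L2P[mf fi] mg gk.
apply: (L2_le (h := fun x => k ^+ 2 * normc (f x) ^+ 2)).
- exact: cmeasM.
- exact: (integrableZl _ (k ^+ 2) fi).
- move=> x; rewrite normcM exprMn ler_wpM2r ?sqr_ge0//.
  by rewrite ler_sqr ?nnegrE// (le_trans (normc_ge0 _) (gk x)).
Qed.

Lemma L2Z f (c : R[i]) : L2 f -> L2 (fun x => c * f x).
Proof. by move=> f2; apply: (@L2M f (fun=> c) (normc c)) => //; exact: cmeas_cst. Qed.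

Lemma L2N f : L2 f -> L2 (fun x => - f x).
Proof. by move=> /(L2Z (-1)); under eq_fun do rewrite mulN1r. Qed.

Lemma L2B f g : L2 f -> L2 g -> L2 (fun x => f x - g x).
Proof. by move=> f2 g2; exact: L2D f2 (L2N g2). Qed.

Lemma L2_conj f : L2 f -> L2 (fun x => conjc (f x)).
Proof.
move=> /L2P[mf fi]; apply/L2P; split; first exact: cmeas_conj.
by rewrite /sqi; under eq_fun do rewrite normc_conj.
Qed.

Lemma L2_mulL1 f g : L2 f -> L2 g -> L1 (fun x => f x * g x).
Proof.
move=> /L2P[mf fi] /L2P[mg gi].
apply: (L1_le (h := fun x => normc (f x) ^+ 2 + normc (g x) ^+ 2)).
- exact: cmeasM.
- exact: (integrableD _ fi gi).
- move=> x; rewrite normcM.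
  have := sqr_ge0 (normc (f x) - normc (g x)); have := sqr_ge0 (normc (f x) + normc (g x)).
  by rewrite !expr2; lra.
Qed.

(** The discriminant argument behind Cauchy-Schwarz; nonnegative [t] suffice because [c] is
    nonnegative. *)
Lemma quadratic_discr (a b c : R) : 0 <= a -> 0 <= b -> 0 <= c ->
  (forall t, 0 <= t -> 2 * c * t <= a * t ^+ 2 + b) -> c <= Num.sqrt a * Num.sqrt b.
Proof.
move=> a0 b0 c0 H; rewrite -sqrtrM// -[c]ger0_norm// -sqrtr_sqr ler_sqrt ?mulr_ge0//.
have [a00|an] := eqVneq a 0.
  rewrite a00 mul0r leNgt expr2; apply/negP => cc.
  have c1 : 0 < c by rewrite lt0r c0 andbT; apply/eqP => c1; rewrite c1 mul0r ltxx in cc.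
  (* When [a = 0] the linear term cannot exceed [b], but at this [t] it equals [2 * (b + 1)]. *)
  have := H ((b + 1) / c); rewrite divr_ge0 ?addr_ge0// => /(_ isT).
  have -> : 2 * c * ((b + 1) / c) = 2 * (b + 1) by field; exact: lt0r_neq0.
  by rewrite a00; lra.
have a1 : 0 < a by rewrite lt0r an.
(* The minimiser of [a * t ^+ 2 - 2 * c * t]. *)
have := H (c / a); rewrite divr_ge0// => /(_ isT).
have -> : 2 * c * (c / a) = 2 * (c ^+ 2 / a) by field.
have -> : a * (c / a) ^+ 2 = c ^+ 2 / a by field.
move=> h; have : c ^+ 2 / a <= b by lra.
by rewrite ler_pdivrMr// mulrC.
Qed.

Lemma integrable_mul_normc f g : L2 f -> L2 g ->
  mu.-integrable setT (fun x => (normc (f x) * normc (g x))%:E).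
Proof. by move=> f2 g2; have [_] := L2_mulL1 f2 g2; under eq_fun do rewrite normcM. Qed.

Lemma holder2 f g : L2 f -> L2 g ->
  \int[mu]_x (normc (f x) * normc (g x)) <= nrm f * nrm g.
Proof.
move=> f2 g2; have [/L2P[mf fi] /L2P[mg gi]] := (f2, g2).
have fgi := integrable_mul_normc f2 g2.
apply: quadratic_discr; try by apply: Rintegral_ge0 => x _; rewrite ?sqr_ge0// mulr_ge0.
move=> t t0.
have i1 := integrableZl measurableT (2 * t) fgi.
have i2 := integrableZl measurableT (t ^+ 2) fi.
rewrite mulrAC [_ * t ^+ 2]mulrC -RintegralZl// -RintegralZl// -RintegralD//.
apply: le_Rintegral => //; first exact: (integrableD _ i2 gi).
move=> x _; have := sqr_ge0 (t * normc (f x) - normc (g x)).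
by rewrite !expr2; lra.
Qed.

Lemma normc_cintM f g : L2 f -> L2 g -> normc (cint (fun x => f x * g x)) <= nrm f * nrm g.
Proof.
move=> f2 g2; apply: le_trans (normc_cint (L2_mulL1 f2 g2)) _.
by under eq_Rintegral do rewrite normcM; exact: holder2.
Qed.

Lemma nrm_le f g : L2 f -> L2 g -> (forall x, normc (f x) <= normc (g x)) -> nrm f <= nrm g.
Proof.
move=> /L2P[mf fi] /L2P[mg gi] fg; rewrite ler_sqrt; last first.
  by apply: Rintegral_ge0 => x _; exact: sqr_ge0.
by apply: le_Rintegral => // x _; rewrite ler_sqr ?nnegrE.
Qed.

Lemma nrm_ae f g : cmR f -> cmR g -> aeeq f g -> nrm f = nrm g.
Proof.
move=> mf mg fg; congr Num.sqrt; congr fine; apply: ae_eq_integral => //.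
- exact: measurable_normc2.
- exact: measurable_normc2.
- by apply: (ae_imp fg) => x ->.
Qed.

Lemma nrmD f g : L2 f -> L2 g -> nrm (fun x => f x + g x) <= nrm f + nrm g.
Proof.
move=> f2 g2; have [/L2P[mf fi] /L2P[mg gi]] := (f2, g2).
rewrite -(ler_pXn2r (n:=2))// ?nnegrE ?addr_ge0// nrm_sqr sqrrD !nrm_sqr.
have fgi := integrable_mul_normc f2 g2.
have fgi2 : mu.-integrable setT (fun x => (normc (f x) * normc (g x) *+ 2)%:E).
  under eq_fun do rewrite -mulr_natl.
  exact: (integrableZl _ 2 fgi).
have /L2P[_ si] := L2D f2 g2.
have s1 := integrableD measurableT fi fgi2.
apply: (@le_trans _ _ (\int[mu]_x (normc (f x) ^+ 2 + normc (f x) * normc (g x) *+ 2 + normc (g x) ^+ 2))).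
  apply: le_Rintegral => //; first exact: (integrableD _ s1 gi).
  by move=> x _; rewrite -sqrrD ler_sqr ?nnegrE ?addr_ge0//; exact: normcD.
rewrite (RintegralD measurableT s1 gi).
rewrite RintegralD// lerD2r lerD2l.
under eq_Rintegral do rewrite -mulr_natl.
by rewrite RintegralZl// -[leRHS]mulr_natl ler_pM2l//; exact: holder2.
Qed.

Lemma nrmZ f (c : R[i]) : L2 f -> nrm (fun x => c * f x) = normc c * nrm f.
Proof.
move=> /L2P[mf fi]; rewrite /nrm; under eq_Rintegral do rewrite normcM exprMn.
by rewrite RintegralZl// sqrtrM ?sqr_ge0// sqrtr_sqr ger0_norm.
Qed.

Lemma nrmN f : nrm (fun x => - f x) = nrm f.
Proof. by rewrite /nrm; under eq_Rintegral do rewrite normcN. Qed.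

Lemma nrmB f g : nrm (fun x => f x - g x) = nrm (fun x => g x - f x).
Proof. by rewrite -nrmN /nrm; under eq_Rintegral do rewrite opprB. Qed.

Lemma nrmB_le f g h : L2 f -> L2 g -> L2 h ->
  nrm (fun x => f x - h x) <= nrm (fun x => f x - g x) + nrm (fun x => g x - h x).
Proof.
move=> f2 g2 h2; rewrite [leLHS](_ : _ = nrm (fun x => (f x - g x) + (g x - h x))).
  by apply: nrmD; exact: L2B.
by congr nrm; apply/funext => x; rewrite subrKA.
Qed.

Lemma nrm0_ae f : L2 f -> nrm f = 0 -> {ae mu, forall x, f x = 0}.
Proof.
move=> f2 f0; have /L2P[mf fi] := f2.
have I0 : (\int[mu]_x `|(normc (f x) ^+ 2)%:E| = 0)%E.
  under eq_integral do rewrite abse_EFin ger0_norm ?sqr_ge0//.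
  by rewrite -(fineK (integrable_fin_num measurableT fi)) -[fine _]nrm_sqr f0 expr0n.
have := (ae_eq_integral_abs _ measurableT (measurable_normc2 mf)).1 I0.
move=> H; apply: (ae_imp H) => x /(_ I) [] /eqP.
by rewrite expf_eq0/= => /eqP /normc_eq0.
Qed.

Lemma nrm_B0_ae f g : L2 f -> L2 g -> nrm (fun x => f x - g x) = 0 -> aeeq f g.
Proof.
move=> f2 g2 /(nrm0_ae (L2B f2 g2)) H; apply: (ae_imp H) => x /eqP.
by rewrite subr_eq0 => /eqP.
Qed.

Lemma L2_0 : L2 (fun=> 0 : R[i]).
Proof.
apply/L2P; split; first exact: cmeas_cst.
rewrite /sqi; under eq_fun do rewrite Normc.normc0 expr0n.
exact: integrable0.
Qed.
End L2_theory.

Lemma cvg_dist0 {R : realType} T (F : set_system T) {FF : Filter F} (u : T -> R) (l : R) :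
  u n @[n --> F] --> l -> `|u n - l| @[n --> F] --> (0 : R).
Proof.
move=> ul; rewrite -(@normr0 _ R); apply: cvg_norm.
by rewrite -(subrr l); apply: cvgB => //; exact: cvg_cst.
Qed.

Lemma eq_cmeas {R : realType} d (T : measurableType d) (f g : T -> R[i]) :
  (forall x, f x = g x) -> cmeas f -> cmeas g.
Proof. by move=> /funext ->. Qed.

(** * Completeness of L^2 (Riesz-Fischer) *)

Section L2_completeness.
Context {R : realType}.
Local Notation mu := (@lebesgue_measure R).
Local Notation mR := (measurableTypeR R).
Implicit Types f g h : R -> R[i].

(** The moduli [d k] of the increments have partial sums [S n] of norm at most 2. By monotone
    convergence the sum is finite almost everywhere and square integrable; where finite it forces
    pointwise convergence, and its square dominates the squared errors. *)
Lemma L2_fast_cvg (v : nat -> R -> R[i]) : (forall k, L2 (v k)) ->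
  (forall k, nrm (fun x => v k.+1 x - v k x) <= 2^-1 ^+ k) ->
  exists2 g, L2 g & nrm (fun x => v k x - g x) @[k --> \oo] --> 0.
Proof.
move=> v2 vk.
pose d k x := normc (v k.+1 x - v k x).
pose S n x := \sum_(k < n) d k x.
have d0 k x : 0 <= d k x by exact: normc_ge0.
have S0 n x : 0 <= S n x by exact: sumr_ge0.
have Snd x : {homo (S ^~ x) : m n / (m <= n)%N >-> m <= n}.
  apply/nondecreasing_seqP => n; by rewrite /S big_ord_recr/= lerDl.
have S2 n : L2 (fun x => (S n x)%:C%C) /\ nrm (fun x => (S n x)%:C%C) <= \sum_(k < n) 2^-1 ^+ k.
  elim: n => [|n [IH1 IH2]].
    rewrite big_ord0 /S; under eq_fun do rewrite big_ord0.
    split; first exact: L2_0.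
    rewrite /nrm; under eq_Rintegral do rewrite normc_real normr0 expr0n.
    by rewrite /Rintegral integral0 sqrtr0.
  have dn : L2 (fun x => (d n x)%:C%C).
    have /L2P[mv iv] := L2B (v2 n.+1) (v2 n).
    apply: (L2_le (h := fun x => (d n x) ^+ 2)) => //.
      by apply: cmeas_real; exact: (@measurable_normc _ _ mR).
    by move=> x; rewrite normc_real ger0_norm.
  have ES : (fun x => (S n.+1 x)%:C%C) = (fun x => (S n x)%:C%C + (d n x)%:C%C).
    by apply/funext => x; rewrite /S big_ord_recr/= RC_D.
  rewrite ES; split; first exact: L2D.
  rewrite big_ord_recr/= (le_trans (nrmD IH1 dn))// lerD//.
  apply: le_trans (vk n); rewrite /nrm.
  by under eq_Rintegral do rewrite normc_real ger0_norm//.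
(* The square of the full sum of the moduli, kept in the extended reals until it is known to be
   finite almost everywhere. *)
pose E x := ereal_sup (range (fun n => (S n x ^+ 2)%:E)).
have nd2 x : nondecreasing_seq (fun n => (S n x ^+ 2)%:E).
  by move=> m n mn; rewrite lee_fin ler_sqr ?nnegrE// Snd.
have SE x : (S n x ^+ 2)%:E @[n --> \oo] --> E x.
  exact: (ereal_nondecreasing_cvgn (nd2 x)).
have mS n : measurable_fun [set: mR] (fun x => (S n x ^+ 2)%:E).
  have := measurable_normc2 (L2_cmeas (S2 n).1).
  by under eq_fun do rewrite normc_real ger0_norm//.
have mE : measurable_fun [set: mR] E.
  by apply: (emeasurable_fun_cvg (fun n x => (S n x ^+ 2)%:E)) => // x _; exact: SE.
have E0 x : (0 <= E x)%E.
  apply: (@le_trans _ _ (S 0%N x ^+ 2)%:E); first by rewrite lee_fin sqr_ge0.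
  by apply: ereal_sup_ubound; exists 0%N.
have iE : mu.-integrable setT E.
  apply/integrableP; split=> //; under eq_integral do rewrite gee0_abs//.
  apply: (@le_lt_trans _ _ 4%:E); last exact: ltry.
  have cv : (\int[mu]_x (S n x ^+ 2)%:E @[n --> \oo] --> \int[mu]_x E x)%E.
    have -> : E = fun x => limn (fun n => (S n x ^+ 2)%:E).
      by apply/funext => x; apply/esym/cvg_lim => //; exact: SE.
    apply: (cvg_monotone_convergence measurableT mS) => //.
    by move=> n x _; rewrite lee_fin sqr_ge0.
  rewrite -(cvg_lim _ cv)//; apply: lime_le; first by apply/cvg_ex; eexists; exact: cv.
  apply: nearW => n; have [s1 s2] := S2 n.
  have /L2P[_ is2] := s1.
  have -> : (\int[mu]_x (S n x ^+ 2)%:E = (nrm (fun x => (S n x)%:C%C) ^+ 2)%:E)%E.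
    rewrite nrm_sqr /Rintegral fineK; last exact: integrable_fin_num is2.
    by apply: eq_integral => x _; rewrite normc_real ger0_norm.
  (* The geometric series of ratio 1/2 sums to 2, whence the bound 4 on the squared norm. *)
  rewrite lee_fin (_ : 4 = 2 ^+ 2); last by rewrite -natrX.
  rewrite ler_sqr ?nnegrE ?nrm_ge0// (le_trans s2)//.
  have := @geometric_le_lim R n 1 2^-1 ler01.
  rewrite invr_gt0 ltr0n ger0_norm ?invr_ge0// invf_lt1 ?ltr1n// => /(_ isT isT).
  rewrite mul1r => H; apply: (le_trans (le_trans _ H)); last first.
    by rewrite (_ : 1 - 2^-1 = 2^-1 :> R) ?invrK//; lra.
  by rewrite seriesEord/=; under [leRHS]eq_bigr do rewrite mul1r.
pose A := [set x | (E x < +oo)%E].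
have mA : measurable (A : set mR).
  by rewrite -[A]setTI; exact: emeasurable_fun_infty_o.
have aeA : {ae mu, forall x, A x}.
  have H := integrable_ae measurableT iE; apply: (ae_imp H) => x /(_ I).
  by rewrite /A /= ge0_fin_numE.
pose B x := Num.sqrt (fine (E x)).
have SB n x : A x -> S n x <= B x.
  move=> Ax; rewrite -[S n x]ger0_norm// -sqrtr_sqr ler_sqrt ?fine_ge0//.
  by rewrite -lee_fin fineK ?ge0_fin_numE//; apply: ereal_sup_ubound; exists n.
have vB k x : A x -> forall m, (k <= m)%N -> normc (v m x - v k x) <= S m x - S k x.
  move=> Ax m; elim: m => [|m IH].
    by rewrite leqn0 => /eqP ->; rewrite !subrr Normc.normc0.
  rewrite leq_eqVlt => /orP[/eqP <-|]; first by rewrite !subrr Normc.normc0.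
  rewrite ltnS => /IH km; rewrite /S big_ord_recr/= -/(S m x) -addrA [d m x + _]addrC addrA.
  have -> : v m.+1 x - v k x = (v m x - v k x) + (v m.+1 x - v m x) by ring.
  by rewrite (le_trans (normcD _ _))// lerD.
have cvS x : A x -> cvgn (S ^~ x).
  move=> Ax; apply: nondecreasing_is_cvgn; first exact: Snd.
  by exists (B x) => _ [n _ <-]; exact: SB.
(* For [p] the real or the imaginary part: the telescoping series of [p (v k x)] is dominated by the
   convergent series of the [d k x]. *)
have cvv (p : R[i] -> R) x : A x -> (forall z w, p (z - w) = p z - p w) ->
    (forall z, `|p z| <= normc z) -> cvgn (fun k => p (v k x)).
  move=> Ax pB pn.
  have -> : (fun k => p (v k x)) =
    (fun k => p (v 0%N x) + series (telescope (fun k => p (v k x))) k).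
    by apply/funext => k; rewrite -eq_sum_telescope.
  apply: is_cvgD; first exact: is_cvg_cst.
  apply: normed_cvg; apply: (@series_le_cvg _ _ (d ^~ x)) => //.
  - by move=> k /=.
  - by move=> k; rewrite /= [telescope _ _](_ : _ = p (v k.+1 x - v k x)); [exact: pn|rewrite pB].
  - by rewrite seriesEord; exact: cvS.
(* The value 0 outside [A] makes [g] an everywhere pointwise limit of measurable functions. *)
pose g x := if x \in A then Complex (limn (fun k => Re (v k x))) (limn (fun k => Im (v k x))) else 0.
have cvRe x : A x -> Re (v k x) @[k --> \oo] --> Re (g x).
  by move=> Ax; rewrite /g mem_set//=; apply: cvv => //; [exact: ReB|exact: ler_Re].
have cvIm x : A x -> Im (v k x) @[k --> \oo] --> Im (g x).
  by move=> Ax; rewrite /g mem_set//=; apply: cvv => //; [exact: ImB|exact: ler_Im].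
have cvg0 x : A x -> normc (v k x - g x) @[k --> \oo] --> 0.
  move=> Ax; apply: (@squeeze_cvgr _ _ _ _ (fun=> 0)
    (fun k => `|Re (v k x) - Re (g x)| + `|Im (v k x) - Im (g x)|)).
  - by apply: nearW => k; rewrite normc_ge0 -ReB -ImB normc_le.
  - exact: cvg_cst.
  - by rewrite -[X in _ --> X](addr0 0); apply: cvgD; apply: cvg_dist0;
      [exact: cvRe|exact: cvIm].
have vgB k x : A x -> normc (v k x - g x) <= B x.
  move=> Ax; apply/ler_addgt0Pl => e e0.
  have /cvgrPdist_lt/(_ _ e0)[N _ HN] := cvg0 x Ax.
  have := HN (maxn N k) (leq_maxl _ _).
  rewrite sub0r normrN ger0_norm// => H.
  have -> : v k x - g x = (v (maxn N k) x - g x) - (v (maxn N k) x - v k x) by ring.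
  rewrite (le_trans (normcD _ _))// normcN lerD//; first exact: ltW.
  rewrite (le_trans (vB _ _ Ax _ (leq_maxr _ _)))//.
  by rewrite lerBlDr (le_trans (SB _ _ Ax))// lerDl.
have mg : cmR g.
  have mvA k : cmR (fun x => if x \in A then v k x else 0).
    apply: (eq_cmeas (f := fun x => (\1_A x)%:C%C * v k x)).
      by move=> x; rewrite indicE; case: (x \in A); rewrite ?mul1r ?mul0r.
    apply: cmeasM; last exact: L2_cmeas.
    by apply: cmeas_real; exact: measurable_indic.
  split.
    apply: (@measurable_fun_cvg _ mR _ _ (fun k x => Re (if x \in A then v k x else 0))).
      by move=> k; have [] := mvA k.
    move=> x _; case: (boolP (x \in A)) => [/set_mem Ax|Ax].
      exact: cvRe.
    by rewrite /g (negbTE Ax); exact: cvg_cst.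
  apply: (@measurable_fun_cvg _ mR _ _ (fun k x => Im (if x \in A then v k x else 0))).
    by move=> k; have [] := mvA k.
  move=> x _; case: (boolP (x \in A)) => [/set_mem Ax|Ax].
    exact: cvIm.
  by rewrite /g (negbTE Ax); exact: cvg_cst.
have ifE : mu.-integrable setT (fun x => (fine (E x))%:E).
  apply/integrableP; split.
    by apply/measurable_EFinP; exact: measurableT_comp.
  have /integrableP[_] := iE; apply: le_lt_trans.
  apply: ge0_le_integral => //.
  + by apply: measurableT_comp => //; apply/measurable_EFinP; exact: measurableT_comp.
  + exact: measurableT_comp.
  + move=> x _; case: (E x) => [r| |] //=.
    by rewrite normr0 leey.
    by rewrite normr0 leey.
have vg2 k : L2 (fun x => v k x - g x).
  apply: (L2_ae (f := fun x => (\1_A x)%:C%C * (v k x - g x))).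
  - by apply: cmeasB => //; exact: L2_cmeas.
  - apply: (ae_imp aeA) => x Ax; by rewrite indicE mem_set// mul1r.
  apply: (L2_le (h := fun x => fine (E x))) => //.
    apply: cmeasM; last by apply: cmeasB => //; exact: L2_cmeas.
    by apply: cmeas_real; exact: measurable_indic.
  move=> x; rewrite normcM normc_real indicE; have [/set_mem Ax|_] := boolP (x \in A).
    rewrite normr1 mul1r -(sqr_sqrtr (fine_ge0 (E0 x))) ler_sqr ?nnegrE ?sqrtr_ge0//.
    exact: vgB.
  by rewrite normr0 mul0r expr0n fine_ge0.
exists g.
  have := L2B (v2 0%N) (vg2 0%N); apply: L2_ae => //.
  by apply: aeW => x; rewrite subKr.
have [] := @dominated_convergence _ _ _ mu setT measurableT
  (fun k x => (normc (v k x - g x) ^+ 2)%:E) (fun x => 0%E) (fun x => (fine (E x))%:E).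
- by move=> k; exact: (measurable_normc2 (L2_cmeas (vg2 k))).
- exact: measurable_cst.
- apply: (ae_imp aeA) => x Ax _; apply/cvg_EFin; first exact: nearW.
  rewrite /= [X in _ --> X](_ : _ = (0 : R) ^+ 2); last by rewrite expr0n.
  exact: (cvg_comp _ _ (cvg0 x Ax) (@exprn_continuous R 2 0)).
- exact: ifE.
- apply: (ae_imp aeA) => x Ax k _.
  rewrite abse_EFin lee_fin ger0_norm ?sqr_ge0//.
  rewrite -(sqr_sqrtr (fine_ge0 (E0 x))) ler_sqr ?nnegrE ?sqrtr_ge0//.
  exact: vgB.
move=> _ _; rewrite integral0 => /fine_cvgP[_ cv].
rewrite -(sqrtr0 R); apply: (cvg_comp _ _ cv); exact: sqrt_continuous.
Qed.

Lemma L2_complete (u : nat -> R -> R[i]) : (forall n, L2 (u n)) ->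
  (forall e : R, 0 < e -> exists N, forall m n, (N <= m)%N -> (N <= n)%N ->
     nrm (fun x => u m x - u n x) <= e) ->
  exists2 g, L2 g & nrm (fun x => u n x - g x) @[n --> \oo] --> 0.
Proof.
move=> u2 uC.
have hk (k : nat) : exists N, forall m n, (N <= m)%N -> (N <= n)%N ->
     nrm (fun x => u m x - u n x) <= 2^-1 ^+ k.
  by apply: uC; rewrite exprn_gt0.
have [N HN] := choice hk.
(* Summing the thresholds makes [phi] nondecreasing, at least [N k] (consecutive terms are
   geometrically close) and at least [k]. *)
pose phi k := (\sum_(i < k.+1) (N i).+1)%N.
have Nphi k : (N k <= phi k)%N by rewrite /phi big_ord_recr/= (leq_trans (leqnSn _))// leq_addl.
have phiS k : (phi k <= phi k.+1)%N by rewrite [phi k.+1]big_ord_recr/= leq_addr.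
have [g g2 gv] := @L2_fast_cvg (u \o phi) (fun k => u2 _)
  (fun k => HN k _ _ (leq_trans (Nphi k) (phiS k)) (Nphi k)).
exists g => //; apply/cvgrPdist_le => e e0.
have e20 : 0 < e / 2 by rewrite divr_gt0.
have [M HM] := uC _ e20.
have /cvgrPdist_le/(_ _ e20)[K _ HK] := gv.
have kphi k : (k <= phi k)%N.
  by elim: k => // k IH; rewrite [phi k.+1]big_ord_recr/= -/(phi k) addnS ltnS (leq_trans IH)// leq_addr.
near \oo => k.
exists M => // n /= Mn; rewrite sub0r normrN ger0_norm ?nrm_ge0//.
apply: (le_trans (nrmB_le (u2 n) (u2 (phi k)) g2)).
rewrite [e]splitr lerD//.
  by apply: HM => //; rewrite (leq_trans _ (kphi k))//; near: k; exists M.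
have := HK k; rewrite sub0r normrN ger0_norm ?nrm_ge0//; apply.
by near: k; exists K.
Unshelve. all: by end_near. Qed.

End L2_completeness.

(** * The Poisson kernel *)

Section poisson_kernel.
Context {R : realType}.
Local Notation mu := (@lebesgue_measure R).
Local Notation mR := (measurableTypeR R).

(** [f] may involve the absolute value of its argument and fail to be differentiable at 0. [F] is
    therefore a primitive of a smooth [g] that agrees with [f] only on the positive half-line, and
    evenness doubles the result. *)
Lemma integral_even_FTC (f F g : R -> R) (l : R) : (forall x, 0 <= f x) -> continuous f ->
  (forall x, f (- x) = f x) -> (forall x : R, is_derive x 1 F (g x)) ->
  (forall x, 0 < x -> g x = f x) -> F x @[x --> +oo] --> l ->
  mu.-integrable setT (EFin \o f) /\ \int[mu]_x f x = 2 * (l - F 0).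
Proof.
move=> f0 cf fe dF gf Fl.
have E : (\int[mu]_x (f x)%:E = (2 * (l - F 0))%:E)%E.
  rewrite ge0_symfun_integralT//; last by move=> x /=; rewrite fe.
  rewrite -set_itvcy (@ge0_continuous_FTC2y _ f F 0 l)//.
  - exact: continuous_subspaceT.
  - apply: cvg_at_right_filter; have [d _] := dF 0.
    exact/differentiable_continuous/derivable1_diffP.
  - move=> x; rewrite in_itv/= andbT => x0; rewrite derive1E.
    by have [_ ->] := dF x; exact: gf.
split; last by rewrite /Rintegral E.
apply/integrableP; split; first by apply/measurable_EFinP; exact: continuous_measurable_fun.
by under eq_integral do rewrite abse_EFin ger0_norm//; rewrite E ltry.
Qed.

Definition expk (e x : R) : R := expR (- (e * `|x|)).
(** The unnormalised transform of [expk e]; accordingly its total mass is 2 pi instead of 1. *)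
Definition poisson (e y : R) : R := 2 * e / (e ^+ 2 + y ^+ 2).

Variable e : R.
Hypothesis e0 : 0 < e.

Let den_gt0 (y : R) : 0 < e ^+ 2 + y ^+ 2.
Proof. by rewrite ltr_wpDr ?sqr_ge0// exprn_gt0. Qed.

Let den_neq0 (y : R) : e ^+ 2 + y ^+ 2 != 0.
Proof. exact: lt0r_neq0. Qed.

Lemma expk_gt0 x : 0 < expk e x. Proof. exact: expR_gt0. Qed.

Lemma expk_le1 x : expk e x <= 1.
Proof. by rewrite -expR0 ler_expR oppr_le0 mulr_ge0// ltW. Qed.

Lemma continuous_expk : continuous (expk e).
Proof.
move=> x; apply: continuous_comp; last exact: continuous_expR.
apply: continuousN; apply: (@continuousM _ _ (cst e) Num.norm); first exact: cst_continuous.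
exact: norm_continuous.
Qed.

Lemma continuous_poisson : continuous (poisson e).
Proof.
move=> y; rewrite /poisson; apply: cvgM; first exact: cvg_cst.
apply: cvgV; first exact: den_neq0.
by apply: cvgD; [exact: cvg_cst|exact: exprn_continuous].
Qed.

Lemma cvg_expk (h : R -> R) (k : R) : (forall x, `|h x| <= k) ->
  expR (- (e * x)) * h x @[x --> +oo] --> 0.
Proof.
move=> hk.
have cv : expR (- (e * x)) * k @[x --> +oo] --> 0.
  rewrite -[X in _ --> X](mul0r k); apply: cvgM; last exact: cvg_cst.
  have ey : e * x @[x --> +oo] --> +oo.
    by apply: gt0_cvgMry => //; exact: cvg_id.
  exact: (cvg_comp _ _ ey (@cvgr_expR R)).
apply/norm_cvg0P; apply: (@squeeze_cvgr _ _ _ _ (fun=> 0) (fun x => expR (- (e * x)) * k)) => //.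
- near=> x; rewrite normr_ge0 normrM ger0_norm ?expR_ge0//=.
  by rewrite ler_wpM2l ?expR_ge0.
- exact: cvg_cst.
Unshelve. all: by end_near. Qed.

Lemma is_derive_expk_cos (y x : R) :
  is_derive x 1 (fun x => - e^-1 * expR (- (e * x)) +
     expR (- (e * x)) * (y * sin (y * x) - e * cos (y * x)) / (e ^+ 2 + y ^+ 2))
    (expR (- (e * x)) * (1 + cos (y * x))).
Proof.
apply: is_derive_eq; rewrite /GRing.scale/=.
by field; rewrite den_neq0 lt0r_neq0.
Qed.

(** Adding 1 to the cosine makes the integrand nonnegative, as [integral_even_FTC] requires; the
    case [y = 0] then gives the integral of [expk e], which is subtracted again in [cint_expk]. *)
Lemma expk_cos (y : R) :
  mu.-integrable setT (EFin \o (fun x => expk e x * (1 + cos (y * x)))) /\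
  \int[mu]_x (expk e x * (1 + cos (y * x))) = 2 * e^-1 + poisson e y.
Proof.
have [|||||H1 H2] := @integral_even_FTC (fun x => expk e x * (1 + cos (y * x)))
  _ _ 0 _ _ _ (is_derive_expk_cos y).
- move=> x; apply: mulr_ge0; first exact/ltW/expk_gt0.
  by have := cos_geN1 (y * x); lra.
- move=> x; apply: cvgM; first exact: continuous_expk.
  apply: cvgD; first exact: cvg_cst.
  apply: continuous_comp; last exact: continuous_cos.
  by apply: cvgM; [exact: cvg_cst|exact: cvg_id].
- by move=> x; rewrite /expk normrN mulrN cosN.
- by move=> x x0; rewrite /expk ger0_norm// ltW.
- rewrite -[X in _ --> X](addr0 0); apply: cvgD.
    rewrite -[X in _ --> X](mulr0 (- e^-1)); apply: cvgM; first exact: cvg_cst.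
    have := @cvg_expk (fun=> 1) 1; under eq_fun do rewrite mulr1; apply.
    by move=> _; rewrite normr1.
  under eq_fun do rewrite -mulrA.
  apply: (@cvg_expk (fun x => (y * sin (y * x) - e * cos (y * x)) / (e ^+ 2 + y ^+ 2))
    ((`|y| + e) / (e ^+ 2 + y ^+ 2))) => x.
  rewrite normrM [`|_^-1|]gtr0_norm ?invr_gt0// ler_pM2r ?invr_gt0//.
  rewrite (le_trans (ler_normB _ _))// !normrM lerD//.
    by rewrite ler_piMr// sin_max.
  by rewrite (gtr0_norm e0) ler_piMr ?cos_max// ltW.
split=> //; rewrite H2 !mulr0 oppr0 expR0 sin0 cos0 /poisson.
by field; rewrite den_neq0 lt0r_neq0.
Qed.

Lemma integrable_expk : mu.-integrable setT (EFin \o expk e).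
Proof.
have [H _] := expk_cos 0.
have := integrableZl measurableT 2^-1 H; congr (_.-integrable _ _).
apply/funext => x /=; rewrite mul0r cos0; congr EFin; by field.
Qed.

Lemma integral_expk : \int[mu]_x expk e x = 2 * e^-1.
Proof.
have [H1 H2] := expk_cos 0; move: H2.
under eq_Rintegral do rewrite mul0r cos0 mulrC.
rewrite RintegralZl//; last exact: integrable_expk.
rewrite /poisson expr0n addr0.
have -> : 2 * e / e ^+ 2 = 2 * e^-1 by field; exact: lt0r_neq0.
lra.
Qed.

Lemma L1_expk : L1 (fun x => (expk e x)%:C%C).
Proof. exact: L1_real integrable_expk. Qed.

Lemma L1_expk_expi (y : R) : L1 (fun x => (expk e x)%:C%C * expi (y * x)).
Proof.
under eq_fun do rewrite mulrC; apply: (@L1Ml _ _ (fun x => expi (y * x)) 1).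
- exact: L1_expk.
- by apply: cmeas_expi; exact: (measurable_funM _ _).
- by move=> x; rewrite normc_expi.
Qed.

Lemma cint_expk (y : R) : cint (fun x => (expk e x)%:C%C * expi (y * x)) = (poisson e y)%:C%C.
Proof.
have h1 := L1_expk_expi y.
apply: complex_eq; rewrite /cint/=.
  have [H1 H2] := expk_cos y.
  under eq_Rintegral do rewrite mul0r subr0.
  have -> : \int[mu]_x (expk e x * cos (y * x)) =
            \int[mu]_x (expk e x * (1 + cos (y * x)) - expk e x).
    by apply: eq_Rintegral => x _; ring.
  by rewrite RintegralB// ?H2 ?integral_expk ?[2 * _ + _]addrC ?addrK//; exact: integrable_expk.
under eq_Rintegral do rewrite mul0r addr0.
set I := (X in X = 0).
(* The integrand is odd: the reflection of the variable changes the sign of the integral. *)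
suff : I = - I by move=> H; lra.
have iI : mu.-integrable setT (EFin \o (fun x => expk e x * sin (y * x))).
  have := L1_Im h1; congr (_.-integrable _ _).
  by apply/funext => x /=; rewrite mul0r addr0.
rewrite /I -mulN1r -RintegralZl//.
have := @Rintegral_affine R (-1) 0 _ _ iI; rewrite oppr_eq0 oner_eq0 => /(_ isT).
rewrite normrN1 invr1 mul1r => <-; apply: eq_Rintegral => x _.
by rewrite addr0 mulN1r /expk normrN mulrN sinN mulN1r mulrN.
Qed.

Lemma is_derive_atan_poisson (x y : R) :
  is_derive y 1 (fun y => 2 * atan ((y - x) / e)) (poisson e (x - y)).
Proof.
apply: is_derive_eq; rewrite /GRing.scale/= /poisson.
have -> : 1 + ((y - x) / e) ^+ 2 = (e ^+ 2 + (x - y) ^+ 2) / e ^+ 2.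
  by field; exact: lt0r_neq0.
by field; rewrite den_neq0 lt0r_neq0.
Qed.

Lemma poisson_ge0 y : 0 <= poisson e y.
Proof. by apply: divr_ge0; [apply: mulr_ge0 => //; exact: ltW|exact/ltW/den_gt0]. Qed.

Lemma poissonN y : poisson e (- y) = poisson e y.
Proof. by rewrite /poisson sqrrN. Qed.

Lemma integral_poisson : mu.-integrable setT (EFin \o poisson e) /\
  \int[mu]_x poisson e x = 2 * pi.
Proof.
have [||||||H1 H2] := @integral_even_FTC (poisson e) (fun y => 2 * atan ((y - 0) / e))
  (fun y => poisson e (0 - y)) pi.
- exact: poisson_ge0.
- exact: continuous_poisson.
- exact: poissonN.
- by move=> x; exact: is_derive_atan_poisson.
- by move=> x _; rewrite sub0r poissonN.
- rewrite [X in _ --> X](_ : _ = 2 * (pi / 2)); last by field.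
  apply: cvgM; first exact: cvg_cst.
  have ey : (x - 0) / e @[x --> +oo] --> +oo.
    apply: gt0_cvgMly; first by rewrite invr_gt0.
    by under eq_fun do rewrite subr0; exact: cvg_id.
  exact: (cvg_comp _ _ ey (@cvgy_atan R)).
split=> //; rewrite H2 subrr mul0r atan0 mulr0 subr0//.
Qed.

Lemma integral_poisson_itv (x a b : R) : a < b ->
  mu.-integrable `[a, b] (fun y => (poisson e (x - y))%:E) /\
  \int[mu]_(y in `[a, b]) poisson e (x - y) = 2 * (atan ((b - x) / e) - atan ((a - x) / e)).
Proof.
move=> ab.
have cp : continuous (fun y => poisson e (x - y)).
  move=> y; apply: (@continuous_comp _ _ _ (fun y => x - y) (poisson e));
    last exact: continuous_poisson.
  by apply: cvgB; [exact: cvg_cst|exact: cvg_id].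
have cF z : {for z, continuous (fun y => 2 * atan ((y - x) / e))}.
  have [d _] := is_derive_atan_poisson x z.
  exact/differentiable_continuous/derivable1_diffP.
have E : (\int[mu]_(y in `[a, b]) (poisson e (x - y))%:E =
  (2 * atan ((b - x) / e))%:E - (2 * atan ((a - x) / e))%:E)%E.
  apply: (@continuous_FTC2 _ _ (fun y => 2 * atan ((y - x) / e))) => //.
  - exact: continuous_subspaceT.
  - split.
    + by move=> y _; have [] := is_derive_atan_poisson x y.
    + exact: (cvg_at_right_filter (cF a)).
    + exact: (cvg_at_left_filter (cF b)).
  - by move=> y _; rewrite derive1E; have [_ ->] := is_derive_atan_poisson x y.
split; last by rewrite /Rintegral E/= mulrBr.
apply: continuous_compact_integrable; first exact: segment_compact.
exact: continuous_subspaceT.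
Qed.
End poisson_kernel.

(** * Indicators of intervals and Lebesgue differentiation *)

Section indicators.
Context {R : realType}.
Local Notation mu := (@lebesgue_measure R).
Local Notation mR := (measurableTypeR R).

Definition ind (a b : R) : R -> R[i] := fun x => (\1_(`[a, b]) x)%:C%C.

Lemma indE a b x : ind a b x = if a <= x <= b then 1 else 0.
Proof.
rewrite /ind indicE; have -> : (x \in `[a, b]%classic) = (a <= x <= b).
  by rewrite mem_setE in_itv.
by case: ifP.
Qed.

Lemma normc_ind a b x : normc (ind a b x) <= 1.
Proof. by rewrite indE; case: ifP => _; rewrite ?Normc.normc1 ?Normc.normc0. Qed.

Lemma cmeas_ind a b : cmR (ind a b).
Proof. by apply: cmeas_real; exact: measurable_indic. Qed.

Lemma conj_ind a b x : conjc (ind a b x) = ind a b x.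
Proof. exact: conj_RC. Qed.

Lemma indM a b x : ind a b x * ind a b x = ind a b x.
Proof. by rewrite indE; case: ifP; rewrite ?mul1r ?mul0r. Qed.

Lemma L1_ind a b : L1 (ind a b).
Proof. exact: L1_real (integrable_indic_itv a b true false). Qed.

Lemma L2_ind a b : L2 (ind a b).
Proof.
apply: (L2_le _ (integrable_indic_itv a b true false)); first exact: cmeas_ind.
by move=> x; rewrite normc_real indicE; case: (_ \in _); rewrite ?normr1 ?normr0 ?expr1n ?expr0n.
Qed.

Lemma L2_indM a b f : L2 f -> L2 (fun x => ind a b x * f x).
Proof. by move=> f2; apply: L2M f2 (cmeas_ind a b) (normc_ind a b). Qed.

Lemma L1_indM a b f : L1 f -> L1 (fun x => ind a b x * f x).
Proof. by move=> f2; apply: L1Ml f2 (cmeas_ind a b) (normc_ind a b). Qed.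

Lemma L2_indL1 a b f : L2 f -> L1 (fun x => ind a b x * f x).
Proof. by move=> f2; apply: L2_mulL1 => //; exact: L2_ind. Qed.

Lemma cint_ind a b f : cintegral `[a, b] f = cint (fun x => ind a b x * f x).
Proof.
apply: complex_eq; rewrite /cint/= Rintegral_mkcond; apply: eq_Rintegral => x _;
  rewrite patchE /ind indicE; case: (x \in _);
  by rewrite ?(mul1r (f x)) ?(mul0r (f x)).
Qed.

Lemma nrm_ind a b : a <= b -> nrm (ind a b) ^+ 2 = b - a.
Proof.
move=> ab; rewrite nrm_sqr.
have -> : \int[mu]_x normc (ind a b x) ^+ 2 = \int[mu]_x (\1_(`[a, b]) x).
  apply: eq_Rintegral => x _; rewrite normc_real indicE.
  by case: (_ \in _); rewrite ?normr1 ?normr0 ?expr1n ?expr0n.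
rewrite /Rintegral integral_indic// setIT /= lebesgue_measure_itv/= lte_fin.
by case: ltP => //= ba; apply/esym/eqP; rewrite subr_eq0 eq_le ab ba.
Qed.

Lemma cint_ind1 a b : a <= b -> cint (ind a b) = (b - a)%:C%C.
Proof.
move=> ab; rewrite /ind cint_real; congr (_%:C%C).
rewrite /Rintegral integral_indic// setIT /= lebesgue_measure_itv/= lte_fin.
by case: ltP => //= ba; apply/esym/eqP; rewrite subr_eq0 eq_le ab ba.
Qed.

Lemma ind_affine (a b c d x : R) : 0 < c ->
  ind a b (c * x + d) = ind ((a - d) / c) ((b - d) / c) x.
Proof.
move=> c0; rewrite !indE ler_pdivrMr// ler_pdivlMr// lerBlDr lerBrDr.
by rewrite [x * c]mulrC.
Qed.

Definition loc_L1 (f : R -> R[i]) := forall a b, L1 (fun x => ind a b x * f x).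

Lemma loc_L1_bounded (f : R -> R[i]) k : cmR f -> (forall x, normc (f x) <= k) -> loc_L1 f.
Proof.
by move=> mf fk a b; under eq_fun do rewrite mulrC; exact: L1Ml (L1_ind a b) mf fk.
Qed.

(** The differentiation theorem controls the mean of [|f y - f x|] over open balls. Endpoints do not
    matter for the integral, and the distance from the mean of [f] to [f x] is at most that mean. *)
Lemma lebesgue_avg_real (f : R -> R) : locally_integrable setT f ->
  {ae mu, forall x, (2 * r)^-1 * \int[mu]_(y in `[x - r, x + r]) f y @[r --> 0^'+] --> f x}.
Proof.
move=> lf; apply: (ae_imp (lebesgue_differentiation lf)) => x xf.
have mf : measurable_fun [set: mR] f by case: lf.
have if_ (r : R) : mu.-integrable `[x - r, x + r] (EFin \o f).
  case: lf => _ _ lf; apply/integrableP; split.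
    by apply/measurable_EFinP; exact: measurable_funTS.
  apply: lf => //; exact: segment_compact.
have ic (r : R) : mu.-integrable `[x - r, x + r] (EFin \o (fun=> f x)).
  apply: continuous_compact_integrable; first exact: segment_compact.
  exact/continuous_subspaceT/cst_continuous.
have davgE (r : R) : 0 < r -> davg f x r = ((2 * r)^-1 * \int[mu]_(y in `[x - r, x + r]) `|f y - f x|)%:E.
  move=> r0; rewrite /davg /iavg.
  rewrite (lebesgue_measure_ball _ (ltW r0)).
  have ia : mu.-integrable `[x - r, x + r] (EFin \o (fun y => `|f y - f x|)).
    have ib : mu.-integrable `[x - r, x + r] (fun y => (f y - f x)%:E).
      exact: (integrableB _ (if_ r) (ic r)).
    exact: (integrable_abse ib).
  rewrite EFinM; congr (_ * _)%E.
    by rewrite inver mulrn_eq0/= gt_eqF// mulr_natl.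
  rewrite /Rintegral fineK; last exact: integrable_fin_num ia.
  have mi := measurable_int _ ia.
  rewrite ball_itv -integral_itv_obnd_cbnd ?integral_itv_bndo_bndc//;
    apply: measurable_funS mi => //; move=> y /=; rewrite !in_itv/=.
  + by move=> /andP[/ltW -> /ltW ->].
  + by move=> /andP[/ltW -> ->].
apply/cvgrPdist_le => e e0.
case/fine_cvgP : xf => _ /cvgr_lt/(_ _ e0).
apply: filterS2 (nbhs_right_gt (0 : R)) => r r0 /=; rewrite davgE//= => /ltW; apply: le_trans.
have r20 : 0 < 2 * r by rewrite mulr_gt0.
rewrite -[X in `|X - _|](mulVKf (lt0r_neq0 r20) (f x)) mulrCA -mulrBr normrM.
rewrite gtr0_norm ?invr_gt0// ler_pM2l ?invr_gt0//.
have -> : 2 * r * f x = \int[mu]_(y in `[x - r, x + r]) f x.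
  rewrite Rintegral_cst// /= lebesgue_measure_itv/= lte_fin ltrD2l gtrN//.
  by rewrite -EFinB/=; ring.
rewrite distrC -RintegralB//.
apply: le_normr_Rintegral => //; exact: (integrableB _ (if_ r) (ic r)).
Qed.

Lemma loc_L1_locally_integrable (p : R[i] -> R) f : loc_L1 f ->
  measurable_fun [set: mR] (fun x => p (f x)) -> (forall z, `|p z| <= normc z) ->
  locally_integrable setT (fun x => p (f x)).
Proof.
move=> lf mp pn; split => //; first exact: openT.
move=> K _ cK.
have [k Hk] : exists k : R, forall x, K x -> - k <= x <= k.
  have /= := compact_bounded cK; rewrite /bounded_near => [[k [_ Hk]]].
  exists (k + 1) => x Kx; rewrite -ler_norml; apply: (Hk (k + 1)) => //.
  by rewrite ltrDl.
have mK : measurable (K : set mR) by exact: compact_measurable.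
have [mi /integrableP[_ fi]] := lf (- k) k.
apply: le_lt_trans fi; rewrite integral_mkcond.
apply: ge0_le_integral => //.
- by move=> x _; rewrite patchE; case: ifP.
- have H : measurable_fun [set: mR] (fun x => (`|p (f x)|)%:E).
    by apply/measurable_EFinP; exact: measurableT_comp.
  by move: (measurable_funTS (D := K) H) => /(measurable_restrictT _ mK).
- apply: measurableT_comp => //; apply/measurable_EFinP.
  exact: (@measurable_normc _ _ mR).
move=> x _; rewrite patchE; case: ifPn => [xK|_]; last exact: abse_ge0.
have xk := Hk _ (set_mem xK).
by rewrite indE xk mul1r /= lee_fin [leRHS]ger0_norm.
Qed.

Lemma loc_L1_cmeas f : loc_L1 f -> cmR f.
Proof.
move=> lf.
have cv (p : R[i] -> R) : (forall n : nat, measurable_fun [set: mR] (fun x => p (ind (- n%:R) n%:R x * f x))) ->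
   measurable_fun [set: mR] (fun x => p (f x)).
  move=> mp; apply: (@measurable_fun_cvg _ mR _ _ (fun n x => p (ind (- n%:R) n%:R x * f x))) => //.
  move=> x _; apply: (@cvg_near_cst _ _ _ _ _ eventually_filter).
  have [N _ HN] := nbhs_infty_ger `|x|.
  by exists N => // n /HN; rewrite ler_norml indE => ->; rewrite mul1r.
by split; apply: cv => n; have [[]] := lf (- n%:R) n%:R.
Qed.

Definition cavg f (x r : R) : R[i] :=
  ((2 * r)^-1)%:C%C * cint (fun y => ind (x - r) (x + r) y * f y).

Lemma lebesgue_avg f : loc_L1 f ->
  {ae mu, forall x, normc (cavg f x r - f x) @[r --> 0^'+] --> 0}.
Proof.
move=> lf; have [m1 m2] := loc_L1_cmeas lf.
have a1 := lebesgue_avg_real (loc_L1_locally_integrable lf m1 (@ler_Re R)).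
have a2 := lebesgue_avg_real (loc_L1_locally_integrable lf m2 (@ler_Im R)).
apply: (ae_imp2 a1 a2) => x x1 x2.
apply: (@squeeze_cvgr _ _ _ _ (fun=> 0)
    (fun r => `|Re (cavg f x r) - Re (f x)| + `|Im (cavg f x r) - Im (f x)|)).
- by apply: nearW => k; rewrite normc_ge0 -ReB -ImB normc_le.
- exact: cvg_cst.
have E r : cavg f x r = Complex ((2 * r)^-1 * \int[mu]_(y in `[x - r, x + r]) Re (f y))
   ((2 * r)^-1 * \int[mu]_(y in `[x - r, x + r]) Im (f y)).
  by rewrite /cavg -cint_ind; apply: complex_eq; rewrite ?ReM ?ImM/= mul0r ?subr0 ?addr0.
rewrite -[X in _ --> X](addr0 0); apply: cvgD; apply: cvg_dist0.
  by under eq_fun do rewrite E/=; exact: x1.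
by under eq_fun do rewrite E/=; exact: x2.
Qed.

(** All symmetric averages of [f] vanish, while at almost every point they converge to the value of
    [f]. *)
Lemma ae0_ind f : loc_L1 f -> (forall a b, a < b -> cint (fun y => ind a b y * f y) = 0) ->
  {ae mu, forall x, f x = 0}.
Proof.
move=> lf f0; apply: (ae_imp (lebesgue_avg lf)) => x H.
apply: normc_eq0; apply/eqP; rewrite eq_le normc_ge0 andbT leNgt; apply/negP => fx.
have /filter_ex[r [r0]] : \forall r \near 0^'+, 0 < r /\ normc (cavg f x r - f x) < normc (f x).
  have H1 := cvgr_lt _ H _ fx.
  by near=> r; split; near: r; [exact: nbhs_right_gt|exact: H1].
rewrite /cavg f0 ?mulr0 ?sub0r ?normcN ?ltxx//; lra.
Unshelve. all: by end_near.
Qed.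

End indicators.

(** * Plancherel's theorem *)

Section ft.
Context {R : realType}.
Local Notation mu := (@lebesgue_measure R).
Local Notation mR := (measurableTypeR R).
Implicit Types f g h : R -> R[i].

Lemma normc_expi_le1 (t : R) : normc (expi t) <= 1.
Proof. by rewrite normc_expi. Qed.

Definition ft f (x : R) : R[i] := cint (fun y => f y * expi (- (x * y))).

Lemma measurable_mul2 : measurable_fun [set: mR * mR] (fun p => p.1 * p.2).
Proof. exact: measurable_funM. Qed.

Lemma cmeas_expi2 : cmeas (fun p : mR * mR => expi (p.1 * p.2)).
Proof. exact: (cmeas_expi measurable_mul2). Qed.

Lemma cmeas_expiN2 : cmeas (fun p : mR * mR => expi (- (p.1 * p.2))).
Proof. by apply: cmeas_expi; apply: measurableT_comp => //; exact: measurable_mul2. Qed.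

Lemma cmeas_expi1 (a : R) : cmR (fun x => expi (a * x)).
Proof. by apply: cmeas_expi; exact: measurable_funM. Qed.

Lemma L1_expi f (a : R) : L1 f -> L1 (fun x => f x * expi (a * x)).
Proof.
move=> f1; under eq_fun do rewrite mulrC.
by apply: L1Ml f1 (cmeas_expi1 a) _ => x; rewrite normc_expi.
Qed.

Lemma L1_expiN f (a : R) : L1 f -> L1 (fun x => f x * expi (- (a * x))).
Proof. by move=> f1; under eq_fun do rewrite -mulNr; exact: L1_expi. Qed.

Lemma cmeas_ft f : cmR f -> cmR (ft f).
Proof.
move=> mf; apply: (cmeas_cint (k := fun p => f p.2 * expi (- (p.1 * p.2)))).
by apply: cmeasM; [exact: (cmeas_comp mf)|exact: cmeas_expiN2].
Qed.

Lemma normc_ft f x : L1 f -> normc (ft f x) <= \int[mu]_y normc (f y).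
Proof.
move=> f1; apply: le_trans (normc_cint (L1_expiN x f1)) _.
by under eq_Rintegral do rewrite normcM normc_expi mulr1.
Qed.

Lemma ft_conj f x : L1 f -> ft (fun y => conjc (f y)) x = conjc (ft f (- x)).
Proof.
move=> f1; rewrite /ft -cint_conj; last exact: L1_expiN.
by apply: eq_cint => y; rewrite conjM conj_expi opprK mulNr.
Qed.

(** Fubini for a kernel symmetric in its two variables; this is what later extends to L^2 by
    continuity. *)
Lemma ft_swap f g : L1 f -> L1 g ->
  cint (fun x => g x * ft f x) = cint (fun x => f x * ft g x).
Proof.
move=> f1 g1.
have [_ _] := cfubini g1 f1 cmeas_expiN2 (fun x y => normc_expi_le1 _).
rewrite /ft/= => ->; apply: eq_cint => x; congr (_ * _); apply: eq_cint => y.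
by rewrite [y * x]mulrC.
Qed.

Definition poisson_conv e f (xi : R) := cint (fun y => f y * (poisson e (xi - y))%:C%C).

Section regularize.
Variables (e : R) (f : R -> R[i]).
Hypotheses (e0 : 0 < e) (f1 : L1 f).

Lemma L1_expk_ft : L1 (fun x => (expk e x)%:C%C * ft f x).
Proof.
under eq_fun do rewrite mulrC; apply: (@L1Ml _ _ (ft f) (\int[mu]_y normc (f y))).
- exact: L1_expk.
- by apply: cmeas_ft; exact: L1_cmeas.
- by move=> x; exact: normc_ft.
Qed.

(** The kernel is itself the integral [cint_expk]; exchanging the integrals turns convolution into
    damping of the transform by [expk e]. *)
Lemma poisson_convE xi :
  poisson_conv e f xi = cint (fun x => (expk e x)%:C%C * ft f x * expi (xi * x)).
Proof.
have [_ _] := cfubini f1 (L1_expk_expi e0 xi) cmeas_expiN2 (fun x y => normc_expi_le1 _).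
move=> /= E; transitivity (cint (fun x => f x *
  cint (fun y => (expk e y)%:C%C * expi (xi * y) * expi (- (x * y))))).
  apply: eq_cint => y; rewrite -(cint_expk e0); congr (_ * _); apply: eq_cint => x.
  by rewrite -mulrA -expiD mulrBl.
rewrite E; apply: eq_cint => y; rewrite mulrAC; congr (_ * _ * _).
by apply: eq_cint => x; rewrite [x * y]mulrC.
Qed.

(** Used in two ways: with [h] the conjugate of [f], the right-hand side is the damped integral of
    [|ft f|^2]; with [f] an indicator, the limit of small [e] gives inversion. *)
Lemma cint_poisson_conv h : L1 h -> L1 (fun x => h x * poisson_conv e f x) /\
  cint (fun x => h x * poisson_conv e f x) =
  cint (fun x => (expk e x)%:C%C * ft f x * ft h (- x)).
Proof.
move=> h1.
have [H1 _ H2] := cfubini h1 L1_expk_ft cmeas_expi2 (fun x y => normc_expi_le1 _).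
have E : (fun x => h x * poisson_conv e f x) = (fun x => h x *
    cint (fun y => (expk e y)%:C%C * ft f y * expi (x * y))).
  by apply/funext => x; rewrite poisson_convE.
rewrite E; split; first exact: H1.
rewrite [LHS]H2; apply: eq_cint => x; congr (_ * _); apply: eq_cint => y /=.
by rewrite mulNr opprK [y * x]mulrC.
Qed.

End regularize.

End ft.

(** * The quadratic form of the Poisson kernel on L^2 *)

Section contraction.
Context {R : realType}.
Local Notation mu := (@lebesgue_measure R).
Local Notation mR := (measurableTypeR R).
Implicit Types f g h : R -> R[i].

Lemma ge0_integral_poisson (e x : R) : 0 < e ->
  (\int[mu]_y (poisson e (x - y))%:E = (2 * pi)%:E)%E.
Proof.
move=> e0; have [ip vp] := integral_poisson e0.
have n0 : (-1 : R) != 0 by rewrite oppr_eq0 oner_eq0.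
have := @Rintegral_affine R (-1) x n0 _ ip; rewrite normrN1 invr1 mul1r vp => <-.
rewrite /Rintegral fineK; last first.
  exact: integrable_fin_num (integrable_affine x n0 ip).
by apply: eq_integral => y _; rewrite mulN1r addrC.
Qed.

Lemma measurable_poisson (e : R) : 0 < e -> measurable_fun [set: R] (poisson e).
Proof. by move=> e0; apply: continuous_measurable_fun; exact: continuous_poisson. Qed.

(** Schur's test: bound [|f x| |f y|] by half the sum of the squares; the kernel is symmetric and
    has mass 2 pi in each variable. *)
Lemma poisson_quadratic_bound e f : 0 < e -> L1 f -> L2 f ->
  normc (cint (fun x => conjc (f x) * poisson_conv e f x)) <= 2 * pi * nrm f ^+ 2.
Proof.
move=> e0 f1 f2; have [mf if2] := (L2P _).1 f2.
pose P := poisson e.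
have P0 y : 0 <= P y by exact: poisson_ge0.
have PB x y : P (x - y) = P (y - x) by rewrite /P -poissonN opprB.
have mP2 : measurable_fun [set: mR * mR] (fun p => P (p.1 - p.2)).
  by apply: (measurableT_comp (measurable_poisson e0)); exact: measurable_funB.
pose a x := normc (f x).
have a0 x : 0 <= a x by exact: normc_ge0.
have ma : measurable_fun [set: mR] a by exact: (@measurable_normc _ _ mR).
have ma1 : measurable_fun [set: mR * mR] (fun p => a p.1) by exact: (measurableT_comp ma).
have ma2 : measurable_fun [set: mR * mR] (fun p => a p.2) by exact: (measurableT_comp ma).
have mP1 x : measurable_fun [set: mR] (fun y => P (x - y)).
  by apply: (measurableT_comp (measurable_poisson e0)); exact: measurable_funB.
(* [q1] and [q2] are the two halves of the Schur bound; each has double integral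
   [pi * nrm f ^+ 2]. *)
pose q1 := fun p : mR * mR => (2^-1 * a p.1 ^+ 2 * P (p.1 - p.2))%:E.
pose q2 := fun p : mR * mR => (2^-1 * a p.2 ^+ 2 * P (p.1 - p.2))%:E.
have mq1 : measurable_fun setT q1.
  apply/measurable_EFinP/measurable_funM => //; apply: measurable_funM => //.
  exact: measurable_funX.
have mq2 : measurable_fun setT q2.
  apply/measurable_EFinP/measurable_funM => //; apply: measurable_funM => //.
  exact: measurable_funX.
have q0 (x y : R) : 0 <= 2^-1 * x ^+ 2 * P y.
  apply: mulr_ge0 => //; apply: mulr_ge0; last exact: sqr_ge0.
  by rewrite invr_ge0.
have q10 p : (0 <= q1 p)%E by rewrite lee_fin.
have q20 p : (0 <= q2 p)%E by rewrite lee_fin.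
have A0 : (\int[mu]_x (2^-1 * a x ^+ 2 * (2 * pi))%:E = (pi * nrm f ^+ 2)%:E)%E.
  rewrite nrm_sqr /Rintegral EFinM fineK; last exact: integrable_fin_num if2.
  rewrite -integralZl//; apply: eq_integral => x _; rewrite -EFinM; congr EFin.
  by rewrite /a; field.
have A1 : (\int[mu]_x \int[mu]_y q1 (x, y) = (pi * nrm f ^+ 2)%:E)%E.
  rewrite -A0; apply: eq_integral => x _; rewrite /q1/=.
  under eq_integral do rewrite EFinM.
  rewrite ge0_integralZl//.
  - by rewrite ge0_integral_poisson// -EFinM.
  - by apply/measurable_EFinP; exact: mP1.
  - by move=> y _; rewrite lee_fin.
  - by rewrite lee_fin mulr_ge0 ?invr_ge0 ?sqr_ge0//.
have A2 : (\int[mu]_x \int[mu]_y q2 (x, y) = (pi * nrm f ^+ 2)%:E)%E.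
  rewrite (fubini_tonelli q2 mq2 q20) -A0; apply: eq_integral => x _; rewrite /q2/=.
  under eq_integral do rewrite PB EFinM.
  rewrite ge0_integralZl//.
  - by rewrite ge0_integral_poisson// -EFinM.
  - by apply/measurable_EFinP; exact: mP1.
  - by move=> y _; rewrite lee_fin.
  - by rewrite lee_fin mulr_ge0 ?invr_ge0 ?sqr_ge0//.
have [H1 _] := cint_poisson_conv e0 f1 (L1_conj f1).
have Hle : (\int[mu]_x (normc (conjc (f x) * poisson_conv e f x))%:E <=
   \int[mu]_x (\int[mu]_y q1 (x, y) + \int[mu]_y q2 (x, y)))%E.
  apply: ge0_le_integral => //.
  - by move=> x _; rewrite lee_fin.
  - apply/measurable_EFinP; exact: (@measurable_normc _ _ mR _ (L1_cmeas H1)).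
  - apply: emeasurable_funD.
      exact: (measurable_fun_fubini_tonelli_F q1 mq1 q10).
    exact: (measurable_fun_fubini_tonelli_F q2 mq2 q20).
  move=> x _.
  have fP : L1 (fun y => f y * (P (x - y))%:C%C).
    have k : exists k, forall y, P y <= k.
      (* Being the transform of [expk e], the kernel is bounded by the integral of [expk e]. *)
      exists (2 * e^-1) => y; rewrite /P -(integral_expk e0).
      rewrite -[leLHS]ger0_norm// -normc_real -(cint_expk e0).
      apply: le_trans (normc_cint (L1_expk_expi e0 _)) _.
      rewrite le_eqVlt; apply/orP; left; apply/eqP/eq_Rintegral => z _.
      by rewrite normcM normc_expi mulr1 normc_real ger0_norm// ltW// expk_gt0.
    case: k => k Pk.
    under eq_fun do rewrite mulrC; apply: (@L1Ml _ _ (fun y => (P (x - y))%:C%C) k f1).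
      by apply: cmeas_real; exact: mP1.
    by move=> y; rewrite normc_real ger0_norm.
  rewrite -ge0_integralD//; last 2 first.
  - exact: (measurableT_comp mq1).
  - exact: (measurableT_comp mq2).
  apply: (@le_trans _ _ (\int[mu]_y (a x * (a y * P (x - y)))%:E)%E).
    have iap : mu.-integrable setT (fun y => (a y * P (x - y))%:E).
      have [_] := fP; congr (_.-integrable _ _); apply/funext => y.
      by rewrite normcM normc_real ger0_norm.
    under [leRHS]eq_integral do rewrite EFinM.
    rewrite integralZl// -[(\int[mu]_y _)%E]fineK; last exact: integrable_fin_num iap.
    rewrite -EFinM lee_fin normcM normc_conj ler_wpM2l//.
    apply: le_trans (normc_cint fP) _.
    rewrite le_eqVlt; apply/orP; left; apply/eqP/eq_Rintegral => y _.
    by rewrite normcM normc_real ger0_norm.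
  apply: ge0_le_integral => //.
  - by move=> y _; rewrite lee_fin; apply: mulr_ge0 => //; apply: mulr_ge0.
  - apply/measurable_EFinP; apply: measurable_funM; first exact: measurable_cst.
    by apply: measurable_funM => //; exact: mP1.
  - by apply: emeasurable_funD; [exact: (measurableT_comp mq1)|exact: (measurableT_comp mq2)].
  move=> y _; rewrite /q1 /q2/= -EFinD lee_fin mulrA -mulrDl ler_wpM2r//.
  have := sqr_ge0 (a x - a y); rewrite !expr2; lra.
rewrite -lee_fin; apply: le_trans (le_trans _ Hle) _.
  rewrite -[leRHS]fineK; last exact: integrable_fin_num H1.2.
  by rewrite lee_fin; exact: normc_cint.
rewrite ge0_integralD//.
- by rewrite A1 A2 -EFinD lee_fin; lra.
- by move=> x _; exact: integral_ge0.
- exact: (measurable_fun_fubini_tonelli_F q1 mq1 q10).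
- by move=> x _; exact: integral_ge0.
- exact: (measurable_fun_fubini_tonelli_F q2 mq2 q20).
Qed.

End contraction.

(** * Plancherel's inequality, injectivity and isometry on indicators *)

Section ft_L2.
Context {R : realType}.
Local Notation mu := (@lebesgue_measure R).
Local Notation mR := (measurableTypeR R).
Implicit Types f g h : R -> R[i].

Lemma L2_affine (a b : R) f : a != 0 -> L2 f -> L2 (fun x => f (a * x + b)).
Proof.
move=> a0 /L2P[mf fi]; apply/L2P; split; first exact: (cmeas_comp mf (measurable_affine a b)).
exact: (@integrable_affine R a b a0 (fun x => normc (f x) ^+ 2)).
Qed.

Lemma L2_reflect f : L2 f -> L2 (fun x => f (- x)).
Proof.
have n0 : (-1 : R) != 0 by rewrite oppr_eq0 oner_eq0.
by move=> /(L2_affine 0 n0); under eq_fun do rewrite mulN1r addr0.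
Qed.

Let eps (n : nat) : R := n.+1%:R^-1.

Let eps_gt0 n : 0 < eps n. Proof. by rewrite invr_gt0. Qed.

Lemma expk_eps_nd x : {homo (fun n => expk (eps n) x) : m n / (m <= n)%N >-> m <= n}.
Proof.
move=> m n mn; rewrite ler_expR lerN2 ler_wpM2r// lef_pV2 ?posrE//.
by rewrite ler_nat ltnS.
Qed.

Lemma cvg_expk_eps x : expk (eps n) x @[n --> \oo] --> (1 : R).
Proof.
have cv : - (eps n * `|x|) @[n --> \oo] --> (0 : R).
  rewrite -[X in _ --> X]oppr0; apply: cvgN; rewrite -[X in _ --> X](mul0r `|x|).
  by apply: cvgM; [exact: cvg_harmonic|exact: cvg_cst].
have := cvg_comp _ _ cv (@continuous_expR R 0); rewrite expR0; exact.
Qed.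

(** The integrals of [|ft f|^2] damped by [expk (eps n)] are bounded uniformly in [n] by
    [poisson_quadratic_bound]; monotone convergence removes the damping. *)
Lemma ft_L2 f : L1 f -> L2 f -> L2 (ft f) /\ nrm (ft f) ^+ 2 <= 2 * pi * nrm f ^+ 2.
Proof.
move=> f1 f2.
pose g n x := (expk (eps n) x * normc (ft f x) ^+ 2)%:E.
have mF : cmR (ft f) by apply: cmeas_ft; exact: L1_cmeas.
have L1g n : L1 (fun x => (expk (eps n) x * normc (ft f x) ^+ 2)%:C%C).
  have E : (fun x => (expk (eps n) x * normc (ft f x) ^+ 2)%:C%C) =
      (fun x => conjc (ft f x) * ((expk (eps n) x)%:C%C * ft f x)).
    by apply/funext => x; rewrite RC_M -mulcJ; ring.
  rewrite E; apply: (@L1Ml _ _ (fun x => conjc (ft f x)) (\int[mu]_y normc (f y))).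
  - exact: L1_expk_ft.
  - exact: cmeas_conj.
  - by move=> x; rewrite normc_conj normc_ft.
have ig n : mu.-integrable setT (g n).
  exact: (L1_Re (L1g n)).
have gle n : (\int[mu]_x g n x <= (2 * pi * nrm f ^+ 2)%:E)%E.
  have [_ H] := cint_poisson_conv (eps_gt0 n) f1 (L1_conj f1).
  have := poisson_quadratic_bound (eps_gt0 n) f1 f2.
  have {}H : cint (fun x => conjc (f x) * poisson_conv (eps n) f x) =
     (\int[mu]_x (expk (eps n) x * normc (ft f x) ^+ 2))%:C%C.
    rewrite H -cint_real; apply: eq_cint => x.
    by rewrite (ft_conj _ f1) opprK RC_M -(mulcJ (ft f x)) mulrA.
  rewrite H normc_real => /(le_trans (ler_norm _)).
  by rewrite -lee_fin /Rintegral fineK//; exact: integrable_fin_num (ig n).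
have mg n : measurable_fun [set: mR] (g n) by exact: measurable_int (ig n).
have glim : (\int[mu]_x g n x @[n --> \oo] --> \int[mu]_x (normc (ft f x) ^+ 2)%:E)%E.
  have -> : (fun x => (normc (ft f x) ^+ 2)%:E) = fun x => limn (g ^~ x).
    apply/funext => x; apply/esym/cvg_lim => //; apply: cvg_EFin; first exact: nearW.
    rewrite /g/= -[X in _ --> X]mul1r; apply: cvgM; last exact: cvg_cst.
    exact: cvg_expk_eps.
  apply: cvg_monotone_convergence => //.
  - by move=> n x _; rewrite lee_fin mulr_ge0 ?sqr_ge0// ltW// expk_gt0.
  - by move=> x _ m n mn; rewrite lee_fin ler_wpM2r ?sqr_ge0// expk_eps_nd.
have le2 : (\int[mu]_x (normc (ft f x) ^+ 2)%:E <= (2 * pi * nrm f ^+ 2)%:E)%E.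
  rewrite -(cvg_lim _ glim)//; apply: lime_le; first by apply/cvg_ex; eexists; exact: glim.
  exact: nearW.
have I0 : (0 <= \int[mu]_x (normc (ft f x) ^+ 2)%:E)%E.
  by apply: integral_ge0 => x _; rewrite lee_fin sqr_ge0.
have fin : sqi (ft f).
  apply/integrableP; split; first exact: measurable_normc2.
  under eq_integral do rewrite abse_EFin ger0_norm ?sqr_ge0//.
  by apply: le_lt_trans le2 _; rewrite ltry.
split; first by apply/L2P.
by rewrite nrm_sqr -lee_fin /Rintegral fineK// (integrable_fin_num _ fin).
Qed.

Lemma cvg_atan_scale (c : R) : c != 0 ->
  atan (c / eps n) @[n --> \oo] --> Num.sg c * (pi / 2).
Proof.
have H (d : R) : 0 < d -> atan (d / eps n) @[n --> \oo] --> pi / 2.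
  move=> d0; have dy : d / eps n @[n --> \oo] --> +oo.
    apply/cvgryPge => A; have [N _ HN] := nbhs_infty_ger (A / d).
    exists N => // n /HN An; rewrite /eps invrK mulrC -ler_pdivrMr//.
    by rewrite (le_trans An)// ler_nat.
  exact: (cvg_comp _ _ dy (@cvgy_atan R)).
move=> c0; have [cp|cn|c00] := ltrgtP c 0.
- rewrite ltr0_sg// mulN1r -[c]opprK; under eq_fun do rewrite mulNr atanN.
  by apply: cvgN; apply: H; rewrite oppr_gt0.
- by rewrite gtr0_sg// mul1r; exact: H.
- by rewrite c00 eqxx in c0.
Qed.

Lemma poisson_conv_ind (e a b x : R) : 0 < e -> a < b ->
  poisson_conv e (ind a b) x = (2 * (atan ((b - x) / e) - atan ((a - x) / e)))%:C%C.
Proof.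
move=> e0 ab; have [_ <-] := integral_poisson_itv e0 x ab.
by rewrite /poisson_conv -cint_ind; apply: complex_eq; rewrite //= /Rintegral integral0.
Qed.

Lemma ind_limit_sg (a b x : R) : a < b -> x != a -> x != b ->
  (2 * (Num.sg (b - x) * (pi / 2) - Num.sg (a - x) * (pi / 2)))%:C%C = (2 * pi)%:C%C * ind a b x.
Proof.
move=> ab xa xb; rewrite indE.
have [ax|ax|] := ltrgtP x a; last by move=> xa'; rewrite xa' eqxx in xa.
  rewrite /= mulr0 !gtr0_sg ?subr_gt0//; last exact: lt_trans ab.
  by rewrite subrr mulr0.
rewrite (@ltr0_sg _ (a - x)) ?subr_lt0//.
have [bx|bx|] := ltrgtP x b; last by move=> xb'; rewrite xb' eqxx in xb.
  by rewrite /= mulr1 gtr0_sg ?subr_gt0//; congr (_%:C%C); field.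
by rewrite /= mulr0 ltr0_sg ?subr_lt0// subrr mulr0.
Qed.

(** The Poisson kernel as an approximate identity. On an indicator the convolution is a difference
    of arctangents, bounded by 2 pi and convergent except at the two endpoints, so dominated
    convergence applies to any integrable [h]. *)
Lemma cvg_poisson_conv_ind a b h : a < b -> L1 h ->
  normc (cint (fun x => h x * poisson_conv (eps n) (ind a b) x) -
         (2 * pi)%:C%C * cint (fun x => ind a b x * h x)) @[n --> \oo] --> 0.
Proof.
move=> ab h1; have hi := L1_indM a b h1.
rewrite -cintZ//.
have [|||||_ cv] := @dominated_cint R
  (fun n x => h x * poisson_conv (eps n) (ind a b) x)
  (fun x => (2 * pi)%:C%C * (ind a b x * h x)) (fun x => 2 * pi * normc (h x)); last exact: cv.
- by move=> n; have [/L1_cmeas] := cint_poisson_conv (eps_gt0 n) (L1_ind a b) h1.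
- by apply: cmeasM; [exact: cmeas_cst|exact: L1_cmeas].
- have aeab : {ae mu, forall x, x != a /\ x != b}.
    exists [set a; b]; split => //.
    + by apply: measurableU; exact: measurable_set1.
    + by apply: countable_lebesgue_measure0; exact: finite_set_countable.
    + move=> x /= H; apply: contrapT => H2; apply: H.
      by split; apply/eqP => xe; apply: H2; rewrite xe; [left|right].
  apply: (ae_imp aeab) => x [xa xb].
  have E n : normc (h x * poisson_conv (eps n) (ind a b) x - (2 * pi)%:C%C * (ind a b x * h x)) =
    normc (h x) * `|2 * (atan ((b - x) / eps n) - atan ((a - x) / eps n)) -
      2 * (Num.sg (b - x) * (pi / 2) - Num.sg (a - x) * (pi / 2))|.
    rewrite poisson_conv_ind// mulrA -(ind_limit_sg ab xa xb) [_ * h x]mulrC -mulrBr normcM.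
    by rewrite -rmorphB normc_real.
  rewrite (funext E).
  rewrite -[X in _ --> X](mulr0 (normc (h x))); apply: cvgM; first exact: cvg_cst.
  apply: cvg_dist0; apply: cvgM; first exact: cvg_cst.
  by apply: cvgB; apply: cvg_atan_scale; rewrite subr_eq0 eq_sym.
- exact: (integrableZl _ (2 * pi) h1.2).
- move=> n x; rewrite normcM mulrC ler_wpM2r// poisson_conv_ind// normc_real.
  rewrite normrM ger0_norm// ler_pM2l//.
  have := atan_gtNpi2 ((b - x) / eps n); have := atan_ltpi2 ((b - x) / eps n).
  have := atan_gtNpi2 ((a - x) / eps n); have := atan_ltpi2 ((a - x) / eps n).
  by rewrite ler_norml => *; apply/andP; split; lra.
Qed.

Lemma cvg_normc_unique (u : nat -> R[i]) (l k : R[i]) :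
  normc (u n - l) @[n --> \oo] --> 0 -> normc (u n - k) @[n --> \oo] --> 0 -> l = k.
Proof.
move=> ul uk; apply/eqP; rewrite -subr_eq0; apply/eqP/normc_eq0.
have cv : normc (u n - l) + normc (u n - k) @[n --> \oo] --> 0.
  by rewrite -[X in _ --> X](addr0 0); exact: cvgD.
have c0 : normc (l - k) @[n --> \oo] --> (0 : R).
  apply: (squeeze_cvgr _ (cvg_cst 0) cv); apply: nearW => n; rewrite normc_ge0/=.
  have -> : l - k = (u n - k) - (u n - l) by ring.
  by rewrite (le_trans (normcD _ _))// normcN addrC.
by apply: (cvg_unique _ (cvg_cst _) c0).
Qed.

(** A vanishing transform makes every pairing of [h] with a smoothed indicator vanish; in the limit
    the integrals of [h] over intervals vanish. *)
Lemma ft_inj h : L1 h -> (forall x, ft h x = 0) -> {ae mu, forall x, h x = 0}.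
Proof.
move=> h1 h0; apply: ae0_ind; first by move=> a b; exact: L1_indM.
move=> a b ab; have cv := cvg_poisson_conv_ind ab h1.
have /cvg_normc_unique/(_ cv) : normc (cint (fun x => h x * poisson_conv (eps n) (ind a b) x) - 0)
   @[n --> \oo] --> 0.
  rewrite (_ : (fun n => _) = fun=> 0); first exact: cvg_cst.
  apply/funext => n; have [_ ->] := cint_poisson_conv (eps_gt0 n) (L1_ind a b) h1.
  rewrite (@eq_cint _ _ (fun=> 0%:C%C)); last by move=> x; rewrite h0 mulr0.
  by rewrite cint_real /Rintegral integral0 subr0 Normc.normc0.
move/esym/eqP; rewrite mulf_eq0 => /orP[|/eqP //].
by rewrite eq_complex /= eqxx andbT mulf_eq0 pnatr_eq0/= gt_eqF ?pi_gt0.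
Qed.

(** The same sequence is given two limits: as a pairing with smoothed indicators, and as a damped
    integral on the Fourier side, where the product of two L^2 transforms is the integrable
    majorant. *)
Lemma ft_isometry_ind a b h : a < b -> L1 h -> L2 h ->
  cint (fun x => ft (ind a b) x * ft h (- x)) = (2 * pi)%:C%C * cint (fun x => ind a b x * h x).
Proof.
move=> ab h1 h2; apply: cvg_normc_unique (cvg_poisson_conv_ind ab h1).
have [F2 _] := ft_L2 (L1_ind a b) (L2_ind a b); have [H2 _] := ft_L2 h1 h2.
have FH := L2_mulL1 F2 (L2_reflect H2).
have [|||||_ cv] := @dominated_cint R
  (fun n x => (expk (eps n) x)%:C%C * ft (ind a b) x * ft h (- x))
  (fun x => ft (ind a b) x * ft h (- x)) (fun x => normc (ft (ind a b) x * ft h (- x))).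
- move=> n; under eq_fun do rewrite -mulrA.
  apply: cmeasM; last exact: L1_cmeas.
  by apply: cmeas_real; apply: continuous_measurable_fun; exact: continuous_expk.
- exact: L1_cmeas.
- apply: aeW => x.
  have E n : normc ((expk (eps n) x)%:C%C * ft (ind a b) x * ft h (- x) - ft (ind a b) x * ft h (- x))
     = normc (ft (ind a b) x * ft h (- x)) * `|expk (eps n) x - 1|.
    rewrite mulrC -(normc_real (expk _ _ - 1)) -normcM rmorphB/=.
    by congr normc; ring.
  rewrite (funext E).
  rewrite -[X in _ --> X](mulr0 (normc (ft (ind a b) x * ft h (- x)))).
  apply: cvgM; first exact: cvg_cst.
  by apply: cvg_dist0; exact: cvg_expk_eps.
- exact: FH.2.
- move=> n x; rewrite -mulrA normcM ler_piMl// normc_real ger0_norm ?expk_le1//.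
  by rewrite ltW// expk_gt0.
apply: cvg_trans cv; apply: near_eq_cvg; apply: nearW => n.
by have [_ ->] := cint_poisson_conv (eps_gt0 n) (L1_ind a b) h1.
Qed.

End ft_L2.

(** * The unitary Fourier transform and its rules of calculus *)

Section fourier_operator.
Context {R : realType}.
Local Notation mu := (@lebesgue_measure R).
Local Notation mR := (measurableTypeR R).
Implicit Types f g h : R -> R[i].

Lemma aeeq_refl f : aeeq f f. Proof. exact: aeW. Qed.
Lemma aeeq_sym f g : aeeq f g -> aeeq g f.
Proof. by move=> fg; apply: (ae_imp fg) => x. Qed.
Lemma aeeq_trans f g h : aeeq f g -> aeeq g h -> aeeq f h.
Proof. by move=> fg gh; apply: (ae_imp2 fg gh) => x -> ->. Qed.
Lemma aeeq_conj f g : aeeq f g -> aeeq (fun x => conjc (f x)) (fun x => conjc (g x)).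
Proof. by move=> fg; apply: (ae_imp fg) => x ->. Qed.
Lemma aeeq_mul f g h k : aeeq f g -> aeeq h k -> aeeq (fun x => f x * h x) (fun x => g x * k x).
Proof. by move=> fg hk; apply: (ae_imp2 fg hk) => x -> ->. Qed.

Definition ftu f : R -> R[i] := fun x => ((Num.sqrt (2 * pi))^-1)%:C%C * ft f x.

Definition trunc (n : nat) f : R -> R[i] := fun x => ind (- n%:R) n%:R x * f x.

Lemma fourier_truncE n f : fourier_trunc n f = ftu (trunc n f).
Proof.
apply/funext => x; rewrite /fourier_trunc /ftu; congr (_ * _).
by rewrite cint_ind /ft; apply: eq_cint => y; rewrite mulrA.
Qed.

Lemma L2_trunc n f : L2 f -> L2 (trunc n f). Proof. exact: L2_indM. Qed.
Lemma L1_trunc n f : L2 f -> L1 (trunc n f). Proof. exact: L2_indL1. Qed.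

Lemma twopi_gt0 : 0 < 2 * pi :> R. Proof. by rewrite mulr_gt0 ?pi_gt0. Qed.

Lemma ftu_sqr : ((Num.sqrt (2 * pi))^-1 ^+ 2 : R) * (2 * pi) = 1.
Proof. by rewrite exprVn sqr_sqrtr ?mulVf ?ltW ?lt0r_neq0 ?twopi_gt0. Qed.

Lemma L2_ftu f : L1 f -> L2 f -> L2 (ftu f).
Proof. by move=> f1 f2; apply: L2Z; have [] := ft_L2 f1 f2. Qed.

Lemma nrm_ftu f : L1 f -> L2 f -> nrm (ftu f) <= nrm f.
Proof.
move=> f1 f2; have [F2 Fle] := ft_L2 f1 f2.
rewrite nrmZ// normc_real -(ler_pXn2r (n:=2))// ?nnegrE ?mulr_ge0 ?nrm_ge0//.
rewrite exprMn real_normK ?num_real//.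
by apply: (le_trans (ler_wpM2l (sqr_ge0 _) Fle)); rewrite mulrA ftu_sqr mul1r.
Qed.

Lemma ftB f g x : L1 f -> L1 g -> ft (fun y => f y - g y) x = ft f x - ft g x.
Proof.
move=> f1 g1; rewrite /ft -cintB; [|exact: L1_expiN..].
by apply: eq_cint => y; rewrite mulrBl.
Qed.

Lemma nrm_ftuB f g : L1 f -> L2 f -> L1 g -> L2 g ->
  nrm (fun x => ftu f x - ftu g x) <= nrm (fun x => f x - g x).
Proof.
move=> f1 f2 g1 g2; rewrite (_ : (fun x => ftu f x - ftu g x) = ftu (fun x => f x - g x)).
  by apply: nrm_ftu; [exact: L1B|exact: L2B].
by apply/funext => x; rewrite /ftu ftB// mulrBr.
Qed.

Lemma nrm_trunc_cvg f : L2 f -> nrm (fun x => trunc n f x - f x) @[n --> \oo] --> 0.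
Proof.
move=> f2; have [mf if2] := (L2P _).1 f2.
have tB n x : normc (trunc n f x - f x) <= normc (f x).
  by rewrite /trunc indE; case: ifP => _; rewrite ?mul1r ?subrr ?Normc.normc0// mul0r sub0r normcN.
have [] := @dominated_convergence _ _ _ mu setT measurableT
  (fun n x => (normc (trunc n f x - f x) ^+ 2)%:E) (fun x => 0%E) (fun x => (normc (f x) ^+ 2)%:E).
- by move=> n; apply: measurable_normc2; apply: cmeasB => //; apply: cmeasM => //; exact: cmeas_ind.
- exact: measurable_cst.
- apply: aeW => x _; apply: cvg_near_cst.
  have [N _ HN] := nbhs_infty_ger `|x|; exists N => // n /HN.
  by rewrite ler_norml /trunc indE => ->; rewrite mul1r subrr Normc.normc0 expr0n.
- exact: if2.
- by apply: aeW => x n _; rewrite abse_EFin lee_fin ger0_norm ?sqr_ge0// ler_sqr ?nnegrE.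
move=> _ _; rewrite integral0 => /fine_cvgP[_ cv].
by have := cvg_comp _ _ cv (@sqrt_continuous R 0); rewrite sqrtr0.
Qed.

(** The truncations converge to [f] and [ftu] is a contraction, so their transforms are Cauchy.
    Completeness then shows that the choice made in [fourier] does not fall back on its default
    value. *)
Lemma fourierP f : L2 f ->
  L2 (fourier f) /\ nrm (fun x => ftu (trunc n f) x - fourier f x) @[n --> \oo] --> 0.
Proof.
move=> f2.
have u2 n : L2 (ftu (trunc n f)) by apply: L2_ftu; [exact: L1_trunc|exact: L2_trunc].
have [|g g2 gcv] := L2_complete u2.
  move=> e e0; have e20 : 0 < e / 2 by rewrite divr_gt0.
  have /cvgrPdist_le/(_ _ e20)[N _ HN] := nrm_trunc_cvg f2.
  exists N => m n Nm Nn.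
  have tn k : L2 (trunc k f) by exact: L2_trunc.
  apply: (le_trans (nrm_ftuB _ _ _ _)) => //; try exact: L1_trunc.
  apply: (le_trans (nrmB_le (tn m) f2 (tn n))); rewrite [e]splitr lerD//.
    by have := HN _ Nm; rewrite sub0r normrN ger0_norm ?nrm_ge0.
  by rewrite nrmB; have := HN _ Nn; rewrite sub0r normrN ger0_norm ?nrm_ge0.
have normE (k : R -> R[i]) : L2 k ->
   (fun n => normL2 (fun xi => fourier_trunc n f xi - k xi)) =
   (fun n => (nrm (fun x => ftu (trunc n f) x - k x))%:E).
  move=> k2; apply/funext => n; rewrite fourier_truncE normL2_nrm//.
  exact: L2B.
pose S := [set g | L2 g /\
    normL2 (fun xi => fourier_trunc n f xi - g xi) @[n --> \oo] --> 0%E].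
have Sg : S g by split => //; rewrite normE//; apply: cvg_EFin => //; exact: nearW.
have [F2 Fcv] : S (fourier f) by exact: (xgetPex 0 (ex_intro _ g Sg)).
by split => //; move: Fcv; rewrite normE// => /fine_cvgP[].
Qed.

(** A true equality of functions: the choice in [fourier] depends on [f] only through the integrals
    [fourier_trunc]. *)
Lemma fourier_ae f g : L2 f -> L2 g -> aeeq f g -> fourier f = fourier g.
Proof.
move=> f2 g2 fg; rewrite /fourier.
suff E n : fourier_trunc n f = fourier_trunc n g by under eq_fun do under eq_fun do rewrite E.
rewrite !fourier_truncE; apply/funext => x; congr (_ * _); apply: cint_ae.
- by apply: L1_cmeas; apply: L1_expiN; exact: L1_trunc.
- by apply: L1_cmeas; apply: L1_expiN; exact: L1_trunc.
- by apply: (ae_imp fg) => y; rewrite /trunc => ->.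
Qed.

Opaque fourier.

Lemma L2_fourier f : L2 f -> L2 (fourier f). Proof. by move=> /fourierP[]. Qed.

Lemma nrm_cvg_ae (u : nat -> R -> R[i]) g h : (forall n, L2 (u n)) -> L2 g -> L2 h ->
  nrm (fun x => u n x - g x) @[n --> \oo] --> 0 ->
  nrm (fun x => u n x - h x) @[n --> \oo] --> 0 -> aeeq g h.
Proof.
move=> u2 g2 h2 ug uh; apply: nrm_B0_ae => //.
have cv : nrm (fun x => u n x - g x) + nrm (fun x => u n x - h x) @[n --> \oo] --> 0.
  by rewrite -[X in _ --> X](addr0 0); exact: cvgD.
have c0 : (fun n : nat => nrm (fun x => g x - h x)) @ \oo --> (0 : R).
  apply: (squeeze_cvgr _ (cvg_cst 0) cv); apply: nearW => n; rewrite nrm_ge0/=.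
  by rewrite (le_trans (nrmB_le g2 (u2 n) h2))// [X in X + _ <= _]nrmB.
exact: (cvg_unique _ (cvg_cst _) c0).
Qed.

Lemma fourier_ftu f : L1 f -> L2 f -> aeeq (fourier f) (ftu f).
Proof.
move=> f1 f2; have [F2 Fcv] := fourierP f2.
have t2 n := L2_trunc n f2; have t1 n := L1_trunc n f2.
apply: (nrm_cvg_ae _ F2 (L2_ftu f1 f2) Fcv); first by move=> n; exact: L2_ftu.
apply: (squeeze_cvgr _ (cvg_cst 0) (nrm_trunc_cvg f2)); apply: nearW => n.
by rewrite nrm_ge0/= nrm_ftuB.
Qed.

Lemma cint_aeM f g h k : L2 f -> L2 g -> L2 h -> L2 k -> aeeq f g -> aeeq h k ->
  cint (fun x => f x * h x) = cint (fun x => g x * k x).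
Proof.
move=> f2 g2 h2 k2 fg hk; apply: cint_ae; last exact: aeeq_mul.
- exact: L1_cmeas (L2_mulL1 f2 h2).
- exact: L1_cmeas (L2_mulL1 g2 k2).
Qed.

Lemma cvg_cintM (u v : nat -> R -> R[i]) f g : (forall n, L2 (u n)) -> (forall n, L2 (v n)) ->
  L2 f -> L2 g ->
  nrm (fun x => u n x - f x) @[n --> \oo] --> 0 ->
  nrm (fun x => v n x - g x) @[n --> \oo] --> 0 ->
  normc (cint (fun x => u n x * v n x) - cint (fun x => f x * g x)) @[n --> \oo] --> 0.
Proof.
move=> u2 v2 f2 g2 uf vg.
have cv : nrm (fun x => u n x - f x) * (nrm (fun x => v n x - g x) + nrm g) +
    nrm f * nrm (fun x => v n x - g x) @[n --> \oo] --> 0.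
  rewrite -[X in _ --> X]addr0 -[X in _ --> X + _](mul0r (0 + nrm g)).
  rewrite -[X in _ --> _ + X](mulr0 (nrm f)).
  apply: cvgD; first by apply: cvgM => //; apply: cvgD => //; exact: cvg_cst.
  by apply: cvgM => //; exact: cvg_cst.
apply: (squeeze_cvgr _ (cvg_cst 0) cv); apply: nearW => n; rewrite normc_ge0/=.
have uf2 := L2B (u2 n) f2; have vg2 := L2B (v2 n) g2.
have E : cint (fun x => u n x * v n x) - cint (fun x => f x * g x) =
  cint (fun x => (u n x - f x) * v n x) + cint (fun x => f x * (v n x - g x)).
  rewrite -(cintB (L2_mulL1 (u2 n) (v2 n)) (L2_mulL1 f2 g2)).
  rewrite -(cintD (L2_mulL1 uf2 (v2 n)) (L2_mulL1 f2 vg2)).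
  by apply: eq_cint => x; ring.
rewrite E (le_trans (normcD _ _))// lerD//; last exact: normc_cintM.
apply: (le_trans (normc_cintM uf2 (v2 n))); rewrite ler_wpM2l ?nrm_ge0//.
rewrite [leLHS](_ : _ = nrm (fun x => (v n x - g x) + g x)); last first.
  by congr nrm; apply/funext => x; rewrite subrK.
exact: nrmD.
Qed.

(** [ft_swap] for the truncations, passed to the limit by continuity of the pairing on L^2. *)
Lemma fourier_swap f g : L2 f -> L2 g ->
  cint (fun x => fourier f x * g x) = cint (fun x => f x * fourier g x).
Proof.
move=> f2 g2; have [F2 Fcv] := fourierP f2; have [G2 Gcv] := fourierP g2.
have tf2 n := L2_trunc n f2; have tf1 n := L1_trunc n f2.
have tg2 n := L2_trunc n g2; have tg1 n := L1_trunc n g2.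
have H1 := cvg_cintM (fun n => L2_ftu (tf1 n) (tf2 n)) tg2 F2 g2 Fcv (nrm_trunc_cvg g2).
have H2 := cvg_cintM tf2 (fun n => L2_ftu (tg1 n) (tg2 n)) f2 G2 (nrm_trunc_cvg f2) Gcv.
apply: (cvg_normc_unique H1); apply: cvg_trans H2; apply: near_eq_cvg; apply: nearW => n.
congr (normc (_ - _)); rewrite /ftu.
have ftM h k : L1 h -> L1 k -> L1 (fun x => k x * ft h x).
  move=> h1 k1; under eq_fun do rewrite mulrC.
  by apply: L1Ml k1 (cmeas_ft (L1_cmeas h1)) (fun x => normc_ft x h1).
transitivity (((Num.sqrt (2 * pi))^-1)%:C%C * cint (fun x => trunc n f x * ft (trunc n g) x)).
  by rewrite -cintZ; [apply: eq_cint => x; ring|exact: ftM].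
rewrite -ft_swap// -cintZ; last exact: ftM.
by apply: eq_cint => x; ring.
Qed.

(** The inverse transform: conjugating before and after replaces e^(-ixy) by e^(ixy). *)
Definition ifourier f : R -> R[i] := fun x => conjc (fourier (fun y => conjc (f y)) x).

Lemma L2_ifourier f : L2 f -> L2 (ifourier f).
Proof. by move=> f2; apply: L2_conj; apply: L2_fourier; exact: L2_conj. Qed.

Lemma L2_ae0_ind f : L2 f -> (forall a b, a < b -> cint (fun y => ind a b y * f y) = 0) ->
  {ae mu, forall x, f x = 0}.
Proof. by move=> f2; apply: ae0_ind => a b; exact: L2_indL1. Qed.

Lemma L2_aeeq_ind f g : L2 f -> L2 g ->
  (forall a b, a < b -> cint (fun y => ind a b y * f y) = cint (fun y => ind a b y * g y)) ->
  aeeq f g.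
Proof.
move=> f2 g2 fg; have H : {ae mu, forall x, f x - g x = 0}.
  apply: L2_ae0_ind; first exact: L2B.
  move=> a b ab; rewrite -[RHS](subrr (cint (fun y => ind a b y * g y))) -{1}fg//.
  by rewrite -cintB; [apply: eq_cint => x; rewrite mulrBr|exact: L2_indL1..].
by apply: (ae_imp H) => x /eqP; rewrite subr_eq0 => /eqP.
Qed.

Lemma cint_ifourier f g : L2 f -> L2 g ->
  cint (fun x => f x * ifourier g x) = cint (fun x => conjc (fourier (fun y => conjc (f y)) x) * g x).
Proof.
move=> f2 g2; have cf2 := L2_conj f2; have cg2 := L2_conj g2.
rewrite -[RHS]conjcK -cint_conj; last by apply: L2_mulL1 => //; exact: L2_ifourier.
under [in RHS]eq_cint do rewrite conjM conjcK.
rewrite fourier_swap// -cint_conj; last by apply: L2_mulL1 => //; exact: L2_fourier.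
by apply: eq_cint => x; rewrite conjM conjcK.
Qed.

(** Tested against a second indicator, the claim is [ft_isometry_ind], since the transform of an
    indicator at the opposite point is the conjugate. *)
Lemma ifourier_fourier_ind a b : a < b -> aeeq (ifourier (fourier (ind a b))) (ind a b).
Proof.
move=> ab; have i2 := L2_ind a b; have i1 := L1_ind a b.
apply: L2_aeeq_ind => //; first by apply: L2_ifourier; exact: L2_fourier.
move=> c d cd; have j2 := L2_ind c d; have j1 := L1_ind c d.
rewrite cint_ifourier//; last exact: L2_fourier.
have -> : (fun y => conjc (ind c d y)) = ind c d by apply/funext => y; rewrite conj_ind.
transitivity (cint (fun x => conjc (ftu (ind c d) x) * ftu (ind a b) x)).
  by apply: cint_aeM (L2_conj (L2_fourier j2)) (L2_conj (L2_ftu j1 j2)) (L2_fourier i2)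
    (L2_ftu i1 i2) (aeeq_conj (fourier_ftu j1 j2)) (fourier_ftu i1 i2).
have := ft_isometry_ind ab j1 j2.
have [F2 _] := ft_L2 i1 i2; have [H2 _] := ft_L2 j1 j2.
move=> H; transitivity ((((Num.sqrt (2 * pi))^-1) ^+ 2)%:C%C *
   cint (fun x => ft (ind a b) x * ft (ind c d) (- x))).
  have ftN x : ft (ind c d) (- x) = conjc (ft (ind c d) x).
    have E : (fun y => conjc (ind c d y)) = ind c d by apply/funext => y; rewrite conj_ind.
    by have := ft_conj (- x) j1; rewrite E opprK.
  rewrite -(cintZ _ (L2_mulL1 F2 (L2_reflect H2))).
  by apply: eq_cint => x; rewrite /ftu conjM conj_RC ftN expr2 RC_M; ring.
rewrite H mulrA -RC_M ftu_sqr mul1r; apply: eq_cint => x; exact: mulrC.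
Qed.

(** By duality: tested against an indicator, both transforms are moved from [f] onto the indicator,
    where inversion is known. *)
Lemma ifourier_fourier f : L2 f -> aeeq (ifourier (fourier f)) f.
Proof.
move=> f2; have F2 := L2_fourier f2; apply: L2_aeeq_ind => //; first exact: L2_ifourier.
move=> a b ab; have i2 := L2_ind a b.
rewrite cint_ifourier//.
have -> : (fun y => conjc (ind a b y)) = ind a b by apply/funext => y; rewrite conj_ind.
have cF2 : L2 (fun x => conjc (fourier (ind a b) x)) by apply: L2_conj; exact: L2_fourier.
transitivity (cint (fun x => fourier f x * conjc (fourier (ind a b) x))).
  by apply: eq_cint => x; rewrite mulrC.
rewrite fourier_swap//; transitivity (cint (fun x => f x * ind a b x)).
  apply: (cint_aeM f2 f2 (L2_fourier cF2) i2 (aeeq_refl f)).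
  have H := aeeq_conj (ifourier_fourier_ind ab).
  by apply: (ae_imp H) => x; rewrite /ifourier conjcK conj_ind.
by apply: eq_cint => x; rewrite mulrC.
Qed.

Lemma fourier_ifourier f : L2 f -> aeeq (fourier (ifourier f)) f.
Proof.
move=> f2; have cf2 := L2_conj f2.
have E : fourier (ifourier f) = fun x => conjc (ifourier (fourier (fun y => conjc (f y))) x).
  apply/funext => x; rewrite /ifourier conjcK; congr (fourier _ x).
rewrite E; apply: (aeeq_trans (aeeq_conj (ifourier_fourier cf2))).
by apply: aeW => x; rewrite conjcK.
Qed.

Lemma fourier_inner f g : L2 f -> L2 g -> inner (fourier f) (fourier g) = inner f g.
Proof.
move=> f2 g2; have cG2 := L2_conj (L2_fourier g2).
rewrite /inner -/(cint _) -/(cint _) fourier_swap//.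
apply: (cint_aeM f2 f2 (L2_fourier cG2) (L2_conj g2) (aeeq_refl f)).
have H := aeeq_conj (ifourier_fourier g2).
by apply: (ae_imp H) => x; rewrite /ifourier conjcK.
Qed.

Lemma inner_self f : inner f f = (nrm f ^+ 2)%:C%C.
Proof.
rewrite /inner -/(cint _) nrm_sqr -cint_real.
by apply: eq_cint => x; rewrite mulcJ.
Qed.

Lemma fourier_nrm f : L2 f -> nrm (fourier f) = nrm f.
Proof.
move=> f2; have := fourier_inner f2 f2; rewrite !inner_self => -[] /eqP.
by rewrite eqrXn2 ?nrm_ge0// => /eqP.
Qed.

Lemma fourier_surj g : L2 g -> exists2 f, L2 f & aeeq (fourier f) g.
Proof.
by move=> g2; exists (ifourier g); [exact: L2_ifourier|exact: fourier_ifourier].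
Qed.

(** A candidate for the transform is recognised by testing on indicators only, whose transforms are
    explicit integrals. The rules for linear combinations, translations and dilations all follow
    this way. *)
Lemma fourier_char f h : L2 f -> L2 h ->
  (forall a b, a < b -> cint (fun x => ind a b x * h x) = cint (fun x => ftu (ind a b) x * f x)) ->
  aeeq (fourier f) h.
Proof.
move=> f2 h2 H; apply: L2_aeeq_ind => //; first exact: L2_fourier.
move=> a b ab; rewrite H// -fourier_swap//; last exact: L2_ind.
have i2 := L2_ind a b; have i1 := L1_ind a b.
exact: cint_aeM (L2_fourier i2) (L2_ftu i1 i2) _ _ (fourier_ftu i1 i2) (aeeq_refl _).
Qed.

Lemma cint_ind_fourier f a b : L2 f ->
  cint (fun x => ind a b x * fourier f x) = cint (fun x => ftu (ind a b) x * f x).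
Proof.
move=> f2; have i2 := L2_ind a b; have i1 := L1_ind a b.
rewrite -fourier_swap//.
exact: cint_aeM (L2_fourier i2) (L2_ftu i1 i2) _ _ (fourier_ftu i1 i2) (aeeq_refl _).
Qed.

Lemma fourier_linear (c : R[i]) f g : L2 f -> L2 g ->
  aeeq (fourier (fun x => c * f x + g x)) (fun x => c * fourier f x + fourier g x).
Proof.
move=> f2 g2; have cf2 := L2Z c f2; have F2 := L2_fourier f2; have G2 := L2_fourier g2.
apply: fourier_char; [exact: L2D|by apply: L2D => //; exact: L2Z|].
move=> a b ab; have i2 := L2_ind a b; have u2 := L2_ftu (L1_ind a b) i2.
have Ef := cint_ind_fourier a b f2; have Eg := cint_ind_fourier a b g2.
move: F2 G2 Ef Eg; move: (fourier f) (fourier g) => Ff Fg F2 G2 Ef Eg.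
transitivity (c * cint (fun x => ind a b x * Ff x) + cint (fun x => ind a b x * Fg x)).
  rewrite -(cintZ c (L2_mulL1 i2 F2)) -(cintD (L1Z c (L2_mulL1 i2 F2)) (L2_mulL1 i2 G2)).
  by apply: eq_cint => x; ring.
rewrite Ef Eg -(cintZ c (L2_mulL1 u2 f2)) -(cintD (L1Z c (L2_mulL1 u2 f2)) (L2_mulL1 u2 g2)).
by apply: eq_cint => x; ring.
Qed.

Lemma fourierB f g : L2 f -> L2 g ->
  aeeq (fourier (fun x => f x - g x)) (fun x => fourier f x - fourier g x).
Proof.
move=> f2 g2; have H := fourier_linear (-1) g2 f2.
rewrite (_ : (fun x => f x - g x) = (fun x => -1 * g x + f x)).
  by apply: (ae_imp H) => x ->; rewrite mulN1r addrC.
by apply/funext => x; rewrite mulN1r addrC.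
Qed.

Lemma fourier_inj f g : L2 f -> L2 g -> aeeq (fourier f) (fourier g) -> aeeq f g.
Proof.
move=> f2 g2 FG; apply: nrm_B0_ae => //.
rewrite -fourier_nrm; last exact: L2B.
have F2 := L2_fourier f2; have G2 := L2_fourier g2.
have -> : nrm (fourier (fun x => f x - g x)) = nrm (fun=> 0 : R[i]).
  apply: nrm_ae; [by apply: L2_cmeas; apply: L2_fourier; exact: L2B|exact: cmeas_cst|].
  by apply: (ae_imp2 (fourierB f2 g2) FG) => x -> ->; rewrite subrr.
by rewrite /nrm; under eq_Rintegral do rewrite Normc.normc0 expr0n;
  rewrite /Rintegral integral0 sqrtr0.
Qed.

Lemma L2_transl a f : L2 f -> L2 (transl a f).
Proof. by move=> /(L2_affine (- a) (oner_neq0 R)); under eq_fun do rewrite mul1r. Qed.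

Lemma L2_expiM (h : R -> R) f : measurable_fun [set: mR] h -> L2 f -> L2 (fun x => expi (h x) * f x).
Proof. by move=> mh f2; apply: L2M f2 (cmeas_expi mh) (fun x => normc_expi_le1 _). Qed.

Lemma fourier_transl a f : L2 f ->
  aeeq (fourier (transl a f)) (fun x => expi (- (a * x)) * fourier f x).
Proof.
move=> f2; have F2 := L2_fourier f2.
have ma : measurable_fun [set: mR] (fun x => - (a * x)).
  by apply: measurableT_comp => //; exact: measurable_funM.
apply: fourier_char; [exact: L2_transl|exact: L2_expiM|].
move=> b c bc; have i2 := L2_ind b c; have i1 := L1_ind b c; have u2 := L2_ftu i1 i2.
(* Modulating the test indicator translates its transform, and the translation is then moved onto
   [f] by a change of variable. *)
pose k := fun x => expi (- (a * x)) * ind b c x.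
have k2 : L2 k by exact: L2_expiM.
have k1 : L1 k by apply: L1Ml i1 (cmeas_expi ma) (fun x => normc_expi_le1 _).
have kE x : ftu k x = ftu (ind b c) (x + a).
  by congr (_ * _); apply: eq_cint => y; rewrite mulrDl opprD expiD /k; ring.
transitivity (cint (fun x => k x * fourier f x)).
  by apply: eq_cint => x; rewrite /k; ring.
rewrite -fourier_swap//.
transitivity (cint (fun x => ftu k x * f x)).
  exact: cint_aeM (L2_fourier k2) (L2_ftu k1 k2) _ _ (fourier_ftu k1 k2) (aeeq_refl _).
have := @cint_affine R 1 a (oner_neq0 R) (fun x => ftu (ind b c) x * transl a f x).
move=> /(_ (L2_mulL1 u2 (L2_transl a f2))).
rewrite normr1 invr1 -[(1%:C)%C]/(1 : R[i]) mul1r => <-.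
by apply: eq_cint => x; rewrite kE /transl mul1r addrK.
Qed.

Lemma L2_dil l f : l != 0 -> L2 f -> L2 (dil l f).
Proof.
move=> l0 f2; apply: L2Z; have l0' : l^-1 != 0 by rewrite invr_eq0.
by move: (L2_affine 0 l0' f2); under eq_fun do rewrite addr0 mulrC.
Qed.

Lemma fourier_dil l f : l != 0 -> L2 f ->
  aeeq (fourier (dil l f)) (fun x => fourier f (l * x)).
Proof.
move=> l0 f2; have F2 := L2_fourier f2.
have l0' : l^-1 != 0 by rewrite invr_eq0.
have Fl2 : L2 (fun x => fourier f (l * x)).
  by move: (L2_affine 0 l0 F2); under eq_fun do rewrite addr0.
apply: fourier_char => //; first exact: L2_dil.
move=> b c bc; have i2 := L2_ind b c; have i1 := L1_ind b c; have u2 := L2_ftu i1 i2.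
(* The dilation is carried by the test indicator through its transform, then handed to [f]; each
   change of variable contributes a factor [|l|] or its inverse. *)
pose k := fun x => ind b c (l^-1 * x).
have k2 : L2 k by move: (L2_affine 0 l0' i2); under eq_fun do rewrite addr0.
have k1 : L1 k by move: (L1_affine 0 l0' i1); under eq_fun do rewrite addr0.
have kE x : ftu k x = `|l|%:C%C * ftu (ind b c) (l * x).
  rewrite /ftu mulrCA; congr (_ * _).
  have := cint_affine 0 l0' (L1_expiN (l * x) i1).
  rewrite normrV ?unitfE// invrK => <-; apply: eq_cint => y.
  by rewrite addr0 /k mulrACA [x * _]mulrC -mulrA mulVKf// mulrC.
transitivity ((`|l|^-1)%:C%C * cint (fun x => k x * fourier f x)).
  rewrite -(@cint_affine R l 0 l0 (fun x => k x * fourier f x) (L2_mulL1 k2 F2)).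
  by apply: eq_cint => x; rewrite addr0 /k mulKf.
rewrite -fourier_swap//.
transitivity ((`|l|^-1)%:C%C * cint (fun x => ftu k x * f x)).
  congr (_ * _).
  exact: cint_aeM (L2_fourier k2) (L2_ftu k1 k2) _ _ (fourier_ftu k1 k2) (aeeq_refl _).
transitivity (cint (fun x => ftu (ind b c) (l * x) * f x)).
  rewrite -cintZ; last by apply: L2_mulL1 => //; exact: L2_ftu.
  apply: eq_cint => x; rewrite kE !mulrA -RC_M mulVf ?normr_eq0// mul1r//.
have d2 : L2 (dil l f) by exact: L2_dil.
have := @cint_affine R l 0 l0 (fun x => ftu (ind b c) x * dil l f x) (L2_mulL1 u2 d2).
have K0 : (`|l|^-1)%:C%C != 0 :> R[i].
  by rewrite eq_complex/= eqxx andbT invr_eq0 normr_eq0.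
move=> E; apply: (mulfI K0); rewrite -E.
have ul2 : L2 (fun x => ftu (ind b c) (l * x)).
  by move: (L2_affine 0 l0 u2); under eq_fun do rewrite addr0.
rewrite -(cintZ _ (L2_mulL1 ul2 f2)); apply: eq_cint => x.
by rewrite addr0 /dil [l * x / l]mulrAC mulfV// mul1r mulrCA.
Qed.

End fourier_operator.

(** * Translation-invariant unitary operators and their symbols *)

Section multiplier.
Context {R : realType}.
Local Notation mu := (@lebesgue_measure R).
Local Notation mR := (measurableTypeR R).
Implicit Types f g h : R -> R[i].

(** A nowhere vanishing element of L^2, by which transforms can be divided to extract a symbol or to
    compare two of them. *)
Lemma L2_expk : L2 (fun x : R => (expk 1 x)%:C%C).
Proof.
apply: (L2_le _ (integrable_expk (ltr01 : 0 < (1 : R)))); first exact: L1_cmeas (L1_expk ltr01).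
move=> x; have e0 : 0 <= expk 1 x :> R by exact/ltW/expk_gt0.
by rewrite normc_real ger0_norm// expr2 ler_piMl// expk_le1.
Qed.

Lemma measurable_eq1 (h : R -> R) : measurable_fun [set: mR] h ->
  measurable_fun [set: mR] (fun x => if h x == 1 then 1 else 0 : R).
Proof.
move=> mh; have mA : measurable ([set x | h x == 1] : set mR).
  have -> : [set x | h x == 1] = setT `&` h @^-1` [set 1].
    by rewrite setTI; apply/seteqP; split => x /=; [move/eqP|move=> ->].
  exact: mh.
have -> : (fun x => if h x == 1 then 1 else 0 : R) = \1_([set x | h x == 1]).
  by apply/funext => x; rewrite indicE; case: ifP => hx;
    [rewrite mem_set|rewrite memNset//= hx].
exact: measurable_indic.
Qed.

Lemma ae_unimodular f : cmR f -> {ae mu, forall x, normc (f x) = 1} ->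
  exists m, [/\ cmR m, forall x, normc (m x) = 1 & aeeq f m].
Proof.
move=> mf f1; pose m x := if normc (f x) == 1 then f x else 1.
exists m; split.
- have mc := measurable_eq1 (@measurable_normc _ _ mR _ mf).
  apply: (eq_cmeas (f := fun x => (if normc (f x) == 1 then 1 else 0)%:C%C * f x +
     (1 - (if normc (f x) == 1 then 1 else 0)%:C%C))).
    by move=> x; rewrite /m; case: ifP => _; rewrite ?mul1r ?mul0r ?subrr ?subr0 ?addr0 ?add0r.
  have mc' := cmeas_real mc.
  by apply: cmeasD; [exact: cmeasM|apply: cmeasB => //; exact: cmeas_cst].
- by move=> x; rewrite /m; case: ifP => [/eqP //|_]; rewrite Normc.normc1.
- by apply: (ae_imp f1) => x fx; rewrite /m fx eqxx.
Qed.

Definition has_symbol (T : (R -> R[i]) -> (R -> R[i])) (m : R -> R[i]) : Prop :=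
  forall f, L2 f -> aeeq (fourier (T f)) (fun x => m x * fourier f x).

Lemma unitary_L2 T f : unitary_operator T -> L2 f -> L2 (T f).
Proof. by case=> -[H _ _ _] _ _; exact: H. Qed.

Lemma transl_commute T a f : unitary_operator T -> translation_invariant T -> L2 f ->
  aeeq (T (transl a f)) (transl a (T f)).
Proof.
move=> uT tT f2; have H := ae_affine (- a) (oner_neq0 R) (tT a f f2).
by apply: (ae_imp H) => x; rewrite /transl/= mul1r opprK addrNK => ->.
Qed.

(** Unitarity preserves the inner product of [f] with every translate of [f0], and [T] commutes with
    translations; on the Fourier side a translation is a character. *)
Lemma fourier_pairing T a f f0 : unitary_operator T -> translation_invariant T ->
  L2 f -> L2 f0 ->
  cint (fun x => fourier (T f) x * conjc (fourier (T f0) x) * expi (a * x)) =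
  cint (fun x => fourier f x * conjc (fourier f0 x) * expi (a * x)).
Proof.
move=> uT tT f2 g2; have t2 := L2_transl a g2.
have Tf2 := unitary_L2 uT f2; have Tg2 := unitary_L2 uT g2.
have Tt2 := unitary_L2 uT t2; have tT2 := L2_transl a Tg2.
have key h k k' : L2 h -> L2 k -> L2 k' -> aeeq k' (transl a k) ->
    inner h k' = cint (fun x => fourier h x * conjc (fourier k x) * expi (a * x)).
  move=> h2 k2 k2' kk'; rewrite -(fourier_inner h2 k2').
  have tk2 := L2_transl a k2.
  rewrite (fourier_ae k2' tk2 kk') /inner -/(cint _).
  have K2 := L2_fourier k2.
  have ma : measurable_fun [set: mR] (fun x : R => - (a * x)).
    by apply: measurableT_comp => //; exact: measurable_funM.
  have eK2 := L2_expiM ma K2.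
  rewrite (cint_aeM (L2_fourier h2) (L2_fourier h2) (L2_conj (L2_fourier tk2)) (L2_conj eK2)
    (aeeq_refl _) (aeeq_conj (fourier_transl a k2))).
  by apply: eq_cint => x; rewrite conjM conj_expi opprK mulrA mulrAC.
have K1 := key _ _ _ Tf2 Tg2 Tt2 (transl_commute a uT tT g2).
have K2 := key _ _ _ f2 g2 t2 (aeeq_refl _).
apply: (etrans (esym K1)); apply: etrans K2.
by case: uT => _ H _; exact: H.
Qed.

Lemma expi_transform_inj (u v : R -> R[i]) : L1 u -> L1 v ->
  (forall a, cint (fun x => u x * expi (a * x)) = cint (fun x => v x * expi (a * x))) ->
  aeeq u v.
Proof.
move=> u1 v1 P; have H : {ae mu, forall x, u x - v x = 0}.
  apply: ft_inj; first exact: L1B.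
  move=> x; have -> : ft (fun y => u y - v y) x = ft u x - ft v x by exact: ftB.
  have E w : ft w x = cint (fun y => w y * expi ((- x) * y)).
    by apply: eq_cint => y; rewrite mulNr.
  by rewrite !E P subrr.
by apply: (ae_imp H) => x /eqP; rewrite subr_eq0 => /eqP.
Qed.

Lemma fourier_mul_conj T f f0 : unitary_operator T -> translation_invariant T ->
  L2 f -> L2 f0 ->
  aeeq (fun x => fourier (T f) x * conjc (fourier (T f0) x))
       (fun x => fourier f x * conjc (fourier f0 x)).
Proof.
move=> uT tT f2 g2; apply: expi_transform_inj.
- exact: L2_mulL1 (L2_fourier (unitary_L2 uT f2)) (L2_conj (L2_fourier (unitary_L2 uT g2))).
- exact: L2_mulL1 (L2_fourier f2) (L2_conj (L2_fourier g2)).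
- by move=> a; exact: (fourier_pairing a uT tT f2 g2).
Qed.

(** Take [f0] with transform [expk 1] and divide the transform of [T f0] by it. In
    [fourier_mul_conj] the choice [f = f0] shows that the quotient is unimodular, and a general [f]
    shows that it acts as the symbol. *)
Lemma unitary_symbol T : unitary_operator T -> translation_invariant T ->
  exists m, [/\ cmR m, forall x, normc (m x) = 1 & has_symbol T m].
Proof.
move=> uT tT; have [f0 f02 F0] := fourier_surj L2_expk.
have Tf0 := L2_fourier (unitary_L2 uT f02).
pose m0 x := ((expk 1 x)^-1)%:C%C * fourier (T f0) x.
have e0 x : expk 1 x != 0 :> R by rewrite gt_eqF// expk_gt0.
have eC x : (expk 1 x)%:C%C != 0 :> R[i].
  by rewrite eq_complex/= eqxx andbT.
have mm0 : cmR m0.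
  apply: cmeasM; last exact: L2_cmeas.
  apply: cmeas_real; apply: continuous_measurable_fun => x.
  by apply: cvgV => //; exact: continuous_expk.
have E0 x : fourier (T f0) x = (expk 1 x)%:C%C * m0 x.
  by rewrite /m0 mulrA -RC_M mulfV// mul1r.
have n1 : {ae mu, forall x, normc (m0 x) = 1}.
  have H := fourier_mul_conj uT tT f02 f02.
  apply: (ae_imp2 H F0) => x; rewrite E0 => + F0x; rewrite F0x.
  rewrite conjM !conj_RC mulrACA -[RHS]mulr1 => /(mulfI (mulf_neq0 (eC x) (eC x))).
  rewrite mulcJ => /(congr1 (@complex.Re R)) /= H2.
  by apply/eqP; rewrite -(@eqrXn2 _ 2)// ?ler01 ?expr1n ?H2.
have [m [mm m1 m0m]] := ae_unimodular mm0 n1.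
exists m; split => // f f2.
have H := fourier_mul_conj uT tT f2 f02.
have H2 : {ae mu, forall x, fourier (T f) x = m0 x * fourier f x}.
  apply: (ae_imp2 (ae_imp2 H F0 (fun x a b => conj a b)) n1) => x [].
  rewrite E0 => + F0x n1x; rewrite F0x conjM !conj_RC [RHS]mulrC mulrCA => /(mulfI (eC x)) <-.
  rewrite mulrCA mulcJ n1x expr1n. 
  by rewrite -[(1%:C)%C]/(1 : R[i]) mulr1.
by apply: (ae_imp2 H2 m0m) => x -> ->.
Qed.

End multiplier.

(** * Properties of the operator read on its symbol *)

Section symbol_calculus.
Context {R : realType}.
Local Notation mu := (@lebesgue_measure R).
Local Notation mR := (measurableTypeR R).
Implicit Types (f g h : R -> R[i]) (m : R -> R[i]).

Lemma ae_dense (P : R -> Prop) (a b : R) : {ae mu, forall x, P x} -> a < b ->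
  exists x, a < x < b /\ P x.
Proof.
move=> [N [mN N0 PN]] ab; apply: contrapT => H.
have sub : `]a, b[%classic `<=` N.
  move=> x; rewrite /= in_itv/= => xab; apply: PN => /= Px; apply: H.
  by exists x.
have : (mu `]a, b[%classic <= mu N)%E by apply: le_measure => //; rewrite inE.
by rewrite N0 /= lebesgue_measure_itv/= lte_fin ab -EFinB lee_fin subr_le0 leNgt ab.
Qed.

Lemma symbol_unique m m' :
  (forall f, L2 f -> aeeq (fun x => m x * fourier f x) (fun x => m' x * fourier f x)) ->
  aeeq m m'.
Proof.
move=> H; have [f0 f02 F0] := fourier_surj (@L2_expk R).
apply: (ae_imp2 (H f0 f02) F0) => x /[swap] ->.
have e0 : (expk 1 x)%:C%C != 0 :> R[i].
  by rewrite eq_complex/= eqxx andbT gt_eqF// expk_gt0.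
exact: mulIf.
Qed.

Lemma opeq_symbol S S' m m' : (forall f, L2 f -> L2 (S f)) -> (forall f, L2 f -> L2 (S' f)) ->
  has_symbol S m -> has_symbol S' m' -> opeq S S' -> aeeq m m'.
Proof.
move=> S2 S'2 Sm S'm SS'; apply: symbol_unique => f f2.
have := Sm f f2; rewrite (fourier_ae (S2 _ f2) (S'2 _ f2) (SS' f f2)) => H.
exact: aeeq_trans (aeeq_sym H) (S'm f f2).
Qed.

Lemma has_symbol_comp S S' m m' : (forall f, L2 f -> L2 (S' f)) ->
  has_symbol S m -> has_symbol S' m' -> has_symbol (S \o S') (fun x => m x * m' x).
Proof.
move=> S'2 Sm S'm f f2.
apply: (ae_imp2 (Sm _ (S'2 f f2)) (S'm f f2)) => x /= -> ->.
by rewrite mulrA.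
Qed.

Lemma L2_opdil l T f : l != 0 -> (forall f, L2 f -> L2 (T f)) -> L2 f -> L2 (opdil l T f).
Proof.
by move=> l0 T2 f2; apply: L2_dil => //; apply: T2; apply: L2_dil => //; rewrite invr_eq0.
Qed.

Lemma has_symbol_opdil l T m : l != 0 -> (forall f, L2 f -> L2 (T f)) -> has_symbol T m ->
  has_symbol (opdil l T) (fun x => m (l * x)).
Proof.
move=> l0 T2 Tm f f2; have l0' : l^-1 != 0 by rewrite invr_eq0.
have d2 := L2_dil l0' f2; have H1 := fourier_dil l0 (T2 _ d2).
have H2 := ae_affine 0 l0 (Tm _ d2).
have H3 := ae_affine 0 l0 (fourier_dil l0' f2).
apply: (ae_imp2 (ae_imp2 H1 H2 (fun x a b => conj a b)) H3) => x [].
by rewrite addr0 => E1 E2 E3; rewrite /opdil/= E1 E2 E3 mulKf.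
Qed.

(** Only [s] is confined to a bounded interval. This form comes directly out of the LUC condition
    and gives the uniform step needed to subdivide an interval in the lifting argument. *)
Definition loc_unif_continuous (w : R -> R[i]) : Prop :=
  forall N e : R, 0 < e -> exists2 eta, 0 < eta & forall s s', `|s| <= N ->
    `|s' - s| < eta -> normc (w s' - w s) <= e.

Lemma normc_quad (e : R) (x x' y y' z : R[i]) :
  normc (x' - x) <= e / 4 -> normc (x' - z) <= e / 4 ->
  normc (y' - z) <= e / 4 -> normc (y' - y) <= e / 4 -> normc (x - y) <= e.
Proof.
have -> : x - y = - (x' - x) + (x' - z) - (y' - z) + (y' - y) by ring.
have := normcD (- (x' - x) + (x' - z) - (y' - z)) (y' - y).
have := normcD (- (x' - x) + (x' - z)) (- (y' - z)).
have := normcD (- (x' - x)) (x' - z).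
rewrite !normcN; lra.
Qed.

Lemma normc_triple (e d : R) (x y z z' : R[i]) : normc (z - z') <= e ->
  normc (z - x) <= d / 2 -> normc (z' - y) <= d / 2 -> normc (x - y) <= e + d.
Proof.
have -> : x - y = (z - z') - (z - x) + (z' - y) by ring.
have := normcD ((z - z') - (z - x)) (z' - y).
have := normcD (z - z') (- (z - x)).
rewrite !normcN; lra.
Qed.

Lemma unimodular_close (e : R) (z z' : R[i]) : normc z' = 1 -> normc (z' - z) <= e ->
  `|normc z - 1| <= e.
Proof.
move=> <- H; have := normcD (z' - z) z; rewrite subrK => h1.
have := normcD (z - z') z'; rewrite subrK normcB => h2.
by rewrite ler_norml; apply/andP; split; lra.
Qed.

Section one_operator.
Variables (T : (R -> R[i]) -> (R -> R[i])) (m : R -> R[i]).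
Hypotheses (T2 : forall f, L2 f -> L2 (T f)) (mm : cmR m)
  (m1 : forall x, normc (m x) = 1) (Tm : has_symbol T m).

Lemma semistable_symbol : semistable T -> exists a b : R, [/\ 0 < a, 0 < b,
  aeeq (fun x => m x ^+ 2) (fun x => m (a * x)) &
  aeeq (fun x => m x ^+ 3) (fun x => m (b * x))].
Proof.
move=> [a [b [a0 b0 Ha Hb]]]; exists a, b; split => //.
  have := @opeq_symbol (T \o T) (opdil a T) (fun x => m x * m x) (fun x => m (a * x)).
  apply => //.
  - by move=> f f2; apply: T2; exact: T2.
  - by move=> f f2; apply: L2_opdil => //; rewrite gt_eqF.
  - exact: has_symbol_comp.
  - by apply: has_symbol_opdil => //; rewrite gt_eqF.
have := @opeq_symbol (T \o T \o T) (opdil b T) (fun x => m x * m x * m x) (fun x => m (b * x)).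
move=> H; have {}H : aeeq (fun x => m x * m x * m x) (fun x => m (b * x)).
  apply: H => //.
  - by move=> f f2; apply: T2; apply: T2; exact: T2.
  - by move=> f f2; apply: L2_opdil => //; rewrite gt_eqF.
  - by apply: has_symbol_comp => //; exact: has_symbol_comp.
  - by apply: has_symbol_opdil => //; rewrite gt_eqF.
by apply: (ae_imp H) => x <-; rewrite 2!exprSr expr1.
Qed.

Lemma symmetric_symbol : symmetric_operator T -> aeeq (fun x => m (- x)) m.
Proof.
move=> H; have n0 : (-1 : R) != 0 by rewrite oppr_eq0 oner_eq0.
have {}H : aeeq (fun x => m (-1 * x)) m.
  apply: opeq_symbol H => //; last exact: has_symbol_opdil.
  by move=> f f2; exact: L2_opdil.
by apply: (ae_imp H) => x; rewrite mulN1r.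
Qed.

Lemma loc_L1_symbol : loc_L1 m.
Proof. by apply: (loc_L1_bounded (k := 1)) => // x; rewrite m1. Qed.

(** LUC at dilation 1, transported by Plancherel: the difference of the dilated operators acts as
    multiplication by [m (l * x) - m x], and the band restricts the support of [g]. Other dilations
    are reached later by scaling the test function. *)
Lemma LUC_symbol_norm (r e : R) : LUC T -> 1 < r -> 0 < e ->
  exists2 eta, 0 < eta & forall l, `|l - 1| < eta -> 0 < l ->
  forall g, L2 g -> (forall x, `|x| < r^-1 \/ r < `|x| -> g x = 0) ->
  nrm (fun x => (m (l * x) - m x) * g x) <= e * nrm g.
Proof.
move=> lucT r1 e0; have /fine_cvgP[Hfin Hcv] := lucT r r1 1 ltr01.
have Hlt := cvgr_lt _ Hcv _ e0.
have [eta eta0 Heta] : \forall l \near (1 : R), opnorm_on (L2band r)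
    (fun f x => opdil l T f x - opdil 1 T f x) \is a fin_num /\
    fine (opnorm_on (L2band r) (fun f x => opdil l T f x - opdil 1 T f x)) < e.
  by apply: filterI; [exact: Hfin|exact: Hlt].
exists eta => // l l1 l0 g g2 gband.
have := Heta l; rewrite /ball_/= distrC => /(_ l1) [fin lt].
have lN0 : l != 0 by rewrite gt_eqF.
(* The operator norm is a supremum over the unit ball, so [g] is normalised; a null [g] is set
   apart. *)
have [gz|gnz] := eqVneq (nrm g) 0.
  have G0 := nrm0_ae g2 gz; rewrite gz mulr0.
  have -> : nrm (fun x => (m (l * x) - m x) * g x) = nrm (fun=> 0 : R[i]).
    apply: nrm_ae; [|exact: cmeas_cst|by apply: (ae_imp G0) => x ->; rewrite mulr0].
    apply: cmeasM; last exact: L2_cmeas.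
    apply: cmeasB => //; apply: (cmeas_comp mm (h := fun x => l * x)).
    exact: measurable_funM.
  by rewrite /nrm; under eq_Rintegral do rewrite Normc.normc0 expr0n;
    rewrite /Rintegral integral0 sqrtr0.
have gp : 0 < nrm g by rewrite lt0r gnz nrm_ge0.
have [f f2 Ff] := fourier_surj g2.
pose c : R[i] := ((nrm g)^-1)%:C%C.
have nc : normc c = (nrm g)^-1 by rewrite normc_real gtr0_norm ?invr_gt0.
have F2 := L2_fourier f2.
pose f' x := c * f x.
have f'2 : L2 f' by exact: L2Z.
have Ff' : aeeq (fourier f') (fun x => c * g x).
  have H := fourier_linear c f2 L2_0.
  have H0 : aeeq (fourier (fun=> 0 : R[i])) (fun=> 0).
    apply: nrm0_ae; first exact: L2_fourier L2_0.
    rewrite fourier_nrm; last exact: L2_0.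
    by rewrite /nrm; under eq_Rintegral do rewrite Normc.normc0 expr0n;
      rewrite /Rintegral integral0 sqrtr0.
  have -> : f' = fun x => c * f x + 0 by apply/funext => x; rewrite addr0.
  apply: (ae_imp2 (ae_imp2 H H0 (fun x a b => conj a b)) Ff) => x [-> ->] ->.
  by rewrite addr0.
have band : L2band r f'.
  split => //; apply: (ae_imp Ff') => x -> /gband ->; by rewrite mulr0.
have nf' : nrm f' = 1.
  by rewrite -fourier_nrm// (nrm_ae (L2_cmeas (L2_fourier f'2)) (L2_cmeas (L2Z c g2)) Ff')
     nrmZ// nc mulVf.
have O1 := L2_opdil lN0 T2 f'2; have O2 := L2_opdil (oner_neq0 R) T2 f'2.
have le1 : (normL2 (fun x => opdil l T f' x - opdil 1 T f' x)%R <= e%:E)%E.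
  apply: (@le_trans _ _ (opnorm_on (L2band r) (fun f x => opdil l T f x - opdil 1 T f x))).
    by apply: ereal_sup_ubound; exists f' => //; split => //; rewrite normL2_nrm// nf'.
  by rewrite -(fineK fin) lee_fin ltW.
have mg2 : L2 (fun x => (m (l * x) - m x) * g x).
  apply: (L2M (k := 2)) => //.
    apply: cmeasB => //; apply: (cmeas_comp mm (h := fun x => l * x)).
    exact: measurable_funM.
  by move=> x; rewrite (le_trans (normcD _ _))// normcN !m1; lra.
move: le1; rewrite normL2_nrm; last exact: L2B.
rewrite lee_fin -fourier_nrm; last exact: L2B.
have D : aeeq (fourier (fun x => opdil l T f' x - opdil 1 T f' x))
    (fun x => c * ((m (l * x) - m x) * g x)).
  have S1 := has_symbol_opdil lN0 T2 Tm f'2.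
  have S2 := has_symbol_opdil (oner_neq0 R) T2 Tm f'2.
  have S3 := fourierB O1 O2.
  apply: (ae_imp2 (ae_imp2 S1 S2 (fun x a b => conj a b)) 
                  (ae_imp2 S3 Ff' (fun x a b => conj a b))) => x [E1 E2] [-> E4].
  by rewrite E1 E2 E4 mul1r -mulrBl mulrCA.
rewrite (nrm_ae (L2_cmeas (L2_fourier (L2B O1 O2))) (L2_cmeas (L2Z c mg2)) D).
by rewrite nrmZ// nc mulrC ler_pdivrMr.
Qed.

(** Test on the indicator of the interval. Cauchy-Schwarz with the indicator used twice costs its
    squared norm [2 * d], which cancels the factor of the average: the bound does not depend on [d].
    Dilating the variable moves the interval to centre [l * x] and radius [l * d]. *)
Lemma LUC_symbol_avg (r e : R) : LUC T -> 1 < r -> 0 < e ->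
  exists2 eta, 0 < eta & forall l, `|l - 1| < eta -> 0 < l ->
  forall x d, 0 < d -> r^-1 <= x - d -> x + d <= r ->
  normc (cavg m (l * x) (l * d) - cavg m x d) <= e.
Proof.
move=> lucT r1 e0; have [eta eta0 H] := LUC_symbol_norm lucT r1 e0.
exists eta => // l l1 l0 x d d0 xr xd.
have i2 := L2_ind (x - d) (x + d).
have rp : 0 < r^-1 by rewrite invr_gt0 (lt_trans ltr01).
have := H l l1 l0 _ i2; have {}H := H.
have band y : `|y| < r^-1 \/ r < `|y| -> ind (x - d) (x + d) y = 0.
  rewrite indE; case: ifP => // /andP[y1 y2].
  have y0 : 0 < y by rewrite (lt_le_trans rp)// (le_trans xr).
  rewrite gtr0_norm// => -[|]; last by rewrite ltNge (le_trans y2 xd).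
  by rewrite ltNge (le_trans xr y1).
move=> /(_ band) Hn.
have ml : cmR (fun y => m (l * y)).
  by apply: (cmeas_comp mm (h := fun x => l * x)); exact: measurable_funM.
have dp : 0 < 2 * d by rewrite mulr_gt0.
have E : cavg m (l * x) (l * d) - cavg m x d = ((2 * d)^-1)%:C%C *
    cint (fun y => ((m (l * y) - m y) * ind (x - d) (x + d) y) * ind (x - d) (x + d) y).
  have j1 : L1 (fun y => ind (x - d) (x + d) y * m (l * y)).
    by apply: (loc_L1_bounded (k := 1) ml) => y; rewrite m1.
  have j2 : L1 (fun y => ind (x - d) (x + d) y * m y) by exact: loc_L1_symbol.
  have -> : cint (fun y => ((m (l * y) - m y) * ind (x - d) (x + d) y) * ind (x - d) (x + d) y) =
     cint (fun y => ind (x - d) (x + d) y * m (l * y)) - cint (fun y => ind (x - d) (x + d) y * m y).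
    by rewrite -(cintB j1 j2); apply: eq_cint => y; rewrite -mulrA indM mulrC mulrBr.
  rewrite mulrBr; congr (_ - _).
  have lN0 : l != 0 by rewrite gt_eqF.
  have := @cint_affine R l 0 lN0 (fun y => ind (l * x - l * d) (l * x + l * d) y * m y).
  move=> /(_ (loc_L1_symbol _ _)) C.
  have -> : cint (fun y => ind (x - d) (x + d) y * m (l * y)) =
    cint (fun y => ind (l * x - l * d) (l * x + l * d) (l * y + 0) * m (l * y + 0)).
    apply: eq_cint => y; rewrite ind_affine// !subr0 addr0 -mulrBr -mulrDr.
    by rewrite ![l * _ / l]mulrAC mulfV// !mul1r.
  rewrite C mulrA -RC_M; congr (_%:C%C * _).
  by rewrite gtr0_norm// -invfM; congr (_^-1); ring.
have mi2 : L2 (fun y => (m (l * y) - m y) * ind (x - d) (x + d) y).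
  apply: (L2M (k := 2)) => //; first exact: cmeasB.
  by move=> y; rewrite (le_trans (normcD _ _))// normcN !m1; lra.
rewrite E normcM normc_real gtr0_norm ?invr_gt0// mulrC ler_pdivrMr//.
apply: (le_trans (normc_cintM mi2 i2)).
apply: (le_trans (ler_wpM2r (nrm_ge0 _) Hn)).
have nE : nrm (ind (x - d) (x + d)) ^+ 2 = 2 * d by rewrite nrm_ind; lra.
by rewrite -mulrA -expr2 nE.
Qed.

(** Starting at 1/2 keeps every interval of centre e^s and relative radius [rad n] between e^s / 2
    and 3 e^s / 2. *)
Let rad (n : nat) : R := n.+2%:R^-1.

(** The radius is proportional to the centre, so that a dilation by e^(s' - s) carries the interval
    of [A n s] onto that of [A n s']. *)
Let A (n : nat) (s : R) := cavg m (expR s) (rad n * expR s).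

Let rad_gt0 n : 0 < rad n. Proof. by rewrite invr_gt0. Qed.

Let rad_le n : rad n <= 2^-1. Proof. by rewrite lef_pV2 ?posrE// ler_nat. Qed.

Let A_equicontinuous (N e : R) : LUC T -> 0 < e ->
  exists2 eta, 0 < eta & forall s s', `|s| <= N -> `|s' - s| < eta ->
  forall n, normc (A n s' - A n s) <= e.
Proof.
(* The band from 1/r to r then contains all intervals from e^s / 2 to 3 e^s / 2 with [s] bounded by
   [N]. *)
move=> lucT e0; pose r := 2 * expR `|N|.
have r1 : 1 < r.
  have : 1 <= expR `|N| by rewrite -expR0 ler_expR.
  by rewrite /r; lra.
have [eta eta0 H] := LUC_symbol_avg lucT r1 e0.
have /(_ _ eta0)[del del0 Hdel] : forall e, 0 < e -> \forall t \near (0 : R), `|expR t - 1| < e.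
  move=> t t0; have /cvgrPdistC_lt/(_ _ t0) := @continuous_expR R 0.
  by apply: filterS => y; rewrite expR0.
exists del => // s s' sN ss' n.
have Hl : `|expR (s' - s) - 1| < eta by apply: Hdel; rewrite /ball_/= sub0r normrN.
have sN' : `|s| <= `|N| by rewrite (le_trans sN)// ler_norm.
have E1 : expR s' = expR (s' - s) * expR s by rewrite -expRD subrK.
have sp := expR_gt0 s.
have hl : expR (- `|N|) <= expR s.
  by rewrite ler_expR; move: sN'; rewrite ler_norml => /andP[].
have hr : expR s <= expR `|N|.
  by rewrite ler_expR; move: sN'; rewrite ler_norml => /andP[].
have rs : rad n * expR s <= 2^-1 * expR s by rewrite ler_pM2r.
have := H _ Hl (expR_gt0 _) (expR s) (rad n * expR s).
rewrite /A E1 mulrCA; apply.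
- by rewrite mulr_gt0.
- by rewrite /r invfM -expRN; lra.
- by rewrite /r; lra.
Qed.

(** The averages converge to the symbol at almost every point, hence on a dense set; equicontinuity
    extends the convergence to every point and passes to the limit [w]. *)
Lemma LUC_continuous_symbol : LUC T -> exists w : R -> R[i],
  [/\ loc_unif_continuous w, forall s, normc (w s) = 1 &
   {ae mu, forall x, 0 < x -> m x = w (ln x)}].
Proof.
move=> lucT.
have leb : {ae mu, forall x, 0 < x -> normc (A n (ln x) - m x) @[n --> \oo] --> 0}.
  apply: (ae_imp (lebesgue_avg loc_L1_symbol)) => x H x0.
  have cv0 : rad n * x @[n --> \oo] --> (0 : R).
    rewrite -[X in _ --> X](mul0r x); apply: cvgM; last exact: cvg_cst.
    by have := @cvg_harmonic R; rewrite -(cvg_shiftS (@harmonic R)).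
  have cv : rad n * x @[n --> \oo] --> 0^'+.
    move=> B [d d0 Hd]; have /cvgrPdist_lt/(_ _ d0)[K _ HK] := cv0.
    by exists K => // n /HK Kn; apply: Hd => //=; rewrite mulr_gt0.
  rewrite /A lnK//; exact: (cvg_comp _ _ cv H).
have dense s (e : R) : 0 < e -> exists s', `|s' - s| < e /\
    normc (A n s' - m (expR s')) @[n --> \oo] --> 0.
  move=> e0; have [|x [/andP[x1 x2] Hx]] := @ae_dense _ (expR (s - e)) (expR (s + e)) leb.
    by rewrite ltr_expR; lra.
  have x0 : 0 < x by rewrite (lt_trans _ x1) ?expR_gt0.
  exists (ln x); rewrite lnK//; split; last exact: Hx.
  move: x1 x2; rewrite -{1 2}(lnK x0) !ltr_expR => x1 x2.
  by rewrite ltr_norml; apply/andP; split; lra.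
(* Two averages at [s] are compared through a nearby point of convergence: two errors from
   equicontinuity and two from convergence, each at most [e / 4]. *)
have cauchy s (e : R) : 0 < e -> exists K, forall i j, (K <= i)%N -> (K <= j)%N ->
    normc (A i s - A j s) <= e.
  move=> e0; have e4 : 0 < e / 4 by rewrite divr_gt0.
  have [eta eta0 H] := @A_equicontinuous `|s| _ lucT e4.
  have [s' [ss' cv]] := dense s eta eta0.
  have /cvgr_lt/(_ _ e4)[K _ HK] := cv.
  exists K => i j /HK/ltW Ki /HK/ltW Kj.
  exact: normc_quad (H s s' (lexx _) ss' i) Ki Kj (H s s' (lexx _) ss' j).
have cauchy_cvg (u : nat -> R) : (forall e : R, 0 < e -> exists K, forall i j, (K <= i)%N ->
    (K <= j)%N -> `|u i - u j| <= e) -> cvgn u.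
  move=> uC; apply/cauchy_cvgP/cauchy_exP => e e0.
  have e20 : 0 < e / 2 by rewrite divr_gt0.
  have [K HK] := uC _ e20; exists (u K); exists K => // n Kn.
  by rewrite /= /ball/= (le_lt_trans (HK K n _ Kn))//; lra.
have cvRe s : cvgn (fun n => Re (A n s)).
  apply: cauchy_cvg => e e0; have [K HK] := cauchy s e e0.
  by exists K => i j Ki Kj; rewrite -ReB (le_trans (ler_Re _))// HK.
have cvIm s : cvgn (fun n => Im (A n s)).
  apply: cauchy_cvg => e e0; have [K HK] := cauchy s e e0.
  by exists K => i j Ki Kj; rewrite -ImB (le_trans (ler_Im _))// HK.
pose p s := limn (fun n => Re (A n s)); pose q s := limn (fun n => Im (A n s)).
pose w s := Complex (p s) (q s).
have Aw s : normc (A n s - w s) @[n --> \oo] --> 0.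
  apply: (@squeeze_cvgr _ _ _ _ (fun=> 0)
    (fun k => `|Re (A k s) - p s| + `|Im (A k s) - q s|)).
  - by apply: nearW => k; rewrite normc_ge0/= (le_trans (normc_le _))// ReB ImB.
  - exact: cvg_cst.
  - rewrite -[X in _ --> X](addr0 0); apply: cvgD; apply: cvg_dist0;
      [exact: cvRe|exact: cvIm].
have equi : loc_unif_continuous w.
  move=> N e e0; have [eta eta0 H] := @A_equicontinuous N _ lucT e0.
  exists eta => // s s' sN ss'; apply/ler_addgt0Pr => d d0.
  have d2 : 0 < d / 2 by rewrite divr_gt0.
  have /cvgr_lt/(_ _ d2)[K _ HK] := Aw s; have /cvgr_lt/(_ _ d2)[K' _ HK'] := Aw s'.
  have /ltW h1 := HK (maxn K K') (leq_maxl _ _).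
  have /ltW h2 := HK' (maxn K K') (leq_maxr _ _).
  exact: normc_triple (H s s' sN ss' (maxn K K')) h2 h1.
have wm s : normc (A n s - m (expR s)) @[n --> \oo] --> 0 -> w s = m (expR s).
  by move=> H; exact: (cvg_normc_unique (Aw s) H).
(* The modulus is 1 at the dense points where [w] equals a value of [m], hence everywhere by
   continuity. *)
have w1 s : normc (w s) = 1.
  apply/eqP; rewrite -subr_eq0 -normr_eq0 eq_le normr_ge0 andbT.
  apply/ler_addgt0Pr => e e0; rewrite add0r.
  have [eta eta0 H] := equi `|s| e e0.
  have [s' [ss' cv]] := dense s eta eta0.
  apply: unimodular_close (H s s' (lexx _) ss').
  by rewrite (wm _ cv) m1.
exists w; split => //.
apply: (ae_imp leb) => x H x0; have := H x0; rewrite -{2}(lnK x0) => /wm.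
by rewrite lnK.
Qed.

End one_operator.
End symbol_calculus.

(** * Continuous logarithms and the power law *)

Section lifting.
Context {R : realType}.

Lemma expi_inj0 (x : R) : 0 <= x <= pi -> expi x = 1 -> x = 0.
Proof.
move=> xpi; rewrite -expi0 => /(congr1 (@complex.Re R)) /= H.
by apply: cos_inj => //; rewrite in_itv//= lexx pi_ge0.
Qed.

(** If [g] left 0, the intermediate value theorem would give it a value strictly between 0 and 2 pi
    in modulus, where e^(it) differs from 1. *)
Lemma lift_unique (g : R -> R) (N : R) : continuous g -> g 0 = 0 ->
  (forall x, `|x| <= N -> expi (g x) = 1) -> forall x, `|x| <= N -> g x = 0.
Proof.
have key (h : R -> R) x : continuous h -> h 0 = 0 ->
  (forall y, `|y| <= N -> expi (h y) = 1) -> `|x| <= N -> ~ (0 < h x).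
  move=> ch h0 hN xN hx.
  (* Capping at pi keeps the intermediate value in the interval where the cosine is injective. *)
  pose v := Num.min (h x) pi.
  have v0 : 0 < v by rewrite lt_min hx pi_gt0.
  have vle : v <= h x by rewrite ge_min lexx.
  have [c cin hc] : exists2 c, `|c| <= `|x| & h c = v.
    have [x0|x0] := leP 0 x.
      have [||c] := @IVT R h 0 x v x0; [exact: continuous_subspaceT|
         by rewrite h0 (min_idPl (ltW hx)) (max_idPr (ltW hx)) ltW|].
      rewrite in_itv/= => /andP[c0 cx] hc; exists c => //.
      by rewrite !ger0_norm.
    have [||c] := @IVT R h x 0 v (ltW x0); [exact: continuous_subspaceT|
         by rewrite h0 (min_idPr (ltW hx)) (max_idPl (ltW hx)) ltW|].
    rewrite in_itv/= => /andP[c0 cx] hc; exists c => //.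
    by rewrite ler0_norm// ltr0_norm// lerN2.
  have /hN : `|c| <= N by exact: le_trans xN.
  have vpi : 0 <= v <= pi by rewrite (ltW v0) ge_min lexx orbT.
  by rewrite hc => /(expi_inj0 vpi) H; rewrite H ltxx in v0.
move=> cg g0 gN x xN; apply/eqP; rewrite eq_le; apply/andP; split.
  by rewrite leNgt; apply/negP; exact: (key g).
rewrite leNgt; apply/negP => gx; apply: (key (fun y => - g y) x) => //.
- by move=> y; apply: cvgN; exact: cg.
- by rewrite g0 oppr0.
- by move=> y yN; have := expiN (g y); rewrite gN// mul1r.
- by rewrite oppr_gt0.
Qed.

Lemma expi1_const (g : R -> R) : continuous g -> (forall x, expi (g x) = 1) ->
  forall x, g x = g 0.
Proof.
move=> cg g1 x; apply/eqP; rewrite -subr_eq0; apply/eqP.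
apply: (@lift_unique (fun y => g y - g 0) `|x|) => //.
- by move=> y; apply: cvgB; [exact: cg|exact: cvg_cst].
- by rewrite subrr.
- by move=> y _; rewrite expiD g1 mul1r; have := expiN (g 0); rewrite g1 mul1r.
Qed.

(* The principal argument when Re z >= 1/2; the maximum makes it continuous
   in z everywhere. *)
Definition argc (z : R[i]) : R := atan (Im z / Num.max (Re z) 2^-1).

Lemma expi_argc (z : R[i]) : normc z = 1 -> 2^-1 <= Re z -> expi (argc z) = z.
Proof.
move=> z1 z2; have z0 : 0 < Re z by rewrite (lt_le_trans _ z2).
have zn : Re z != 0 by rewrite gt_eqF.
have E : 1 + (Im z / Re z) ^+ 2 = (Re z) ^- 2.
  have := normc_sqr z; rewrite z1 expr1n => H.
  by rewrite -[RHS]mul1r [X in _ = X * _]H; field.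
have C : cos (argc z) = Re z.
  rewrite /argc (max_idPl z2) cos_atan E sqrtrV ?sqr_ge0// sqrtr_sqr invrK.
  by rewrite gtr0_norm.
apply: complex_eq; first exact: C.
have := atanK (Im z / Num.max (Re z) 2^-1); rewrite /tan -/(argc z) C (max_idPl z2) => H.
by rewrite /= -[LHS](divfK zn) H divfK.
Qed.

(** For unimodular numbers, |z - z'|^2 = 2 - 2 Re (z conj z'). *)
Lemma Re_conj_ge (z z' : R[i]) : normc z = 1 -> normc z' = 1 -> normc (z - z') <= 1 ->
  2^-1 <= Re (z * conjc z').
Proof.
move=> z1 z2 zz; have := normc_sqr z; have := normc_sqr z'.
rewrite z1 z2 expr1n => h1 h2.
have : normc (z - z') ^+ 2 <= 1 by rewrite expr_le1.
rewrite normc_sqr ReB ImB ReM Reconj Imconj => h3.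
have : (Re z - Re z') ^+ 2 + (Im z - Im z') ^+ 2 =
  (Re z ^+ 2 + Im z ^+ 2) + (Re z' ^+ 2 + Im z' ^+ 2) - 2 * (Re z * Re z' - Im z * - Im z') by ring.
rewrite -h1 -h2; lra.
Qed.

Lemma polar (z : R[i]) : normc z = 1 -> exists t : R, expi t = z.
Proof.
move=> z1; have := normc_sqr z; rewrite z1 expr1n => H.
have zr : -1 <= Re z <= 1.
  by rewrite -ler_norml -z1; exact: ler_Re.
have C : cos (acos (Re z)) = Re z by apply: acosK; rewrite in_itv.
have S : sin (acos (Re z)) = `|Im z|.
  by rewrite sin_acos// -sqrtr_sqr; congr Num.sqrt; lra.
have [i0|i0] := leP 0 (Im z).
  by exists (acos (Re z)); apply: complex_eq => //=; rewrite S ger0_norm.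
exists (- acos (Re z)); apply: complex_eq => /=; first by rewrite cosN.
by rewrite sinN S ltr0_norm// opprK.
Qed.

Variable w : R -> R[i].
Hypotheses (wc : loc_unif_continuous w) (w1 : forall s, normc (w s) = 1).

Lemma loc_unif_continuous_part (P : R[i] -> R) :
  (forall z z', P (z - z') = P z - P z') ->
  (forall z, `|P z| <= normc z) -> continuous (fun s => P (w s)).
Proof.
move=> PB Pn s; apply/cvgrPdistC_le => e e0.
have [eta eta0 H] := wc `|s| e0.
exists eta => // s' /=; rewrite distrC => ss'.
by rewrite -PB (le_trans (Pn _))// H.
Qed.

Let cRe : continuous (fun s => Re (w s)).
Proof. exact: loc_unif_continuous_part ReB (@ler_Re R). Qed.

Let cIm : continuous (fun s => Im (w s)).
Proof. exact: loc_unif_continuous_part ImB (@ler_Im R). Qed.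

(* The lift is the sum of the small angles between consecutive points of the
   subdivision of [0, x] into k parts. *)
Let step (k j : nat) (x : R) := argc (w (x * (j.+1%:R / k%:R)) * conjc (w (x * (j%:R / k%:R)))).
Let psi (k n : nat) (x : R) := \sum_(j < n) step k j x.

Let continuous_psi k n : continuous (psi k n).
Proof.
have cmul (c : R) : continuous (fun x : R => x * c).
  by move=> x; apply: cvgM; [exact: cvg_id|exact: cvg_cst].
have cR (c : R) : continuous (fun x : R => Re (w (x * c))).
  by move=> x; exact: (@continuous_comp _ _ _ (fun y : R => y * c) (fun s => Re (w s))
    x (cmul c x) (@cRe _)).
have cI (c : R) : continuous (fun x : R => Im (w (x * c))).
  by move=> x; exact: (@continuous_comp _ _ _ (fun y : R => y * c) (fun s => Im (w s))
    x (cmul c x) (@cIm _)).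
have cs j : continuous (step k j).
  move=> x; pose q := fun x : R => w (x * (j.+1%:R / k%:R)) * conjc (w (x * (j%:R / k%:R))).
  have cq : continuous (fun x => Re (q x)).
    have -> : (fun x => Re (q x)) = (fun x => Re (w (x * (j.+1%:R / k%:R))) * Re (w (x * (j%:R / k%:R)))
        - Im (w (x * (j.+1%:R / k%:R))) * - Im (w (x * (j%:R / k%:R)))).
      by apply/funext => y; rewrite /q ReM Reconj Imconj.
    by move=> y; apply: cvgB; apply: cvgM; try apply: cvgN; [exact: cR|exact: cR|exact: cI|exact: cI].
  have ciq : continuous (fun x => Im (q x)).
    have -> : (fun x => Im (q x)) = (fun x => Re (w (x * (j.+1%:R / k%:R))) * - Im (w (x * (j%:R / k%:R)))
        + Im (w (x * (j.+1%:R / k%:R))) * Re (w (x * (j%:R / k%:R)))).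
      by apply/funext => y; rewrite /q ImM Reconj Imconj.
    by move=> y; apply: cvgD; apply: cvgM; try apply: cvgN; [exact: cR|exact: cI|exact: cI|exact: cR].
  apply: (@continuous_comp _ _ _ (fun x => Im (q x) / Num.max (Re (q x)) 2^-1) (@atan R));
    last exact: continuous_atan.
  apply: cvgM; first exact: ciq.
  apply: cvgV; first by rewrite gt_eqF// lt_max invr_gt0 ltr0n orbT.
  by apply: (@continuous_max _ _ (fun x => Re (q x)) (cst 2^-1)); [exact: cq|exact: cst_continuous].
elim: n => [|n IH] x.
  have -> : psi k 0 = cst 0 by apply/funext => y; rewrite /psi big_ord0.
  exact: cst_continuous.
have -> : psi k n.+1 = fun y => psi k n y + step k n y.
  by apply/funext => y; rewrite /psi big_ord_recr.
by apply: cvgD; [exact: IH|exact: cs].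
Qed.

Let psi0 k n : psi k n 0 = 0.
Proof.
rewrite /psi big1// => j _; rewrite /step !mul0r mulcJ w1 expr1n.
by rewrite /argc/= mul0r atan0.
Qed.

(** The exponentials of the small angles are successive ratios of values of [w], and their product
    telescopes. *)
Let expi_psi (N : R) : exists2 k, (0 < k)%N & forall x, `|x| <= N -> expi (psi k k x) = w x * conjc (w 0).
Proof.
have [eta eta0 H] := wc N (ltr01 : 0 < (1 : R)).
(* Neighbouring points of the subdivision must lie within [eta], so that the values of [w] differ by
   at most 1 and [argc] is a true argument of their ratio. *)
have [k Hk] : exists k : nat, (0 < k)%N /\ `|N| / k%:R < eta.
  have [K _ HK] := nbhs_infty_ger (`|N| / eta + 1).
  exists K.+1; split => //.
  have := HK K.+1 (leqnSn _) => h.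
  by rewrite ltr_pdivrMr// mulrC -ltr_pdivrMr// (lt_le_trans _ h)// ltrDl.
case: Hk => k0 Hk; exists k => // x xN.
have kn : k%:R != 0 :> R by rewrite pnatr_eq0 -lt0n.
have kp : 0 < k%:R :> R by rewrite ltr0n.
have stepE j : (j < k)%N -> expi (step k j x) =
    w (x * (j.+1%:R / k%:R)) * conjc (w (x * (j%:R / k%:R))).
  move=> jk; apply: expi_argc.
    by rewrite normcM normc_conj !w1 mulr1.
  apply: Re_conj_ge => //; apply: H.
    rewrite normrM (le_trans _ xN)// ler_piMr// ger0_norm ?divr_ge0//.
    by rewrite ler_pdivrMr// mul1r ler_nat ltnW.
  rewrite -mulrBr -mulrBl -natrB// subSnn mul1r normrM [`|_^-1|]gtr0_norm ?invr_gt0//.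
  apply: le_lt_trans Hk; rewrite ler_pM2r ?invr_gt0//; exact: le_trans xN (ler_norm _).
suff E n : (n <= k)%N -> expi (psi k n x) = w (x * (n%:R / k%:R)) * conjc (w 0).
  by rewrite E// mulfV// mulr1.
elim: n => [_|n IH nk].
  by rewrite /psi big_ord0 expi0 mul0r mulr0 mulcJ w1 expr1n.
rewrite /psi big_ord_recr/= expiD -/(psi k n x) IH ?(ltnW nk)// stepE//.
have := mulcJ (w (x * (n%:R / k%:R))); rewrite w1 expr1n => E.
by rewrite mulrCA mulrA -mulrA -[RHS]mulr1 -[X in _ = _ * X]/(1%:C)%C -E; ring.
Qed.

(** The number of steps depends on the interval. The lifts on nested intervals agree by
    [lift_unique], having the same value at 0, and are glued. *)
Lemma continuous_lift : exists2 phi : R -> R, continuous phi & forall s, w s = expi (phi s).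
Proof.
have [t0 Ht0] := polar (w1 0).
have /choice[K HK] : forall n : nat, exists k, forall x, `|x| <= n%:R ->
    expi (psi k k x) = w x * conjc (w 0).
  by move=> n; have [k _ Hk] := expi_psi n%:R; exists k.
pose f n x := t0 + psi (K n) (K n) x.
have fc n : continuous (f n).
  by move=> x; apply: cvgD; [exact: cvg_cst|exact: continuous_psi].
have fE n x : `|x| <= n%:R -> expi (f n x) = w x.
  move=> xn; rewrite /f expiD HK// Ht0 mulrCA mulcJ w1 expr1n.
  by rewrite -[(1%:C)%C]/(1 : R[i]) mulr1.
have fmn m n x : (m <= n)%N -> `|x| <= m%:R -> f n x = f m x.
  move=> mn xm; apply/eqP; rewrite -subr_eq0; apply/eqP.
  apply: (@lift_unique (fun y => f n y - f m y) m%:R) => //.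
  - by move=> y; apply: cvgB; exact: fc.
  - by rewrite /f !psi0 subrr.
  - move=> y ym; rewrite expiD fE ?(le_trans ym) ?ler_nat// -(fE m)//.
    exact: expiN.
(* The strict inequality [|x| < ix x] leaves room for a neighbourhood of [x] on which the same lift
   is valid. *)
pose ix (x : R) := (Num.truncn `|x|).+1.
have ixP x : `|x| < (ix x)%:R by rewrite /ix truncnS_gt.
exists (fun x => f (ix x) x); last by move=> s; rewrite fE// ltW.
move=> x.
have near_eq : \forall y \near x, f (ix x) y = f (ix y) y.
  have dp : 0 < (ix x)%:R - `|x| by rewrite subr_gt0.
  exists ((ix x)%:R - `|x|) => // y /=; rewrite /ball_/= => xy.
  have yx : `|y| <= (ix x)%:R.
    have := ler_normD x (y - x); rewrite addrC subrK distrC.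
    by move: xy; lra.
  have [le|le] := leqP (ix x) (ix y); first by rewrite (fmn _ _ _ le).
  by rewrite -(fmn _ _ _ (ltnW le))// ltW.
have := fc (ix x) x => H.
rewrite /continuous_at; apply: cvg_trans H.
exact: near_eq_cvg.
Qed.

End lifting.

(** * Periodic functions and the power law for the phase *)

Section power_law.
Context {R : realType}.
Implicit Types (g : R -> R) (p q u v s c M : R).

Definition period (g : R -> R) : set R := [set p | forall s, g (s + p) = g s].

Lemma periodD g p q : period g p -> period g q -> period g (p + q).
Proof. by move=> gp gq s; rewrite addrA gq gp. Qed.

Lemma periodN g p : period g p -> period g (- p).
Proof. by move=> gp s; rewrite -{2}(subrK p s) gp. Qed.

Lemma period_mulrz g p (k : int) : period g p -> period g (p *~ k).
Proof.
have H n q : period g q -> period g (q *+ n).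
  move=> gq; elim: n => [|n IH]; first by move=> s; rewrite mulr0n addr0.
  by rewrite mulrS; exact: periodD.
move=> gp; case: k => n; first exact: H.
by rewrite NegzE mulrNz; apply: periodN; exact: H.
Qed.

Lemma period_norm g p : period g p -> period g `|p|.
Proof. by move=> gp; case: ler0P => _; [exact: periodN|]. Qed.

Lemma euclid_real (p s : R) : 0 < p -> exists k : int, 0 <= s - p *~ k < p.
Proof.
move=> p0; exists (Num.floor (s / p)).
have /andP[h1 h2] := Num.Theory.floor_itv (s / p).
rewrite -mulrzr subr_ge0 mulrC -ler_pdivlMr// h1/=.
by rewrite ltrBlDr -[X in X + _]mul1r -mulrDl -ltr_pdivrMr// addrC -intrD1.
Qed.

Lemma period_reduce g p s : period g p -> 0 < p -> exists2 r, 0 <= r < p & g s = g r.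
Proof.
move=> gp p0; have [k hk] := euclid_real s p0; exists (s - p *~ k) => //.
by have := periodN (period_mulrz k gp) s => ->.
Qed.

Lemma periodic_bounded g p : continuous g -> period g p -> 0 < p ->
  exists M, forall s, `|g s| <= M.
Proof.
move=> cg gp p0.
have cn : {within `[0, p], continuous (fun x => `|g x|)}.
  apply: continuous_subspaceT => x.
  exact: (@continuous_comp _ _ _ g _ x (cg x) (@norm_continuous _ _ _)).
have [c _ H] := EVT_max (ltW p0) cn.
exists `|g c| => s; have [r /andP[r0 rp] ->] := period_reduce s gp p0.
by apply: H; rewrite in_itv/= r0 ltW.
Qed.

(** Iterating the shift multiplies a nonzero value by c^n, which is unbounded for c > 1 by
    Bernoulli's inequality. *)
Lemma bounded_quasiperiod g c v s0 M : (forall s, `|g s| <= M) ->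
  (forall s, g (s + v) = c * g s) -> g s0 != 0 -> c <= 1.
Proof.
move=> gM gv g0; rewrite leNgt; apply/negP => c1.
have gn n : g (s0 + v *+ n) = c ^+ n * g s0.
  elim: n => [|n IH]; first by rewrite mulr0n addr0 mul1r.
  by rewrite mulrSr addrA gv IH exprS mulrA.
have bern n : 1 + n%:R * (c - 1) <= c ^+ n.
  elim: n => [|n IH]; first by rewrite mul0r addr0 expr0.
  have n0 : 0 <= n%:R * (c - 1) ^+ 2 by rewrite mulr_ge0// sqr_ge0.
  have : c * (1 + n%:R * (c - 1)) <= c * c ^+ n by rewrite ler_pM2l// (lt_trans ltr01).
  rewrite exprS -natr1; move: n0; lra.
have gp : 0 < `|g s0| by rewrite normr_gt0.
have [K _ HK] := nbhs_infty_ger (M / `|g s0| / (c - 1)).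
have := HK K (leqnn K); rewrite /= ler_pdivrMr ?subr_gt0// => h.
have := gM (s0 + v *+ K); rewrite gn normrM -ler_pdivlMr// => h2.
have := bern K; have := ler_norm (c ^+ K); lra.
Qed.

Lemma closed_period g : continuous g -> closed (period g).
Proof.
move=> cg p clp s; apply/eqP; rewrite -subr_eq0 -normr_le0; apply/ler_addgt0Pl => e e0.
rewrite addr0.
have /cvgrPdist_lt /(_ _ e0) [d d0 H] := cg (s + p).
have [q [gq]] := clp _ (nbhsx_ballx p d d0).
rewrite /ball/= => pq.
have := H (s + q); rewrite /ball_/= gq => /(_ _)/ltW; apply.
by rewrite (_ : s + p - (s + q) = p - q)//; ring.
Qed.

(** Parity: 3^n is odd, so 2^m = 3^n forces m = 0 and then n = 0. Signs are removed by taking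
    absolute values. *)
Lemma ln2_ln3_indep (j k : int) : j != 0 -> ln (2 : R) *~ k <> ln (3 : R) *~ j.
Proof.
move=> j0 H.
have l2 : 0 < ln (2 : R) by rewrite ln_gt0// ltr1n.
have l3 : 0 < ln (3 : R) by rewrite ln_gt0// ltr1n.
have nat_case (m n : nat) : ln (2 : R) *+ m = ln (3 : R) *+ n -> n = 0%N.
  rewrite -!lnXn ?ltr0n// => /ln_inj; rewrite !posrE !exprn_gt0 ?ltr0n// => /(_ isT isT)/eqP.
  rewrite -!natrX eqr_nat => /eqP E.
  have := congr1 odd E; rewrite !oddX/= orbF orbT => /eqP/eqP/eqP m0.
  move: E; rewrite m0 expn0; case: n => // n; rewrite expnS.
  by have := expn_gt0 3 n; case: (3 ^ n)%N => // q _; rewrite mulnS.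
have := congr1 Num.norm H; rewrite !normrMz (gtr0_norm l2) (gtr0_norm l3).
rewrite -!abszE -!pmulrn => /nat_case/eqP.
by rewrite absz_eq0 (negbTE j0).
Qed.

(* The positive periods either accumulate at 0, or are the multiples of the
   least one; the latter makes ln 2 / ln 3 rational. *)
Lemma periodic_const g u v al : continuous g -> period g u -> period g v ->
  al * u = ln 2 -> al * v = ln 3 -> forall s, g s = g 0.
Proof.
move=> cg gu gv alu alv.
have l2 : 0 < ln (2 : R) by rewrite ln_gt0// ltr1n.
have l3 : 0 < ln (3 : R) by rewrite ln_gt0// ltr1n.
have u0 : u != 0 by apply/eqP => E; move: l2; rewrite -alu E mulr0 ltxx.
pose P := [set p | 0 < p /\ period g p].
have P0 : P !=set0 by exists `|u|; split; [rewrite normr_gt0|exact: period_norm].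
have lbP : has_lbound P by exists 0 => p [/ltW].
have hP : has_inf P by [].
have inf0 : 0 <= inf P by apply: lb_le_inf => // p [/ltW].
have [infp|] := ltP 0 (inf P).
  have pinf : period g (inf P).
    apply: closed_period => // B [d /= d0 dB].
    have [p [p0 gp] pd] := inf_adherent d0 hP.
    exists p; split => //; apply: dB.
    have : inf P <= p by exact: ge_inf.
    by rewrite /ball_/= distrC => h; rewrite ger0_norm ?subr_ge0// ltrBlDl.
  have mult q : period g q -> exists k : int, q = inf P *~ k.
    move=> gq; have [k /andP[h1 h2]] := euclid_real q infp; exists k.
    apply/eqP; rewrite -subr_eq0; apply/eqP/le_anti; rewrite h1 andbT leNgt.
    apply/negP => h3; move: h2; rewrite ltNge => /negP; apply.
    by apply: ge_inf => //; split => //; apply: periodD => //; apply: periodN; exact: period_mulrz.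
  have [j Ej] := mult u gu; have [k Ek] := mult v gv.
  have j0 : j != 0 by apply/eqP => E; move: u0; rewrite Ej E mulr0z eqxx.
  case: (@ln2_ln3_indep j k j0).
  suff: al * u *~ k = al * v *~ j by rewrite alu alv.
  by rewrite Ej Ek !mulrzAr -!mulrzA [(k * j)%R]mulrC.
move=> inf_le0 s; apply/eqP; rewrite -subr_eq0 -normr_le0; apply/ler_addgt0Pl => e e0.
rewrite addr0.
have /cvgrPdist_lt /(_ _ e0) [d d0 H] := cg 0.
have [p [p0 gp]] := inf_adherent d0 hP.
rewrite (le_anti (introT andP (conj inf_le0 inf0))) add0r => pd.
have [r /andP[r0 rp] ->] := period_reduce s gp p0.
rewrite distrC; apply/ltW/H; rewrite /ball_/= sub0r normrN ger0_norm//.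
exact: lt_trans pd.
Qed.

(** The exponent is read from the first relation; the second must then be shown compatible with it,
    that is [al * v = ln 3]. *)
Lemma power_law (phi : R -> R) (u v : R) : continuous phi ->
  (forall s, phi (s + u) = 2 * phi s) -> (forall s, phi (s + v) = 3 * phi s) ->
  exists al be, (al != 0) /\ forall s, phi s = be * expR (al * s).
Proof.
move=> cphi phiu phiv.
have [[s0 phi0]|H] := pselect (exists s, phi s != 0); last first.
  (* A zero phase fits every exponent; 1 is taken because the exponent must be nonzero. *)
  exists 1, 0; split => [|s]; first exact: oner_neq0.
  by rewrite mul0r; apply/eqP; apply/negPn/negP => h; apply: H; exists s.
have u0 : u != 0.
  by apply/eqP => E; have := phiu s0; move/eqP: phi0; rewrite E addr0; lra.
have l2 : 0 < ln (2 : R) by rewrite ln_gt0// ltr1n.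
pose al := ln 2 / u.
have al0 : al != 0 by rewrite mulf_neq0 ?invr_eq0// gt_eqF.
have alu : al * u = ln 2 by rewrite /al divfK.
pose g s := phi s * expR (- (al * s)).
have cg : continuous g.
  move=> s; apply: cvgM; first exact: cphi.
  apply: (@continuous_comp _ _ _ (fun s => - (al * s)) (@expR R)); last exact: continuous_expR.
  by apply: cvgN; apply: cvgM; [exact: cvg_cst|exact: cvg_id].
have gu : period g u.
  move=> s; rewrite /g phiu mulrDr opprD expRD alu (expRN (ln 2)) lnK ?posrE//.
  by field.
have [M gM] := periodic_bounded cg (period_norm gu) (eq_trans (normr_gt0 u) u0).
(* The factor of [g] under the shift [v]. Since [g] is bounded, applying [bounded_quasiperiod] to
   [v] and to [- v] gives [c <= 1] and [c^-1 <= 1]. *)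
pose c := 3 * expR (- (al * v)).
have cp : 0 < c by rewrite mulr_gt0// expR_gt0.
have gc s : g (s + v) = c * g s.
  by rewrite /g /c phiv mulrDr opprD expRD; ring.
have g0 : g s0 != 0 by rewrite mulf_neq0// gt_eqF// expR_gt0.
have c1 : c = 1.
  apply/le_anti; rewrite (bounded_quasiperiod gM gc g0)/= -invf_le1//.
  apply: (@bounded_quasiperiod g c^-1 (- v) s0 M) => // s.
  by rewrite -[in RHS](subrK v s) gc mulKf// gt_eqF.
have gv : period g v by move=> s; rewrite gc c1 mul1r.
have alv : al * v = ln 3.
  move: c1; rewrite /c expRN => /eqP; rewrite -[_ == _]/(3 / _ == _) => /eqP h.
  rewrite -[LHS]expRK; congr ln; rewrite -[RHS](divfK (_ : expR (al * v) != 0)) ?h ?mul1r//.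
  by rewrite gt_eqF// expR_gt0.
have gE := periodic_const cg gu gv alu alv.
exists al, (g 0); split => // s.
by rewrite -(gE s) /g -mulrA -expRD addNr expR0 mulr1.
Qed.

Lemma continuous_shift (h : R -> R) u : continuous h -> continuous (fun s => h (s + u)).
Proof.
move=> ch s; apply: (@continuous_comp _ _ _ (fun s => s + u) h); last exact: ch.
by apply: cvgD; [exact: cvg_id|exact: cvg_cst].
Qed.

Lemma unimodular_power_law (w : R -> R[i]) (u v : R) :
  loc_unif_continuous w -> (forall s, normc (w s) = 1) ->
  (forall s, w (s + u) = w s ^+ 2) -> (forall s, w (s + v) = w s ^+ 3) ->
  exists al be : R, al != 0 /\ forall s, w s = expi (be * expR (al * s)).
Proof.
move=> wc w1 wu wv; have [f fc fE] := continuous_lift wc w1.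
have scale (h : R -> R) c : continuous h -> continuous (fun s => c * h s).
  by move=> ch s; apply: cvgM; [exact: cvg_cst|exact: ch].
(* The defect [h (s + p) - n h s] of a continuous logarithm is continuous with values in 2 pi Z,
   hence constant. *)
have diff (h : R -> R) p (n : nat) : continuous h -> (forall s, w s = expi (h s)) ->
    (forall s, w (s + p) = w s ^+ n) ->
    (forall s, h (s + p) - n%:R * h s = h (0 + p) - n%:R * h 0) /\
    expi (h (0 + p) - n%:R * h 0) = 1.
  move=> ch hE wp.
  have eX m s : expi (m%:R * h s) = w s ^+ m.
    elim: m => [|m IH]; first by rewrite mul0r expi0.
    by rewrite -natr1 mulrDl mul1r expiD IH -hE exprSr.
  have e1 s : expi (h (s + p) - n%:R * h s) = 1.
    by rewrite expiD -hE wp -eX -expiD addrN expi0.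
  split => // s; apply: (@expi1_const R (fun s => h (s + p) - n%:R * h s)) => // {}s.
  by apply: cvgB; [exact: continuous_shift|exact: scale].
have [fu cu1] := diff f u 2%N fc fE wu.
set c := f (0 + u) - _ in fu cu1.
(* The shift by [c] absorbs the defect, as 2 (f + c) = (2 f + c) + c; it keeps a logarithm of [w]
   because [expi c = 1]. *)
pose h s := f s + c.
have ch : continuous h by move=> s; apply: cvgD; [exact: fc|exact: cvg_cst].
have hE s : w s = expi (h s) by rewrite expiD cu1 mulr1 fE.
have hu s : h (s + u) = 2 * h s by have := fu s; rewrite /h; lra.
have [hv _] := diff h v 3%N ch hE wv.
set c2 := h (0 + v) - _ in hv.
(* Shifting by [u] and [v] in either order gives 6 h + 2 c2 = 6 h + c2. *)
have c20 : c2 = 0.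
  have := hv (0 + u); have := hv 0; have := hu (0 + v).
  rewrite addrAC hu; lra.
have [al [be [al0 H]]] := power_law ch hu (fun s => subr0_eq (etrans (hv s) c20)).
by exists al, be; split => // s; rewrite hE H.
Qed.

End power_law.

(** * Identification of the symbol as a power law *)

Section power_symbols.
Context {R : realType}.
Local Notation mu := (@lebesgue_measure R).
Implicit Types (f g w : R -> R[i]) (h : R -> R).

Definition ccontinuous f : Prop :=
  continuous (fun s => Re (f s)) /\ continuous (fun s => Im (f s)).

Lemma loc_unif_ccontinuous w : loc_unif_continuous w -> ccontinuous w.
Proof.
by move=> wc; split; apply: loc_unif_continuous_part => //;
  [exact: ReB|exact: ler_Re|exact: ImB|exact: ler_Im].
Qed.

Lemma ccontinuousM f g : ccontinuous f -> ccontinuous g -> ccontinuous (fun s => f s * g s).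
Proof.
move=> [fr fi] [gr gi]; split.
  rewrite (_ : (fun s => _) = (fun s => Re (f s) * Re (g s) - Im (f s) * Im (g s))).
    by move=> s; apply: cvgB; apply: cvgM; [exact: fr|exact: gr|exact: fi|exact: gi].
  by apply/funext => s; rewrite ReM.
rewrite (_ : (fun s => _) = (fun s => Re (f s) * Im (g s) + Im (f s) * Re (g s))).
  by move=> s; apply: cvgD; apply: cvgM; [exact: fr|exact: gi|exact: fi|exact: gr].
by apply/funext => s; rewrite ImM.
Qed.

Lemma ccontinuousX n f : ccontinuous f -> ccontinuous (fun s => f s ^+ n).
Proof.
move=> cf; elim: n => [|n IH]; first by split; exact: cst_continuous.
rewrite (_ : (fun s => _) = (fun s => f s * f s ^+ n)); first exact: ccontinuousM.
by apply/funext => s; rewrite exprS.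
Qed.

Lemma ccontinuous_shift f (u : R) : ccontinuous f -> ccontinuous (fun s => f (s + u)).
Proof. by case=> cr ci; split; [exact: continuous_shift cr|exact: continuous_shift ci]. Qed.

Lemma ccontinuous_expi h : continuous h -> ccontinuous (fun s => expi (h s)).
Proof.
move=> ch; split => s.
  exact: (@continuous_comp _ _ _ h (@cos R) s (ch s) (@continuous_cos R _)).
exact: (@continuous_comp _ _ _ h (@sin R) s (ch s) (@continuous_sin R _)).
Qed.

Lemma continuous_exp_scale (al be : R) : continuous (fun s : R => be * expR (al * s)).
Proof.
move=> s; apply: cvgM; first exact: cvg_cst.
apply: (@continuous_comp _ _ _ (fun s => al * s) (@expR R)); last exact: continuous_expR.
by apply: cvgM; [exact: cvg_cst|exact: cvg_id].
Qed.

(** The logarithms of the positive points of a set of full measure are dense, so continuity extends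
    the identity to every [s]. *)
Lemma ae_ln_eq_real h1 h2 : continuous h1 -> continuous h2 ->
  {ae mu, forall x, 0 < x -> h1 (ln x) = h2 (ln x)} -> forall s, h1 s = h2 s.
Proof.
move=> c1 c2 H s; apply/eqP; rewrite -subr_eq0; apply/negPn/negP => ne.
have cd : (fun s => h1 s - h2 s) t @[t --> s] --> h1 s - h2 s by apply: cvgB; [exact: c1|exact: c2].
have /cvgrPdist_lt/(_ `|h1 s - h2 s|) := cd; rewrite normr_gt0 => /(_ ne)[d /= d0 Hd].
have [|x [/andP[x1 x2] Hx]] := @ae_dense _ _ (expR (s - d)) (expR (s + d)) H.
  by rewrite ltr_expR; lra.
have x0 : 0 < x by rewrite (lt_trans _ x1) ?expR_gt0.
suff /Hd : ball_ Num.norm s d (ln x) by rewrite /= (Hx x0) subrr subr0 ltxx.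
move: x1 x2; rewrite -{1 2}(lnK x0) !ltr_expR => x1 x2.
by rewrite /ball_/= ltr_norml; apply/andP; split; lra.
Qed.

Lemma ae_ln_eq f g : ccontinuous f -> ccontinuous g ->
  {ae mu, forall x, 0 < x -> f (ln x) = g (ln x)} -> forall s, f s = g s.
Proof.
move=> [fr fi] [gr gi] H s; apply: complex_eq.
  by apply: (ae_ln_eq_real fr gr); apply: (ae_imp H) => x E x0; rewrite E.
by apply: (ae_ln_eq_real fi gi); apply: (ae_imp H) => x E x0; rewrite E.
Qed.

(** In the variable ln x a dilation by [a] is the shift by [ln a], and continuity turns the almost
    everywhere relation into one valid for all [s]. *)
Lemma ae_ln_pow (m : R -> R[i]) w (a : R) n : 0 < a -> ccontinuous w ->
  {ae mu, forall x, 0 < x -> m x = w (ln x)} -> aeeq (fun x => m x ^+ n) (fun x => m (a * x)) ->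
  forall s, w (s + ln a) = w s ^+ n.
Proof.
move=> a0 cw mw ma; have an0 : a != 0 by rewrite gt_eqF.
apply: ae_ln_eq; [exact: ccontinuous_shift|exact: ccontinuousX|].
apply: (ae_imp2 (ae_imp2 mw ma (fun x p q => conj p q)) (ae_affine 0 an0 mw)) => x [E1 E2] E3 x0.
by rewrite -E1// E2 -lnM// mulrC -[a * x]addr0 -E3 ?addr0// mulr_gt0.
Qed.

Definition power_symbol (al be x : R) : R[i] := expi (be * `|x| `^ al).

Lemma power_symbol_gt0 al be x : 0 < x -> power_symbol al be x = expi (be * expR (al * ln x)).
Proof. by move=> x0; rewrite /power_symbol gtr0_norm// /powR gt_eqF. Qed.

(** The symbol is found on the positive half-line and carried to the negative one by symmetry. The
    clause [al != 0] rules out constant symbols e^(i be), whose coefficient is defined only modulo 2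
    pi. *)
Lemma power_symbolP T : unitary_operator T -> semistable T -> translation_invariant T ->
  symmetric_operator T -> LUC T ->
  exists al be, al != 0 /\ has_symbol T (power_symbol al be).
Proof.
move=> uT ssT tT symT lucT; have [m [mm m1 Tm]] := unitary_symbol uT tT.
have T2 f : L2 f -> L2 (T f) by exact: unitary_L2.
have [w [wc w1 mw]] := LUC_continuous_symbol T2 mm m1 Tm lucT.
have [a [b [a0 b0 ma mb]]] := semistable_symbol T2 Tm ssT.
have cw := loc_unif_ccontinuous wc.
have wu := ae_ln_pow a0 cw mw ma.
have wv := ae_ln_pow b0 cw mw mb.
have [al [be [al0 wE]]] := unimodular_power_law wc w1 wu wv.
exists al, be; split => //.
suff E : aeeq m (power_symbol al be).
  move=> f f2; apply: aeeq_trans (Tm f f2) _.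
  by apply: (ae_imp E) => x ->.
have n0 : (-1 : R) != 0 by rewrite oppr_eq0 oner_eq0.
have mpos : {ae mu, forall x, 0 < x -> m x = power_symbol al be x}.
  by apply: (ae_imp mw) => x H x0; rewrite H// power_symbol_gt0// wE.
have msym := symmetric_symbol T2 Tm symT.
have mneg := ae_affine 0 n0 mpos.
have m0 : {ae mu, forall x : R, x != 0}.
  exists [set 0]; split; [exact: measurable_set1|exact: lebesgue_measure_set1|].
  by move=> x /= /negP; rewrite negbK => /eqP.
apply: (ae_imp2 (ae_imp2 mpos msym (fun x p q => conj p q)) (ae_imp2 mneg m0 (fun x p q => conj p q))).
move=> x [E1 E2] []; rewrite mulN1r addr0 => E3; rewrite neq_lt => /orP[x0|/E1//].
by rewrite -E2 E3 ?oppr_gt0// /power_symbol normrN.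
Qed.

End power_symbols.

(** * Operator groups *)

Section operator_groups.
Context {R : realType}.
Local Notation mu := (@lebesgue_measure R).
Implicit Types (al be : R).

Lemma aeeq_power_symbol al be al' be' :
  aeeq (power_symbol al be) (power_symbol al' be') ->
  forall s, expi (be * expR (al * s)) = expi (be' * expR (al' * s)).
Proof.
move=> H; apply: ae_ln_eq; try exact/ccontinuous_expi/continuous_exp_scale.
by apply: (ae_imp H) => x E x0; rewrite -!power_symbol_gt0.
Qed.

(** The phase difference is continuous and takes values in 2 pi Z; it therefore equals its value at
    [s = 0]. *)
Lemma power_symbol_comp al1 be1 al2 be2 al3 be3 :
  aeeq (power_symbol al3 be3) (fun x => power_symbol al1 be1 x * power_symbol al2 be2 x) ->
  forall s, be3 * expR (al3 * s) - (be1 * expR (al1 * s) + be2 * expR (al2 * s)) =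
    be3 - (be1 + be2).
Proof.
move=> H; pose h s := be3 * expR (al3 * s) - (be1 * expR (al1 * s) + be2 * expR (al2 * s)).
have c12 : continuous (fun s => be1 * expR (al1 * s) + be2 * expR (al2 * s)).
  by move=> s; apply: cvgD; exact: continuous_exp_scale.
have ch : continuous h by move=> s; apply: cvgB; [exact: continuous_exp_scale|exact: c12].
have E s : expi (be3 * expR (al3 * s)) = expi (be1 * expR (al1 * s) + be2 * expR (al2 * s)).
  move: s; apply: ae_ln_eq; try exact: ccontinuous_expi.
    exact/ccontinuous_expi/continuous_exp_scale.
  by apply: (ae_imp H) => x + x0; rewrite expiD -!power_symbol_gt0.
have h1 s : expi (h s) = 1 by rewrite /h expiD E -expiD addrN expi0.
by move=> s; have := expi1_const ch h1 s; rewrite /h !mulr0 expR0 !mulr1.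
Qed.

(* Taking differences at s = 0, 1, 2, 3 removes the constant; with p = e^al1,
   q = e^al2 the resulting weights X, Y satisfy
   (X + Y) (X p^2 + Y q^2) = (X p + Y q)^2, that is X Y (p - q)^2 = 0. *)
Lemma exponents_eq al1 be1 al2 be2 al3 be3 c : al1 != 0 -> al2 != 0 -> be1 != 0 -> be2 != 0 ->
  (forall s, be3 * expR (al3 * s) - (be1 * expR (al1 * s) + be2 * expR (al2 * s)) = c) ->
  al1 = al2.
Proof.
move=> a1 a2 b1 b2 H; set p := expR al1; set q := expR al2; set r := expR al3.
have eX a n : expR (a * n%:R) = expR a ^+ n :> R.
  by rewrite mulrC expRM_natl.
have H0 := H 0%:R; have H1 := H 1%:R; have H2 := H 2%:R; have H3 := H 3%:R.
rewrite !eX -/p -/q -/r ?expr0 ?expr1 in H0 H1 H2 H3.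
pose X := be1 * (p - 1); pose Y := be2 * (q - 1); pose Z := be3 * (r - 1).
have neq1 a : a != 0 -> expR a - 1 != 0 :> R.
  by move=> a0; rewrite subr_eq0 -expR0; apply: contra_neq a0 => /expR_inj.
have X0 : X != 0 by rewrite mulf_neq0// neq1.
have Y0 : Y != 0 by rewrite mulf_neq0// neq1.
have E0 : Z = X + Y by rewrite /X /Y /Z; lra.
have E1 : Z * r = X * p + Y * q by rewrite /X /Y /Z; lra.
have E2 : Z * r ^+ 2 = X * p ^+ 2 + Y * q ^+ 2 by rewrite /X /Y /Z; lra.
have : X * Y * (p - q) ^+ 2 = 0.
  have -> : X * Y * (p - q) ^+ 2 = (X + Y) * (X * p ^+ 2 + Y * q ^+ 2) - (X * p + Y * q) ^+ 2 by ring.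
  by rewrite -E0 -E1 -E2; ring.
move=> /eqP; rewrite mulf_eq0 (negbTE (mulf_neq0 X0 Y0))/= sqrf_eq0 subr_eq0 => /eqP.
exact: expR_inj.
Qed.

Variable T : R -> (R -> R[i]) -> (R -> R[i]).
Hypotheses (gT : operator_group T) (T2 : forall t f, L2 f -> L2 (T t f)).

Lemma group_symbol (m : R -> R -> R[i]) s t : (forall t, has_symbol (T t) (m t)) ->
  aeeq (m (s + t)) (fun x => m s x * m t x).
Proof.
move=> Tm; apply: (opeq_symbol (@T2 (s + t)) _ (Tm _) (has_symbol_comp (@T2 t) (Tm s) (Tm t))).
  by move=> f f2; apply: T2; exact: T2.
exact: gT.2.
Qed.

Lemma group_exponent :
  (forall t, exists al be, al != 0 /\ has_symbol (T t) (power_symbol al be)) ->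
  exists al (B : R -> R), [/\ al != 0, forall t, has_symbol (T t) (power_symbol al (B t)) &
    forall s t, B (s + t) = B s + B t].
Proof.
move=> /choice[A] /choice[B] AB.
have Asym t : has_symbol (T t) (power_symbol (A t) (B t)) by have [] := AB t.
have A0 t : A t != 0 by have [] := AB t.
have [al [al0 alP]] : exists al, al != 0 /\ forall t, B t != 0 -> A t = al.
  have [[t0 Bt0]|nB] := pselect (exists t, B t != 0); last first.
    (* If every coefficient vanishes, all symbols are 1 and any nonzero exponent serves. *)
    by exists 1; split => [|t Bt]; [exact: oner_neq0|case: nB; exists t].
  exists (A t0); split => // t Bt.
  exact: exponents_eq (power_symbol_comp (group_symbol t t0 Asym)).
have sym t : has_symbol (T t) (power_symbol al (B t)).
  have [B0|/alP <-//] := eqVneq (B t) 0.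
  have := Asym t; rewrite B0; suff -> : power_symbol al 0 = power_symbol (A t) 0 by [].
  by apply/funext => x; rewrite /power_symbol !mul0r.
exists al, B; split => // s t.
(* With a common exponent, comparing [s = 1] with [s = 0] leaves the additivity defect of [B] times
   [expR al - 1], a nonzero factor. *)
have := power_symbol_comp (group_symbol s t sym) 1; rewrite mulr1 => H.
have ne : expR al - 1 != 0 :> R.
  by rewrite subr_eq0 -expR0; apply: contra_neq al0 => /expR_inj.
apply/eqP; rewrite -subr_eq0; apply/eqP/(mulIf ne); rewrite mul0r; lra.
Qed.

End operator_groups.

(** * Lebesgue measurable additive functions are linear *)

Section additive_functions.
Context {R : realType}.
Local Notation mu := (@lebesgue_measure R).
Local Notation mR := (measurableTypeR R).

(** Returns from the completed sigma-algebra to Borel sets, where the properties of [mu] are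
    available, at the price of a negligible set. *)
Lemma completed_measurable_core (E : set R) :
  (completed_algebra_gen mu).-sigma.-measurable E ->
  exists A : set mR, [/\ measurable A, A `<=` E & {ae mu, forall x, E x -> A x}].
Proof.
rewrite g_sigma_completed_algebra_genE => -[A mA [N negN <-]].
exists A; split => //; apply: negligibleS negN => x /= H.
by apply: contrapT => nN; apply: H => -[].
Qed.

(** Continuity of the measure from below: the union has measure at least 1. The threshold 3/4 is the
    one that [overlap_translate] asks for. *)
Lemma ae_cover_measure (F : (set mR)^nat) : (forall n, measurable (F n)) ->
  nondecreasing_seq F -> {ae mu, forall x, x \in `[(0 : R), 1] -> exists n, F n x} ->
  exists n, (((3 / 4 : R)%:E < mu (F n)))%E.
Proof.
move=> mF ndF cov; have mU : measurable (\bigcup_n F n) by exact: bigcupT_measurable.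
have U1 : (1%:E <= mu (\bigcup_n F n))%E.
  have [N [mN N0 NP]] := cov.
  have sub : `[(0 : R), 1]%classic `<=` (\bigcup_n F n) `|` N.
    move=> x /= x01; have [Nx|nN] := pselect (N x); [by right|left].
    have [[n Fn]|nF] := pselect (exists n, F n x); first by exists n.
    by case: nN; apply: NP => /= /(_ x01).
  have m01 : mu `[(0 : R), 1]%classic = 1%:E.
    by rewrite lebesgue_measure_itv/= lte_fin ltr01 oppr0 adde0.
  have /le_trans : (mu `[(0%R : R), 1%R]%classic <= mu ((\bigcup_n F n) `|` N))%E.
    by apply: le_measure => //; rewrite inE//; exact: measurableU.
  rewrite -m01; apply.
  apply: (le_trans (measureU2 _ mU mN)); rewrite le_eqVlt; apply/orP; left; apply/eqP.
  exact: (etrans (congr1 (adde _) N0) (adde0 _)).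
have H : (mu \o F) n @[n --> \oo] --> mu (\bigcup_n F n) by exact: nondecreasing_cvg_mu.
have lt1 : ((3 / 4 : R)%:E < mu (\bigcup_n F n))%E.
  by rewrite (lt_le_trans _ U1)// lte_fin; lra.
apply: contrapT => nF; move: lt1; apply/negP; rewrite -leNgt.
have -> : mu (\bigcup_n F n) = limn (mu \o F) by apply/esym/cvg_lim => //; exact: H.
apply: (lime_le (cvgP _ H)); apply: nearW => n.
by rewrite leNgt; apply/negP => Fn; apply: nF; exists n.
Qed.

(** Steinhaus' argument: were [A] and its translate disjoint, their total measure would exceed 3/2,
    the length of the interval from -1/4 to 5/4 that contains both. *)
Lemma overlap_translate (A : set mR) (x : R) : measurable A -> A `<=` `[(0 : R), 1]%classic ->
  ((3 / 4 : R)%:E < mu A)%E -> `|x| < 1 / 4 -> exists2 a, A a & A (a + x).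
Proof.
move=> mA A01 Ab x4; apply: contrapT => nA.
pose A' : set mR := (fun y : mR => 1 * y + x) @^-1` A.
have mA' : measurable A'.
  by rewrite -[A']setTI; apply: measurable_affine.
have muA' : mu A' = mu A.
  have := lebesgue_measure_affine x (oner_neq0 R) mA.
  by rewrite normr1 mul1e => ->.
have dis : A `&` A' = set0.
  apply/seteqP; split => // y [Ay]; rewrite /A'/= mul1r => Ay'.
  by apply: nA; exists y.
have sub : A `|` A' `<=` `[(- (1 / 4) : R), 5 / 4]%classic.
  move: x4; rewrite ltr_norml => /andP[x1 x2].
  move=> y []; first by move=> /A01; rewrite /= !in_itv/= => /andP[? ?]; lra.
  rewrite /A'/= mul1r => /A01; rewrite /= !in_itv/= => /andP[? ?].
  by apply/andP; split; lra.
have muU : mu (A `|` A') = (mu A + mu A)%E.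
  by rewrite -[X in (_ + X)%E]muA'; exact: measureU.
have : (mu (A `|` A') <= mu `[(- (1 / 4) : R)%R, (5 / 4)%R]%classic)%E.
  by apply: le_measure => //; rewrite inE; [exact: measurableU|exact: measurable_itv].
rewrite muU lebesgue_measure_itv/= lte_fin.
rewrite ifT; last by lra.
by move=> /(lt_le_trans (lteD Ab Ab)); rewrite -!EFinD lte_fin; lra.
Qed.

(** Subtracting [B 1 * t] leaves an additive function of period 1. It is bounded on a period, hence
    everywhere, and a bounded additive function is 0. *)
Lemma additive_bounded_linear (B : R -> R) (M : R) : (forall s t, B (s + t) = B s + B t) ->
  (forall x, `|x| < 1 / 4 -> `|B x| <= M) -> forall t, B t = B 1 * t.
Proof.
move=> BD BM; pose D t := B t - B 1 * t.
have DD s t : D (s + t) = D s + D t by rewrite /D BD; ring.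
have Dn n t : D (n%:R * t) = n%:R * D t.
  elim: n => [|n IH]; last by rewrite -natr1 !mulrDl !mul1r DD IH.
  by rewrite !mul0r; have := DD 0 0; rewrite addr0; lra.
have D1 : period D 1 by move=> s; rewrite DD /D mulr1 subrr addr0.
have Dbound t : `|D t| <= 8 * (M + `|B 1|).
  have [r /andP[r0 r1] ->] := period_reduce t D1 ltr01.
  (* Dividing by 8 brings a point of [0, 1[ into the interval where [B] is bounded. *)
  have -> : r = 8%:R * (r / 8) by field.
  rewrite Dn normrM [`|8%:R|]ger0_norm// ler_pM2l// /D.
  have r8 : `|r / 8| < 1 / 4 by rewrite ger0_norm ?divr_ge0//; lra.
  rewrite (le_trans (ler_normB _ _))// lerD ?BM// normrM ler_piMr//.
  by move: r8; lra.
have D0 t : D t = 0.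
  apply/eqP/negPn/negP => Dt; have Dp : 0 < `|D t| by rewrite normr_gt0.
  have [K _ HK] := nbhs_infty_ger (8 * (M + `|B 1|) / `|D t| + 1).
  have := HK K (leqnn K); rewrite /= => h.
  have := Dbound (K%:R * t); rewrite Dn normrM ger0_norm// -ler_pdivlMr//; lra.
by move=> t; apply/eqP; rewrite -subr_eq0; apply/eqP/D0.
Qed.

Lemma additive_measurable_linear (B : R -> R) : (forall s t, B (s + t) = B s + B t) ->
  lebesgue_measurable_fun B -> forall t, B t = B 1 * t.
Proof.
move=> BD mB; pose E (n : nat) := [set t : R | `|B t| <= n%:R].
have mE n : (completed_algebra_gen mu).-sigma.-measurable (E n).
  have := mB measurableT _ (measurable_itv `[- (n%:R : R), n%:R]).
  rewrite setTI => H; have -> : E n = B @^-1` `[- (n%:R : R), n%:R]%classic.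
    by apply/seteqP; split => t; rewrite /E/= in_itv/= ler_norml.
  exact: H.
have /choice[A HA] : forall n, exists A : set mR, [/\ measurable A, A `<=` E n &
    {ae mu, forall x, E n x -> A x}] by move=> n; exact: completed_measurable_core.
(* The Borel sets [A i] are chosen independently and need not be nested; finite unions restore
   monotonicity. *)
pose F (n : nat) : set mR := `[(0 : R), 1]%classic `&` \bigcup_(i in [set i | (i <= n)%N]) A i.
have mF n : measurable (F n).
  apply: measurableI; first exact: measurable_itv.
  by apply: bigcup_measurable => i _; have [] := HA i.
have ndF : nondecreasing_seq F.
  move=> m n mn; apply/subsetPset => x [x01 [i /= im Aix]]; split => //; exists i => //=.
  exact: leq_trans mn.
have cov : {ae mu, forall x, x \in `[(0 : R), 1] -> exists n, F n x}.
  have H : {ae mu, forall x, forall n, E n x -> A n x}.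
    by apply: (@ae_foralln _ _ _ mu) => n; have [] := HA n.
  apply: (ae_imp H) => x Hx x01; have [K _ HK] := nbhs_infty_ger `|B x|.
  by exists K; split => //; exists K => //=; apply: Hx; exact: (HK K (leqnn K)).
have [n Fn] := ae_cover_measure mF ndF cov.
(* Every small [x] is a difference of two points at which [|B|] is at most [n]. *)
apply: (@additive_bounded_linear B (2 * n%:R)) => // x x4.
have FE t : F n t -> `|B t| <= n%:R.
  case=> _ [i /= im]; have [_ H _] := HA i => /H; rewrite /E/= => h.
  by rewrite (le_trans h)// ler_nat.
have [a /FE Fa /FE Fax] := overlap_translate (mF n) (@subIsetl _ _ _) Fn x4.
have -> : B x = B (a + x) - B a by rewrite BD; ring.
by rewrite (le_trans (ler_normB _ _))//; lra.
Qed.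

End additive_functions.

(** * Measurability of the coefficient from weak measurability *)

Section weak_measurability.
Context {R : realType}.
Local Notation mu := (@lebesgue_measure R).
Local Notation mR := (measurableTypeR R).
Implicit Types (al be : R).

(** Lets the mean of a symbol over a short interval recover its value at the left endpoint. *)
Lemma cint_ind_close (f : R -> R[i]) (a b e : R) : a < b -> cmR f ->
  (forall x, normc (f x) = 1) -> 0 <= e -> (forall y, a <= y <= b -> normc (f y - f a) <= e) ->
  normc (cint (fun y => ind a b y * f y) - (b - a)%:C%C * f a) <= e * (b - a).
Proof.
move=> ab mf f1 e0 H.
have i2 := L2_ind a b.
have g2 : L2 (fun y => (f y - f a) * ind a b y).
  apply: (L2M (k := 2)) => //; first by apply: cmeasB => //; exact: cmeas_cst.
  by move=> y; rewrite (le_trans (normcD _ _))// normcN !f1; lra.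
have h2 : L2 (fun y => e%:C%C * ind a b y) by exact: L2Z.
have -> : cint (fun y => ind a b y * f y) - (b - a)%:C%C * f a =
    cint (fun y => (f y - f a) * ind a b y * ind a b y).
  have j1 : L1 (fun y => ind a b y * f y).
    by apply: (loc_L1_bounded (k := 1) mf) => y; rewrite f1.
  have j2 : L1 (fun y => f a * ind a b y) by apply: L1Z; exact: L1_ind.
  rewrite -cint_ind1 ?ltW// [X in _ - X]mulrC -(cintZ _ (L1_ind a b)) -(cintB j1 j2).
  by apply: eq_cint => y; rewrite -mulrA indM mulrBl mulrC.
rewrite (le_trans (normc_cintM g2 i2))//.
have nE : nrm (ind a b) ^+ 2 = b - a by rewrite nrm_ind// ltW.
rewrite -nE expr2 mulrA ler_wpM2r ?nrm_ge0//.
have := nrmZ e%:C%C i2; rewrite normc_real ger0_norm// => <-.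
apply: nrm_le => // y; rewrite !normcM indE; case: ifPn => yab.
  by rewrite normc_real ger0_norm// ler_wpM2r ?normc_ge0// H.
by have := normc_real (0 : R); rewrite normr0 => ->; rewrite !mulr0.
Qed.

Lemma normc_power_symbol al be x : normc (power_symbol al be x) = 1.
Proof. exact: normc_expi. Qed.

Lemma measurable_power al be : measurable_fun [set: mR] (fun x : R => be * `|x| `^ al).
Proof.
apply: measurable_funM => //; apply: (measurableT_comp (measurable_powR al)).
exact: normr_measurable.
Qed.

Lemma power_symbol_near al be (x e : R) : 0 < x -> 0 < e ->
  exists2 d, 0 < d & forall y, x <= y <= x + d ->
    normc (power_symbol al be y - power_symbol al be x) <= e.
Proof.
move=> x0 e0; pose h (y : R) := be * expR (al * ln y).
have ch : h y @[y --> x] --> h x.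
  apply: (@continuous_comp _ _ _ (@ln R) (fun s => be * expR (al * s))).
    exact: continuous_ln.
  exact: continuous_exp_scale.
have cc : cos (h y) @[y --> x] --> cos (h x).
  exact: (@continuous_comp _ _ _ h (@cos R) x ch (@continuous_cos R _)).
have cs : sin (h y) @[y --> x] --> sin (h x).
  exact: (@continuous_comp _ _ _ h (@sin R) x ch (@continuous_sin R _)).
have e20 : 0 < e / 2 by rewrite divr_gt0.
have /cvgrPdistC_lt/(_ _ e20)[d1 /= d10 H1] := cc.
have /cvgrPdistC_lt/(_ _ e20)[d2 /= d20 H2] := cs.
exists (Num.min d1 d2 / 2) => [|y /andP[xy yx]].
  by rewrite divr_gt0// lt_min d10.
have y0 : 0 < y by exact: lt_le_trans xy.
have m0 : 0 < Num.min d1 d2 by rewrite lt_min d10.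
have : `|x - y| < Num.min d1 d2 by rewrite distrC ger0_norm ?subr_ge0//; lra.
rewrite lt_min => /andP[/H1/= h1 /H2/= h2].
rewrite !power_symbol_gt0// (le_trans (normc_le _))// ReB ImB/=.
by rewrite -/(h x) -/(h y); lra.
Qed.

(** These are the difference quotients at 0 of [sin (c * x)], whose derivative there is [c]. *)
Lemma sin_quotient_cvg (c : R) : n.+1%:R * sin (c / n.+1%:R) @[n --> \oo] --> c.
Proof.
have D : is_derive (0 : R) 1 (fun x => sin (c * x)) c.
  have Dc : is_derive (0 : R) 1 (fun x => c * x) c.
    by apply: is_derive_eq; rewrite /GRing.scale/= mulr1.
  have := @is_derive1_comp R (@sin R) (fun x => c * x) 0 _ _ (is_derive_sin _) Dc.
  by rewrite mulr0 cos0 mul1r.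
have [/cvg_ex[l Hl] lE] : derivable (fun x => sin (c * x)) (0 : R) 1 /\ 'D_1 (fun x => sin (c * x)) (0 : R) = c.
  by split; [exact: ex_derive|exact: derive_val].
have {lE} lc : l = c by rewrite -lE; apply/esym/cvg_lim.
rewrite lc in Hl.
have cv : n.+1%:R^-1 @[n --> \oo] --> (0 : R)^'.
  move=> B [d /= d0 Hd]; have /cvgrPdist_lt/(_ _ d0)[K _ HK] := @cvg_harmonic R.
  by exists K => // n /HK Kn; apply: Hd => //=; rewrite invr_eq0 pnatr_eq0.
have := cvg_comp _ _ cv Hl; apply: cvg_trans.
apply: near_eq_cvg; apply: nearW => n /=.
by rewrite /GRing.scale/= mulr1 addr0 mulr0 sin0 subr0 invrK.
Qed.

Variables (T : R -> (R -> R[i]) -> (R -> R[i])) (al : R) (B : R -> R).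
Hypotheses (T2 : forall t f, L2 f -> L2 (T t f)) (al0 : al != 0).
Hypothesis Tsym : forall t, has_symbol (T t) (power_symbol al (B t)).
Hypothesis Tmeas : weakly_measurable T.

Lemma inner_symbol_ind (f : R -> R[i]) (a b t : R) : L2 f -> aeeq (fourier f) (ind a b) ->
  inner (T t f) f = cint (fun x => ind a b x * power_symbol al (B t) x).
Proof.
move=> f2 fE; have Tf2 := @T2 t f f2.
have p2 : L2 (fun x => power_symbol al (B t) x * ind a b x).
  exact: (L2_expiM (measurable_power al (B t)) (L2_ind a b)).
have E1 : aeeq (fourier (T t f)) (fun x => power_symbol al (B t) x * ind a b x).
  by apply: (ae_imp2 (Tsym t f2) fE) => x -> ->.
have E2 : aeeq (fun x => conjc (fourier f x)) (ind a b).
  by apply: (ae_imp fE) => x ->; rewrite conj_ind.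
have := fourier_inner Tf2 f2; rewrite /inner -!/(cint _) => <-.
rewrite (cint_aeM (L2_fourier Tf2) p2 (L2_conj (L2_fourier f2)) (L2_ind a b) E1 E2).
by apply: eq_cint => x; rewrite -mulrA indM mulrC.
Qed.

(** As [al] is nonzero, [x] is the power y^al of some positive [y]. Taking for [f] a preimage of the
    indicator of a short interval to the right of [y], the coefficient [inner (T t f) f] divided by
    the length of the interval is a mean of the symbol, and tends to its value at [y]. *)
Lemma measurable_sin_exponent (x : R) : 0 < x ->
  lebesgue_measurable_fun (fun t => sin (B t * x)).
Proof.
move=> x0; pose y := expR (ln x / al).
have y0 : 0 < y by exact: expR_gt0.
have yE t : Im (power_symbol al (B t) y) = sin (B t * x).
  by rewrite power_symbol_gt0// /y expRK (mulrC al) divfK// lnK.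
pose A (n : nat) : g_sigma_algebraType (completed_algebra_gen mu) -> R := fun t => n.+1%:R *
  Im (cint (fun z => ind y (y + n.+1%:R^-1) z * power_symbol al (B t) z)).
apply: (measurable_fun_cvg (h := A)) => [n|t _].
  apply: measurable_funM => //.
  have [f f2 fE] := fourier_surj (L2_ind y (y + n.+1%:R^-1)).
  rewrite (_ : (fun t => _) = (fun t => Im (inner (T t f) f))).
    exact: (Tmeas f2 f2).2.
  by apply/funext => t; rewrite (inner_symbol_ind t f2 fE).
rewrite -yE; apply/cvgrPdistC_le => e e0.
have [d d0 Hd] := power_symbol_near al (B t) y0 e0.
have /cvgrPdist_lt/(_ _ d0)[K _ HK] := @cvg_harmonic R.
exists K => // n /HK /=; rewrite sub0r normrN => nd.
have np : 0 < n.+1%:R^-1 :> R by rewrite invr_gt0.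
rewrite gtr0_norm// in nd.
have yn : y < y + n.+1%:R^-1 by rewrite ltrDl.
have := @cint_ind_close (power_symbol al (B t)) y (y + n.+1%:R^-1) e yn _ (normc_power_symbol _ _) (ltW e0).
move=> /(_ (cmeas_expi (measurable_power _ _))).
have H z : y <= z <= y + n.+1%:R^-1 -> normc (power_symbol al (B t) z - power_symbol al (B t) y) <= e.
  by move=> /andP[z1 z2]; apply: Hd; rewrite z1 (le_trans z2)// lerD2l ltW.
move=> /(_ H); rewrite addrAC subrr add0r.
set I := cint _; move=> Hc.
have := le_trans (ler_Im _) Hc.
rewrite ImB ImM/= mul0r addr0 -ler_pdivrMr// invrK mulrC -[X in X * `|_|](@gtr0_norm _ n.+1%:R)// -normrM.
by rewrite mulrBr mulVKf.
Qed.

(** A single [x] shows [B t * x] only through its sine; letting [x] tend to 0 recovers [B t] without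
    ambiguity. *)
Lemma measurable_exponent : lebesgue_measurable_fun B.
Proof.
pose A (n : nat) : g_sigma_algebraType (completed_algebra_gen mu) -> R :=
  fun t => n.+1%:R * sin (B t / n.+1%:R).
apply: (measurable_fun_cvg (h := A)) => [n|t _].
  by apply: measurable_funM => //; apply: measurable_sin_exponent; rewrite invr_gt0.
exact: sin_quotient_cvg.
Qed.

End weak_measurability.

Section power_symbol_uniqueness.
Context {R : realType}.
Implicit Types (al be : R) (T : R -> (R -> R[i]) -> (R -> R[i])).

Lemma expi_char_inj (x y : R) : (forall t, expi (x * t) = expi (y * t)) -> x = y.
Proof.
move=> H; apply/eqP; rewrite -subr_eq0; apply/negPn/negP => xy.
(* At this [t] the ratio of the two sides is e^(i pi) = -1. *)
have := H (pi / (x - y)) => /(congr1 (fun z => z * expi (- (y * (pi / (x - y)))))).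
rewrite -!expiD addrN expi0 -mulrBl mulrC divfK// => /(congr1 (@complex.Re R)) /=.
by rewrite cospi; lra.
Qed.

(** For fixed [s], the group parameter [t] runs through a character whose frequency
    [be * expR (al * s)] is determined. The value [s = 0] gives [be], which is nonzero for a
    nontrivial group, and [s = 1] then gives [al]. *)
Lemma power_symbol_unique T al be al' be' :
  (forall t f, L2 f -> L2 (T t f)) -> (exists t, ~ opeq (T t) id) ->
  has_power_symbol T al be -> has_power_symbol T al' be' -> al = al' /\ be = be'.
Proof.
move=> T2 [t0 nt0] H H'.
have E s : be * expR (al * s) = be' * expR (al' * s).
  apply: expi_char_inj => t; rewrite ![_ * _ * t]mulrAC.
  move: s; apply: aeeq_power_symbol; apply: symbol_unique => f f2.
  exact: aeeq_trans (aeeq_sym (H f t f2)) (H' f t f2).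
have bb : be = be' by have := E 0; rewrite !mulr0 expR0 !mulr1.
split => //; have be0 : be != 0.
  apply: contra_notN nt0 => /eqP b0 f f2.
  apply: (fourier_inj (T2 _ _ f2) f2); apply: (ae_imp (H f t0 f2)) => x ->.
  by rewrite b0 !mul0r expi0 mul1r.
have := E 1; rewrite -bb !mulr1 => /(mulfI be0); exact: expR_inj.
Qed.

End power_symbol_uniqueness.

Theorem theorem1p2 (R : realType) (T : R -> (R -> R[i]) -> (R -> R[i])) :
  operator_group T ->
  weakly_measurable T ->
  (forall t, unitary_operator (T t)) ->
  (forall t, [/\ semistable (T t), translation_invariant (T t),
                 symmetric_operator (T t) & LUC (T t)]) ->
  (exists alpha beta : R, has_power_symbol T alpha beta) /\
  ((exists t : R, ~ opeq (T t) id) ->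
   forall alpha beta alpha' beta' : R,
     has_power_symbol T alpha beta -> has_power_symbol T alpha' beta' ->
     alpha = alpha' /\ beta = beta').
Proof.
move=> gT mT uT hT.
have T2 t f : L2 f -> L2 (T t f) by exact: unitary_L2.
split; last by move=> nt al be al' be'; exact: power_symbol_unique.
have Tpow t : exists al be, al != 0 /\ has_symbol (T t) (power_symbol al be).
  by have [] := hT t; exact: power_symbolP.
have [al [B [al0 BT BD]]] := group_exponent gT T2 Tpow.
have BE := additive_measurable_linear BD (measurable_exponent T2 al0 BT mT).
exists al, (B 1) => f t f2.
by apply: (ae_imp (BT t f f2)) => x ->; rewrite /power_symbol BE.
Qed.
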